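(* Let $\mathfrak{g}$ be a basic simple $\mathbb{Z}_2\times\mathbb{Z}_2$-graded Lie algebra with self-centralizing Cartan subalgebra $\mathfrak{t}$, let $\Delta$ be its root system with respect to $\mathfrak{t}$, and fix a positive system $\Delta^+\subset\Delta$. The set of equivalence classes of irreducible finite-dimensional representations of $\mathfrak{g}$ (not necessarily graded) is parametrized by the dominant integral elements of $\mathfrak{t}^*$; that is, assigning to each irreducible finite-dimensional representation its highest weight induces a bijection from the set of equivalence classes of irreducible finite-dimensional representations of $\mathfrak{g}$ onto the set of dominant integral elements of $\mathfrak{t}^*$.
   Context: Everything is over $\mathbb{C}$ and $\mathfrak{g}$ is finite-dimensional. For $a=(a_1,a_2),b=(b_1,b_2)\in\mathbb{Z}_2\times\mathbb{Z}_2$ put $ab:=a_1b_2-a_2b_1\in\mathbb{Z}_2$. A $\mathbb{Z}_2\times\mathbb{Z}_2$-graded Lie algebra is a $\mathbb{Z}_2\times\mathbb{Z}_2$-graded vector space $\mathfrak{g}=\bigoplus_{a}\mathfrak{g}^a$ with a bilinear bracket such that $[\mathfrak{g}^a,\mathfrak{g}^b]\subseteq\mathfrak{g}^{a+b}$; $[x,y]=-(-1)^{ab}[y,x]$ for $x\in\mathfrak{g}^a,y\in\mathfrak{g}^b$; and $[x,[y,z]]=[[x,y],z]+(-1)^{ab}[y,[x,z]]$ for $x\in\mathfrak{g}^a,y\in\mathfrak{g}^b,z\in\mathfrak{g}$. In particular $\mathfrak{g}^{(0,0)}$ is an ordinary Lie algebra. $\mathfrak{g}$ is simple if it is nonzero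 and has no graded ideals other than $\{0\}$ and $\mathfrak{g}$. The Killing form is $K(x,y)=\mathrm{tr}(\mathrm{ad}\,x\circ\mathrm{ad}\,y)$, where $\mathrm{ad}(x)(y)=[x,y]$. $\mathfrak{g}$ is basic if $K$ is nondegenerate and $\mathfrak{g}^{(0,0)}$ is reductive. A Cartan subalgebra $\mathfrak{t}$ of $\mathfrak{g}$ means a Cartan subalgebra of the reductive Lie algebra $\mathfrak{g}^{(0,0)}$. It is self-centralizing if $\{x\in\mathfrak{g}\mid[x,\mathfrak{t}]=\{0\}\}=\mathfrak{t}$. For $\alpha\in\mathfrak{t}^*$ let $\mathfrak{g}_\alpha=\{x\in\mathfrak{g}\mid \forall h\in\mathfrak{t}\ \exists n>0:\ (\mathrm{ad}(h)-\alpha(h)\mathrm{Id})^n x=0\}$, and let $\Delta$ be the set of nonzero $\alpha\in\mathfrak{t}^*$ with $\mathfrak{g}_\alpha\neq\{0\}$. The restriction of $K$ to $\mathfrak{t}$ is nondegenerate; for $\alpha\in\mathfrak{t}^*$ let $H_\alpha\in\mathfrak{t}$ be the unique element with $\alpha(H)=K(H_\alpha,H)$ for all $H\in\mathfrak{t}$, and set $\langle\alpha,\beta\rangle:=K(H_\alpha,H_\beta)$. The set $\Delta$ is an abstract root system (in the real span of $\Delta$, on which $\langle\cdot,\cdot\rangle$ is positive definite), so positive systems make sense. An element $\lambda\in\mathfrak{t}^*$ is integral if $2\langle\lambda,\alpha\rangle/\langle\alpha,\alpha\rangle\in\mathbb{Z}$ for all $\alpha\in\Delta$, and dominant if $2\langle\lambda,\alpha\rangle/\langle\alpha,\alpha\rangle\geq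 0$ for all $\alpha\in\Delta^+$. A representation of $\mathfrak{g}$ on a vector space $V$ is a linear map $\varphi:\mathfrak{g}\to\mathrm{End}(V)$ with $\varphi([x,y])=\varphi(x)\varphi(y)-(-1)^{ab}\varphi(y)\varphi(x)$ for $x\in\mathfrak{g}^a,y\in\mathfrak{g}^b$; $V$ is not assumed graded. Two representations are equivalent if there is a $\mathfrak{g}$-equivariant linear isomorphism between them. A weight of $V$ is $\mu\in\mathfrak{t}^*$ with $V_\mu=\{v\in V\mid hv=\mu(h)v\ \forall h\in\mathfrak{t}\}\neq 0$. The highest weight of an irreducible finite-dimensional $V$ is the unique weight $\lambda$ of $V$ such that every weight of $V$ has the form $\lambda-\sum_{\alpha\in\Delta^+}n_\alpha\alpha$ with $n_\alpha$ nonnegative integers. *)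

(* Defs.v *)
(* The field of complex numbers is R[i], for R : realType. *)
From mathcomp Require Import all_boot all_order all_algebra.
From mathcomp Require Import complex.
From mathcomp Require Import all_classical reals.

Set Implicit Arguments.
Unset Strict Implicit.
Unset Printing Implicit Defensive.

Import Order.TTheory GRing.Theory Num.Theory.
Local Open Scope ring_scope.
Local Open Scope classical_set_scope.
Local Open Scope complex_scope.

Notation degree := ('Z_2 * 'Z_2)%type.

Definition pairing (a b : degree) : 'Z_2 := a.1 * b.2 - a.2 * b.1.

(* The residue [pairing a b] is read as 0 or 1 in nat. *)
Definition sign (F : fieldType) (a b : degree) : F := (-1) ^+ (pairing a b).

(* The bracket is packaged as the linear map ad : g -> End(g), so that
   [x, y] is [ad x y] and bilinearity is part of its type. *)
Record gradedLieAlgebra (F : fieldType) := GradedLieAlgebra {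
  carrier :> vectType F;
  component : degree -> {vspace carrier};
  ad : 'Hom(carrier, 'End(carrier));
  component_full : (\sum_(a : degree) component a)%VS = fullv;
  component_direct : directv (\sum_(a : degree) component a)%VS;
  ad_graded : forall a b x y, x \in component a -> y \in component b ->
    ad x y \in component (a + b);
  ad_antisym : forall a b x y, x \in component a -> y \in component b ->
    ad x y = - (sign F a b *: ad y x);
  ad_jacobi : forall a b x y z, x \in component a -> y \in component b ->
    ad x (ad y z) = ad (ad x y) z + sign F a b *: ad y (ad x z)
}.

Definition even_part (F : fieldType) (g : gradedLieAlgebra F) : {vspace g} :=
  component g 0.

Definition graded_subspace (F : fieldType) (g : gradedLieAlgebra F)
    (I : {vspace g}) : Prop :=
  (\sum_(a : degree) (I :&: component g a))%VS = I.

(* For a graded subspace, left and right ideals coincide by ad_antisym. *)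
Definition graded_ideal (F : fieldType) (g : gradedLieAlgebra F)
    (I : {vspace g}) : Prop :=
  graded_subspace I /\ forall x y : g, y \in I -> ad g x y \in I.

Definition simple (F : fieldType) (g : gradedLieAlgebra F) : Prop :=
  (fullv : {vspace g}) <> 0%VS /\
  forall I : {vspace g}, graded_ideal I -> I = 0%VS \/ I = fullv.

Definition endo_trace (F : fieldType) (V : vectType F) (f : 'End(V)) : F :=
  \tr (passmx.mxof (vbasis fullv) (vbasis fullv) f).

Definition killing (F : fieldType) (g : gradedLieAlgebra F) (x y : g) : F :=
  endo_trace (ad g x \o ad g y)%VF.

Definition ideal_of (F : fieldType) (g : gradedLieAlgebra F)
    (I U : {vspace g}) : Prop :=
  (I <= U)%VS /\ forall x y : g, x \in U -> y \in I -> ad g x y \in I.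

(* Reductive: every ideal has a complementary ideal. Only used for
   U = even_part g, where [ad] is an ordinary Lie bracket. *)
Definition reductive (F : fieldType) (g : gradedLieAlgebra F)
    (U : {vspace g}) : Prop :=
  forall I : {vspace g}, ideal_of I U ->
  exists J : {vspace g},
    [/\ ideal_of J U, (I + J)%VS = U & (I :&: J)%VS = 0%VS].

Definition basic (F : fieldType) (g : gradedLieAlgebra F) : Prop :=
  (forall x : g, (forall y : g, killing x y = 0) -> x = 0) /\
  reductive (even_part g).

(* By bilinearity this is the span of all brackets [x, y], x in U, y in V. *)
Definition bracket_space (F : fieldType) (g : gradedLieAlgebra F)
    (U V : {vspace g}) : {vspace g} :=
  <<[seq ad g x y | x <- vbasis U, y <- vbasis V]>>%VS.

Definition lower_central (F : fieldType) (g : gradedLieAlgebra F)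
    (U : {vspace g}) (n : nat) : {vspace g} :=
  iter n (bracket_space U) U.

(* Cartan subalgebra of the Lie algebra g^(0,0): a nilpotent subalgebra equal
   to its normalizer in g^(0,0). *)
Definition cartan_subalgebra (F : fieldType) (g : gradedLieAlgebra F)
    (t : {vspace g}) : Prop :=
  [/\ (t <= even_part g)%VS,
      forall x y : g, x \in t -> y \in t -> ad g x y \in t,
      exists n : nat, lower_central t n = 0%VS &
      forall x : g, x \in even_part g ->
        (forall h : g, h \in t -> ad g x h \in t) -> x \in t].

Definition self_centralizing (F : fieldType) (g : gradedLieAlgebra F)
    (t : {vspace g}) : Prop :=
  forall x : g, (forall h : g, h \in t -> ad g x h = 0) <-> x \in t.

Definition dual_space (F : fieldType) (g : gradedLieAlgebra F) (t : {vspace g}) :=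
  'Hom(subvs_of t, F^o).

Definition root_vector (F : fieldType) (g : gradedLieAlgebra F)
    (t : {vspace g}) (alpha : dual_space t) : set g :=
  [set x | forall h : subvs_of t, exists2 n : nat, (0 < n)%N &
     iter n (fun y => ad g (vsval h) y - (alpha h : F) *: y) x = 0].

Definition roots (F : fieldType) (g : gradedLieAlgebra F)
    (t : {vspace g}) : set (dual_space t) :=
  [set alpha | alpha != 0 /\ exists2 x : g, x != 0 & root_vector alpha x].
Arguments roots {F g} t.

(* H_alpha; the defining condition determines it uniquely when the Killing
   form is nondegenerate on t (the default value 0 is then not used). *)
Definition coroot_vector (F : fieldType) (g : gradedLieAlgebra F)
    (t : {vspace g}) (alpha : dual_space t) : subvs_of t :=
  xget 0 [set H : subvs_of t | forall h : subvs_of t,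
            alpha h = killing (vsval H) (vsval h)].

Definition dual_form (F : fieldType) (g : gradedLieAlgebra F)
    (t : {vspace g}) (alpha beta : dual_space t) : F :=
  killing (vsval (coroot_vector alpha)) (vsval (coroot_vector beta)).

Definition real_span (R : realType) (V : lmodType R[i]) (A : set V) : set V :=
  [set v | exists s : seq (R * V),
     (forall p, p \in s -> A p.2) /\ v = \sum_(p <- s) p.1%:C *: p.2].

(* A notion of positivity on a real vector space W, that is, the set of
   positive elements of a total order compatible with the vector space
   structure. *)
Definition positivity (R : realType) (V : lmodType R[i]) (W P : set V) : Prop :=
  [/\ forall v, W v -> v != 0 -> (P v \/ P (- v)) /\ ~ (P v /\ P (- v)),
      forall v w, W v -> W w -> P v -> P w -> P (v + w) &
      forall (c : R) v, 0 < c -> W v -> P v -> P (c%:C *: v)].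

Definition positive_system (R : realType) (g : gradedLieAlgebra R[i])
    (t : {vspace g}) (Dp : set (dual_space t)) : Prop :=
  exists2 P : set (dual_space t),
    positivity (real_span (roots t)) P & Dp = roots t `&` P.

Definition integral (R : realType) (g : gradedLieAlgebra R[i])
    (t : {vspace g}) (lambda : dual_space t) : Prop :=
  forall alpha : dual_space t, roots t alpha ->
  exists m : int, 2 * dual_form lambda alpha / dual_form alpha alpha = m%:~R.

Definition dominant (R : realType) (g : gradedLieAlgebra R[i])
    (t : {vspace g}) (Dp : set (dual_space t)) (lambda : dual_space t) : Prop :=
  forall alpha : dual_space t, Dp alpha ->
  0 <= 2 * dual_form lambda alpha / dual_form alpha alpha.

Definition dominant_integral (R : realType) (g : gradedLieAlgebra R[i])
    (t : {vspace g}) (Dp : set (dual_space t)) : set (dual_space t) :=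
  [set lambda | dominant Dp lambda /\ integral lambda].

Record representation (F : fieldType) (g : gradedLieAlgebra F) :=
  Representation {
    rep_space : vectType F;
    rep_map :> 'Hom(g, 'End(rep_space));
    rep_bracket : forall a b x y,
      x \in component g a -> y \in component g b ->
      rep_map (ad g x y) = (rep_map x \o rep_map y)%VF
                           - sign F a b *: (rep_map y \o rep_map x)%VF
  }.

Definition irreducible (F : fieldType) (g : gradedLieAlgebra F)
    (rho : representation g) : Prop :=
  (fullv : {vspace rep_space rho}) <> 0%VS /\
  forall U : {vspace rep_space rho},
    (forall (x : g) v, v \in U -> rho x v \in U) -> U = 0%VS \/ U = fullv.

Definition rep_equiv (F : fieldType) (g : gradedLieAlgebra F)
    (rho sigma : representation g) : Prop :=
  exists2 f : 'Hom(rep_space rho, rep_space sigma),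
    bijective f & forall (x : g) v, f (rho x v) = sigma x (f v).

Definition is_weight (F : fieldType) (g : gradedLieAlgebra F)
    (t : {vspace g}) (rho : representation g) (mu : dual_space t) : Prop :=
  exists2 v : rep_space rho, v != 0 &
    forall h : subvs_of t, rho (vsval h) v = (mu h : F) *: v.

(* The sum over Dp is a finite-support sum; Dp, a set of roots, is finite. *)
Definition is_highest_weight (F : fieldType) (g : gradedLieAlgebra F)
    (t : {vspace g}) (Dp : set (dual_space t)) (rho : representation g)
    (lambda : dual_space t) : Prop :=
  is_weight rho lambda /\
  forall mu : dual_space t, is_weight rho mu ->
  exists n : dual_space t -> nat,
    mu = lambda - \sum_(alpha \in Dp) (alpha *+ n alpha).

(* The assignment rho |-> hw rho on irreducible representations descends to a
   bijection from the set of equivalence classes onto A: it takes values in A,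
   is constant on classes, separates them, and is onto. *)
Definition induces_bijection_on_classes (F : fieldType)
    (g : gradedLieAlgebra F) (T : Type) (A : set T)
    (hw : representation g -> T) : Prop :=
  [/\ forall rho, irreducible rho -> A (hw rho),
      forall rho sigma, irreducible rho -> irreducible sigma ->
        rep_equiv rho sigma -> hw rho = hw sigma,
      forall rho sigma, irreducible rho -> irreducible sigma ->
        hw rho = hw sigma -> rep_equiv rho sigma &
      forall a, A a -> exists2 rho, irreducible rho & hw rho = a].

(* Main.v *)
From HB Require Import structures.
From mathcomp Require Import all_boot all_order all_algebra.
From mathcomp Require Import complex.
From mathcomp Require Import all_classical reals.
From mathcomp Require Import ring zify.
Require Import Defs.

Set Implicit Arguments.
Unset Strict Implicit.
Unset Printing Implicit Defensive.

Import Order.TTheory GRing.Theory Num.Theory.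
Local Open Scope ring_scope.

(** Up to signs, [g] behaves like an ordinary semisimple Lie algebra, and the
    theorem of the highest weight holds for it; the Killing form gives all the
    structure that is needed.

    Structure. The operators [ad h], for [h] in [t], commute, so [g] is the sum of
    joint generalized weight spaces. As [t] is its own centralizer, the space of
    weight zero is [t] ([gen_zero_weight]); as the Killing form is invariant and
    nondegenerate, [t] acts diagonally ([ad_t_diagonal]). This gives a homogeneous
    basis of root vectors ([root_basis]). The Killing form pairs opposite root
    spaces degree by degree, and two vectors of the same degree have an ordinary
    commutator; so each root lies in a copy of sl2 ([root_triple]). The theory of
    sl2 gives one-dimensional root spaces, integrality, and the stability of the
    roots under reflections.

    Injectivity. An irreducible finite-dimensional representation contains a weight
    vector killed by the positive root vectors ([singular_exists]) and is generated
    from it by the negative root vectors, so that its weight is the highest weight;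
    sl2 makes it dominant and integral ([highest_weight_dominant]). If two
    irreducible representations have the same highest weight, the submodule of
    their direct sum generated by the pair of highest weight vectors is the graph of
    an isomorphism ([equiv_of_singular]).

    Surjectivity. A module of highest weight [chi] is found among the linear
    functionals on the enveloping algebra. Functionals on the free algebra form a
    commutative algebra for the shuffle product, and those that vanish on the
    relations of an enveloping algebra form a subalgebra ([envelopingM]). For these
    relations to be those of an ordinary Lie algebra, the bracket is first
    multiplied by a bicharacter of the grading group that absorbs the signs
    ([twist]). Call a functional [f] with value 1 at 1 a highest weight functional of
    weight [chi] if [f(u e) = 0] for positive root vectors [e] and
    [f(u h) = chi(h) f(u)] for [h] in [t]. Products of such functionals add the
    weights, and complex powers, given by the binomial series, multiply them by
    scalars; so the weights that occur form a subspace of the dual of [t]. It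
    contains each root, as a difference of weights of minors of the adjoint
    representation, hence every [chi] ([verma_exists]). Untwisted and restricted to
    words of weight zero, the functional generates an irreducible module of highest
    weight [chi] under right translation ([highest_weight_module]).

    When [chi] is dominant and integral, this module contains a lowest weight
    vector, reached from the highest one by walking from the positive system to its
    opposite through reflections in simple roots ([lowest_vector]). Hence the
    negative root vectors act locally nilpotently, and as they generate the module
    from one vector it is finite-dimensional ([finite_span]). *)

(** * Commuting operators and joint generalized eigenvectors *)

Section Sums.
Variables (F : fieldType) (M : lmodType F).

Definition subsp (Q : M -> Prop) :=
  Q 0 /\ forall a u v, Q u -> Q v -> Q (a *: u + v).

Lemma subspD Q u v : subsp Q -> Q u -> Q v -> Q (u + v).
Proof. by move=> [_ h] Qu Qv; have := h 1 u v Qu Qv; rewrite scale1r. Qed.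

Lemma subspZ Q a u : subsp Q -> Q u -> Q (a *: u).
Proof. by move=> [h0 h] Qu; have := h a u 0 Qu h0; rewrite addr0. Qed.

Lemma subspN Q u : subsp Q -> Q u -> Q (- u).
Proof. by move=> hQ Qu; rewrite -scaleN1r; exact: subspZ. Qed.

Lemma subspB Q u v : subsp Q -> Q u -> Q v -> Q (u - v).
Proof. by move=> hQ Qu Qv; apply: subspD => //; exact: subspN. Qed.

Lemma subsp_sum (Q : M -> Prop) (I : Type) (r : seq I) (p : pred I)
    (f : I -> M) :
  subsp Q -> (forall i, p i -> Q (f i)) -> Q (\sum_(i <- r | p i) f i).
Proof. by move=> hQ hf; apply: big_ind => //; [case: hQ|move=> *; exact: subspD]. Qed.

Lemma subsp0 : subsp (fun u : M => u = 0).
Proof. by split=> // a u v -> ->; rewrite scaler0 addr0. Qed.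

Definition sum_of (pr : M -> Prop) (x : M) :=
  exists2 s : seq M, x = \sum_(y <- s) y & forall y, y \in s -> pr y.

Lemma sum_of0 pr : sum_of pr 0.
Proof. by exists [::] => //; rewrite big_nil. Qed.

Lemma sum_of1 (pr : M -> Prop) x : pr x -> sum_of pr x.
Proof. by exists [:: x]; rewrite ?big_seq1 // => y; rewrite inE => /eqP ->. Qed.

Lemma sum_ofD pr x y : sum_of pr x -> sum_of pr y -> sum_of pr (x + y).
Proof.
move=> [s -> hs] [s' -> hs']; exists (s ++ s'); first by rewrite big_cat.
by move=> z; rewrite mem_cat => /orP[/hs|/hs'].
Qed.

Lemma sum_of_sum pr (I : eqType) (r : seq I) (f : I -> M) :
  (forall i, i \in r -> sum_of pr (f i)) -> sum_of pr (\sum_(i <- r) f i).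
Proof.
move=> hf; rewrite big_seq_cond; apply: big_ind => [||i]; first exact: sum_of0.
  exact: sum_ofD.
by rewrite andbT => /hf.
Qed.

Lemma sum_of_bind (pr pr' : M -> Prop) x :
  (forall y, pr y -> sum_of pr' y) -> sum_of pr x -> sum_of pr' x.
Proof. by move=> h [s -> hs]; apply: sum_of_sum => i /hs /h. Qed.

Lemma sum_of_ind (pr Q : M -> Prop) x :
  subsp Q -> (forall y, pr y -> Q y) -> sum_of pr x -> Q x.
Proof.
move=> hQ h [s -> hs]; rewrite big_seq_cond.
by apply: subsp_sum => // i; rewrite andbT => /hs /h.
Qed.

Lemma iterZ (f : {linear M -> M}) n a u : iter n f (a *: u) = a *: iter n f u.
Proof. by elim: n => //= n ->; rewrite linearZ. Qed.

Lemma iter0 (f : {linear M -> M}) n : iter n f 0 = 0.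
Proof. by elim: n => //= n ->; rewrite linear0. Qed.

Lemma iter_addv (f : {linear M -> M}) n u v : iter n f (u + v) = iter n f u + iter n f v.
Proof. by elim: n => //= n ->; rewrite linearD. Qed.

Lemma iter_sum (f : {linear M -> M}) n (I : Type) (r : seq I) (p : pred I)
    (g : I -> M) :
  iter n f (\sum_(i <- r | p i) g i) = \sum_(i <- r | p i) iter n f (g i).
Proof. by apply: (big_morph _ (iter_addv f n)); exact: iter0. Qed.

Lemma iter_wide (f : {linear M -> M}) m n u :
  (m <= n)%N -> iter m f u = 0 -> iter n f u = 0.
Proof. by move=> /subnK <- hm; rewrite iterD hm iter0. Qed.

End Sums.

Section Shift.
Variables (F : fieldType) (M : lmodType F).

Definition shift (B : {linear M -> M}) (c : F) (u : M) : M := B u - c *: u.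

Lemma shift_linear B c : linear (shift B c).
Proof.
by move=> a u v; rewrite /shift linearP scalerDr scalerBr !scalerA [c * a]mulrC opprD addrACA.
Qed.

HB.instance Definition _ B c :=
  GRing.isLinear.Build F M M _ (shift B c) (shift_linear B c).

Lemma iter_comm (f g : M -> M) n u :
  (forall v, f (g v) = g (f v)) -> iter n f (g u) = g (iter n f u).
Proof. by move=> h; elim: n => //= n ->. Qed.

Lemma shift_comm (B B' : {linear M -> M}) c d u :
  (forall v, B (B' v) = B' (B v)) ->
  shift B c (shift B' d u) = shift B' d (shift B c u).
Proof.
move=> h; rewrite /shift [B (_ - _)]linearB [B' (_ - _)]linearB.
rewrite [B (_ *: _)]linearZ [B' (_ *: _)]linearZ /= h !scalerBr !scalerA.
rewrite (mulrC c d) !opprB !addrA addrAC [RHS]addrAC; congr (_ + _).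
by rewrite addrAC.
Qed.

(** On the generalized eigenvectors for [d] the operator [B - c] is invertible
    when [c != d]: this is injectivity, [shift_solve] is surjectivity. *)
Lemma shift_coprime B c d m n u : c != d ->
  iter m (shift B c) u = 0 -> iter n (shift B d) u = 0 -> u = 0.
Proof.
move=> cd; elim: m u => [|m IH] u //= hm hn.
have hu : shift B c u = 0.
  apply: IH; first by rewrite -iterSr.
  by rewrite iter_comm ?hn ?linear0 // => v; exact: shift_comm.
have hB : shift B d u = (c - d) *: u.
  by rewrite /shift -[B u](subrK (c *: u)) [B u - _]hu add0r -scalerBl.
elim: n {IH hm} hn => //= n IHn hn; apply: IHn.
move: hn; rewrite -iterS iterSr hB iterZ => /eqP.
by rewrite scaler_eq0 subr_eq0 (negbTE cd) /= => /eqP.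
Qed.

Lemma shift_solve (B : {linear M -> M}) (Q : M -> Prop) c d n y : c != d ->
  subsp Q -> (forall u, Q u -> Q (B u)) -> Q y ->
  iter n (shift B d) y = 0 ->
  exists x, [/\ shift B c x = y, iter n (shift B d) x = 0 & Q x].
Proof.
move=> cd hQ hB; elim: n y => [|n IH] y Qy /=.
  by move=> ->; exists 0; rewrite linear0; split=> //; case: hQ.
rewrite -iterS iterSr => hn.
have [|x [hx1 hx2 Qx]] := IH (shift B d y) _ hn.
  by rewrite /shift; apply: subspB => //; [exact: hB|exact: subspZ].
have dc0 : d - c != 0 by rewrite subr_eq0 eq_sym.
exists ((d - c)^-1 *: (y - x)); split.
- rewrite linearZ linearB /= hx1 /shift opprB.
  rewrite [X in _ *: X = _]addrC addrA subrK.
  by rewrite -scalerBl scalerA mulVf ?scale1r.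
- have hN : iter n.+1 (shift B d) (- x) = 0.
    by rewrite -scaleN1r iterZ iterS hx2 linear0 scaler0.
  by rewrite -iterS iterZ iter_addv hN iterSr hn addr0 scaler0.
- by apply: subspZ => //; exact: subspB.
Qed.

Definition geig (B : {linear M -> M}) c u := exists n, iter n (shift B c) u = 0.

Lemma geig_subsp B c : subsp (geig B c).
Proof.
split; first by exists 0.
move=> a u v [m hm] [n hn]; exists (m + n)%N.
by rewrite iter_addv iterZ (iter_wide _ hm) ?leq_addr // (iter_wide _ hn) ?leq_addl // scaler0 addr0.
Qed.

Lemma geig_stable (B A : {linear M -> M}) c u :
  (forall v, B (A v) = A (B v)) -> geig B c u -> geig B c (A u).
Proof.
move=> h [n hn]; exists n; rewrite (@iter_comm (shift B c) A) ?hn ?linear0 //.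
by move=> v; rewrite /shift [A (_ - _)]linearB [A (_ *: _)]linearZ /= h.
Qed.

(** The primary decomposition of a vector [x] killed by a product of factors
    [B - c]: induction on the factors, solving [(B - c) x' = y] on the
    generalized eigenvectors for the other eigenvalues. *)
Lemma primary_step (B : {linear M -> M}) (Q : M -> Prop) c x z (s : seq M) :
  subsp Q -> (forall u, Q u -> Q (B u)) -> Q x -> geig B c z -> 
  (forall y, y \in s -> (exists d, geig B d y) /\ Q y) ->
  shift B c x = z + \sum_(y <- s) y ->
  sum_of (fun y => (exists d, geig B d y) /\ Q y) x.
Proof.
move=> hQ hB; elim: s x z => [|y s IH] x z Qx hz hs hx.
  rewrite big_nil addr0 in hx; apply: sum_of1; split=> //; exists c.
  by case: hz => n hn; exists n.+1; rewrite iterSr hx.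
have [[d hd] Qy] := hs y (mem_head _ _).
have hs' v : v \in s -> (exists d, geig B d v) /\ Q v.
  by move=> vs; apply: hs; rewrite inE vs orbT.
rewrite big_cons addrA in hx.
have [/eqP dc|dc] := boolP (d == c).
  by apply: (IH _ _ Qx _ hs' hx); apply: (subspD (geig_subsp B c)) => //; rewrite -dc.
case: hd => n hn; rewrite eq_sym in dc.
have [w [hw1 hw2 Qw]] := shift_solve dc hQ hB Qy hn.
rewrite -(subrK w x); apply: sum_ofD; last first.
  by apply: sum_of1; split=> //; exists d, n.
apply: (IH _ z _ hz hs'); first exact: subspB.
by rewrite linearB /= hx hw1 addrAC addrK.
Qed.

Lemma primary_decomp (B : {linear M -> M}) (Q : M -> Prop) (cs : seq F) x :
  subsp Q -> (forall u, Q u -> Q (B u)) -> Q x ->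
  foldl (fun u c => shift B c u) x cs = 0 ->
  sum_of (fun y => (exists d, geig B d y) /\ Q y) x.
Proof.
move=> hQ hB; elim: cs x => [|c cs IH] x Qx /=.
  by move=> ->; exact: sum_of0.
move=> h; have [|s hx hs] := IH (shift B c x) _ h.
  by rewrite /shift; apply: subspB => //; [exact: hB|exact: subspZ].
apply: (@primary_step B Q c x 0 s) => //; first by case: (geig_subsp B c).
by rewrite add0r.
Qed.

End Shift.

Section Annihilator.
Variables (F : closedFieldType) (V : vectType F).

Let pact (B : {linear V -> V}) (p : {poly F}) (x : V) :=
  \sum_(i < size p) p`_i *: iter i B x.

Let pact_wide B (p : {poly F}) n x : (size p <= n)%N ->
  pact B p x = \sum_(i < n) p`_i *: iter i B x.
Proof.
move=> pn; rewrite /pact (big_ord_widen n (fun i => p`_i *: iter i B x)) // big_mkcond /=.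
apply: eq_bigr => i _; case: ltnP => // h.
by rewrite nth_default // scale0r.
Qed.

Let pactXsub B c (p : {poly F}) x : pact B (('X - c%:P) * p) x = pact B p (shift B c x).
Proof.
have sz : (size (('X - c%:P) * p)%R <= (size p).+1)%N.
  by rewrite (leq_trans (size_polyMleq _ _)) // size_XsubC.
rewrite (pact_wide _ _ sz) (pact_wide _ _ (leqnn (size p))).
under eq_bigr => i _ do rewrite mulrBl coefB coefXM coefCM scalerBl.
rewrite big_split /= big_ord_recl /= scale0r add0r.
under eq_bigr => i _ do rewrite /= add0n.
rewrite big_ord_recr /= [p`_(size p)]nth_default // mulr0 scale0r oppr0 addr0 -big_split /=.
apply: eq_bigr => i _.
by rewrite /shift -[- (c *: x)]scaleNr iter_addv iterZ scalerDr scalerA mulrN -iterSr scaleNr mulrC.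
Qed.

(** The iterates of [x] are linearly dependent, and the polynomial expressing
    the dependence splits into linear factors. *)
Lemma annihilator (B : {linear V -> V}) x :
  exists cs : seq F, foldl (fun u c => shift B c u) x cs = 0.
Proof.
pose n := \dim (fullv : {vspace V}).
pose X := [tuple iter i B x | i < n.+1].
have [k hk [i0 ki0]] : exists2 k : 'I_n.+1 -> F,
    \sum_(i < n.+1) k i *: iter i B x = 0 & exists i, k i != 0.
  apply: contrapT => no; suff : free X.
    rewrite /free size_tuple => /eqP h.
    by have := dimvS (subvf <<X>>%VS); rewrite h ltnn.
  apply/freeP => k hk i; apply/eqP; apply: contrapT => /negP ki; apply: no.
  exists k; last by exists i.
  by rewrite -[RHS]hk; apply: eq_bigr => j _; rewrite -tnth_nth tnth_mktuple.
pose p : {poly F} := \poly_(i < n.+1) k (inord i).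
have p0 : p != 0.
  apply/eqP => /(congr1 (fun q : {poly F} => q`_i0)).
  by rewrite coef_poly ltn_ord inord_val coef0 => /eqP; rewrite (negbTE ki0).
have hp : pact B p x = 0.
  rewrite (pact_wide _ _ (size_poly _ _)) -[RHS]hk; apply: eq_bigr => i _.
  by rewrite coef_poly ltn_ord inord_val.
have [cs hcs] := closed_field_poly_normal p.
exists cs; have : lead_coef p *: foldl (fun u c => shift B c u) x cs = 0.
  rewrite -hp hcs.
  have lc c q y : pact B (c *: q) y = c *: pact B q y.
    rewrite (pact_wide _ _ (size_scale_leq c q)) scaler_sumr.
    by apply: eq_bigr => i _; rewrite coefZ scalerA.
  rewrite lc lead_coefZ (monicP (monic_prod_XsubC _ _ _)) mulr1; congr (_ *: _).
  elim: (cs) (x) => [|c cs' IH] y /=.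
    by rewrite big_nil /pact size_poly1 big_ord1 coef1 scale1r.
  by rewrite big_cons pactXsub IH.
move=> /eqP; rewrite scaler_eq0 lead_coef_eq0 (negbTE p0) => /eqP //.
Qed.

End Annihilator.

(** Every Leibniz-type argument below (nilpotency of a sum of commuting
    operators, of a derivation on a bracket, of [f] on [x u]) is this count:
    [m + n] applications of [N] put at least [m] on the left argument or [n]
    on the right one. *)
Lemma leibniz_nil (F : fieldType) (W : lmodType F) (N : {linear W -> W})
    (U V : Type) (b : U -> V -> W) (D1 : U -> U) (D2 : V -> V)
    (Z1 P1 : U -> Prop) (Z2 : V -> Prop) :
  (forall x y, P1 x -> P1 (D1 x) /\ exists c d,
     N (b x y) = c *: b (D1 x) y + d *: b x (D2 y)) ->
  (forall x y, Z1 x -> b x y = 0) -> (forall x y, Z2 y -> b x y = 0) ->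
  forall m n x y, P1 x -> Z1 (iter m D1 x) -> Z2 (iter n D2 y) ->
  iter (m + n) N (b x y) = 0.
Proof.
move=> hN hZ1 hZ2 m n; move: {2}(m + n)%N (leqnn (m + n)) => k.
elim: k m n => [|k IH] m n hk x y Px hx hy.
  by case: m hk hx => // hk hx; rewrite hZ1 // iter0.
case: m hk hx => [|m] hk hx; first by rewrite hZ1 // iter0.
case: n hk hy => [|n] hk hy; first by rewrite hZ2 // iter0.
have [PD [c [d e]]] := hN x y Px.
have t1 : iter (m + n.+1) N (b (D1 x) y) = 0 by apply: IH; rewrite -?iterSr.
have t2 : iter (m + n.+1) N (b x (D2 y)) = 0.
  by rewrite -addSnnS; apply: IH; rewrite -?iterSr // -ltnS -addnS.
by rewrite addSn iterSr e iter_addv !iterZ t1 t2 !scaler0 addr0.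
Qed.

Section Weights.
Variables (F : fieldType) (T : vectType F) (M : lmodType F).
Variable A : T -> {linear M -> M}.
Hypothesis A_linear : forall a h k u, A (a *: h + k) u = a *: A h u + A k u.
Hypothesis A_comm : forall h k u, A h (A k u) = A k (A h u).

Local Notation dual := 'Hom(T, F^o).

Definition gen_weight (mu : dual) (u : M) := forall h, geig (A h) (mu h) u.

Definition weight_vec (mu : dual) (u : M) := forall h, A h u = (mu h : F) *: u.

Lemma weight_gen mu u : weight_vec mu u -> gen_weight mu u.
Proof. by move=> h k; exists 1%N; rewrite /= /shift h subrr. Qed.

Lemma weight_subsp mu : subsp (weight_vec mu).
Proof.
split=> [h|a u v hu hv h]; first by rewrite linear0 scaler0.
by rewrite linearP hu hv scalerDr !scalerA mulrC.
Qed.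

Lemma gen_weight_subsp mu : subsp (gen_weight mu).
Proof.
split=> [h|a u v hu hv h]; first by case: (geig_subsp (A h) (mu h)).
by case: (geig_subsp (A h) (mu h)) => _; apply.
Qed.

Lemma A0 u : A 0 u = 0.
Proof. by have := A_linear (-1) 0 0 u; rewrite scaler0 addr0 scaleN1r addNr. Qed.

(** [A (a h + k) - (a c + d)] is a combination of two commuting operators that
    are nilpotent on [u]. *)
Lemma geig_lin a h k c d u : geig (A h) c u -> geig (A k) d u ->
  geig (A (a *: h + k)) (a * c + d) u.
Proof.
move=> [m hm] [n hn]; exists (m + n)%N.
pose b (i j : nat) := iter i (shift (A h) c) (iter j (shift (A k) d) u).
have := @leibniz_nil F M (shift (A (a *: h + k)) (a * c + d)) nat nat b S S
  (fun i => m <= i)%N xpredT (fun j => n <= j)%N.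
move=> /(_ _ _ _ m n 0%N 0%N); apply=> //.
- move=> i j _; split=> //; exists a, 1.
  rewrite /b /= scale1r.
  have -> : iter i (shift (A h) c) (shift (A k) d (iter j (shift (A k) d) u)) =
            shift (A k) d (iter i (shift (A h) c) (iter j (shift (A k) d) u)).
    by apply: iter_comm => v; apply: shift_comm => w; exact: A_comm.
  rewrite /shift A_linear scalerBr scalerDl !scalerA opprD addrACA.
  by congr (_ + _); rewrite addrC.
- by move=> i j hi; rewrite /b (iter_wide hi) // iter_comm ?hm ?iter0 // => v;
    elim: j {hi} v => //= j IH v; rewrite -IH; apply: shift_comm => w; exact: A_comm.
- by move=> i j hj; rewrite /b (iter_wide hj hn) iter0.
- by elim: (m) => //= k' IH; rewrite ltnS.
- by elim: (n) => //= k' IH; rewrite ltnS.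
Qed.

Lemma gen_weight_basis (mu : dual) u :
  (forall i : 'I_(\dim (fullv : {vspace T})),
     geig (A (vbasis fullv)`_i) (mu (vbasis fullv)`_i) u) ->
  gen_weight mu u.
Proof.
move=> hb h; rewrite (coord_vbasis (memvf h)).
have g0 : geig (A 0) (mu 0) u.
  by exists 1%N; rewrite /= /shift linear0 scale0r subr0 A0.
apply: (big_ind (fun k => geig (A k) (mu k) u)) => // [k l hk hl|i _].
  by have := geig_lin 1 hk hl; rewrite scale1r mul1r linearD.
have := geig_lin (coord (vbasis fullv) i h) (hb i) g0.
by rewrite linear0 !addr0 linearZ.
Qed.

Lemma dual_neq (mu nu : dual) : nu != mu -> exists h, (mu h : F) - nu h != 0.
Proof.
move=> /eqP nm; apply: contrapT => no; apply: nm; apply/lfunP => h; apply/eqP.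
rewrite eq_sym -subr_eq0; apply: contrapT => /negP nh.
by apply: no; exists h.
Qed.

(** Weight vectors of other weights can be cancelled one at a time by the
    operators [A h - nu h], which act on [u] by nonzero scalars. *)
Lemma weight_extract (Q : M -> Prop) mu u (I : eqType) (r : seq I)
    (nu : I -> dual) (w : I -> M) :
  subsp Q -> (forall h v, Q v -> Q (A h v)) -> weight_vec mu u ->
  (forall i, i \in r -> weight_vec (nu i) (w i) /\ nu i != mu) ->
  Q (u + \sum_(i <- r) w i) -> Q u.
Proof.
move=> hQ hA hu; elim: r w => [|i r IH] w hs; first by rewrite big_nil addr0.
have [hv /dual_neq [h mn0]] := hs i (mem_head _ _).
have {}hs j : j \in r -> weight_vec (nu j) (w j) /\ nu j != mu.
  by move=> ps; apply: hs; rewrite inE ps orbT.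
rewrite big_cons /= => Qs; set a := (mu h : F) - nu i h in mn0.
have sh (ku : dual) v : weight_vec ku v ->
    shift (A h) (nu i h) v = ((ku h : F) - nu i h) *: v.
  by move=> hp; rewrite /shift hp -scalerBl.
have := hQ; case=> _ /(_ (- (nu i h : F)) _ _ Qs (hA h _ Qs)).
rewrite scaleNr addrC -/(shift _ _ _) 2!linearD linear_sum /=.
rewrite [shift _ _ (w i)]/shift hv subrr add0r (sh mu u) //.
move=> /(subspZ a^-1 hQ).
rewrite scalerDr scalerA mulVf // scale1r scaler_sumr => Q2.
apply: (IH (fun j => a^-1 *: shift (A h) (nu i h) (w j))) => // j jr.
have [hj ?] := hs j jr; split=> //.
by apply: (subspZ _ (weight_subsp _)); rewrite (sh _ _ hj); apply: (subspZ _ (weight_subsp _)).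
Qed.

Lemma gen_weight_stable mu h u : gen_weight mu u -> gen_weight mu (A h u).
Proof. by move=> hu k; apply: geig_stable => // v; exact: A_comm. Qed.

(** Here the powers of [A h - nu h] that cancel the other vectors no longer act
    on [u] by scalars, but they are injective on its generalized weight space. *)
Lemma gen_weight_extract mu u (I : eqType) (r : seq I)
    (nu : I -> dual) (w : I -> M) :
  gen_weight mu u ->
  (forall i, i \in r -> gen_weight (nu i) (w i) /\ nu i != mu) ->
  u + \sum_(i <- r) w i = 0 -> u = 0.
Proof.
elim: r w u => [|i r IH] w u hu hs; first by rewrite big_nil addr0.
have [hv /dual_neq [h mn0]] := hs i (mem_head _ _).
have {}hs j : j \in r -> gen_weight (nu j) (w j) /\ nu j != mu.
  by move=> ps; apply: hs; rewrite inE ps orbT.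
rewrite big_cons => e0; have [n hn] := hv h.
have gs ku v m c : gen_weight ku v -> gen_weight ku (iter m (shift (A h) c) v).
  move=> hku; elim: m => //= m hm; apply: (subspB (gen_weight_subsp ku)).
    exact: gen_weight_stable.
  exact: (subspZ _ (gen_weight_subsp ku)).
have [m hm] := hu h.
have cd : (mu h : F) != nu i h by rewrite -subr_eq0.
apply: (shift_coprime cd hm (n := n)).
apply: (IH (fun j => iter n (shift (A h) (nu i h)) (w j))); first exact: gs.
  by move=> j /hs [? ?]; split=> //; exact: gs.
have := congr1 (iter n (shift (A h) (nu i h))) e0.
by rewrite iter0 !iter_addv hn add0r iter_sum.
Qed.

(** Nilpotency modulo a stable subspace: raise [x] by [A h - mu h] as long as
    it stays out of [Q], for each [h] of a basis in turn. *)
Lemma eigenvector_mod (Q D : M -> Prop) (mu : dual) x :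
  subsp Q -> (forall h v, Q v -> Q (A h v)) ->
  subsp D -> (forall h v, D v -> D (A h v)) ->
  gen_weight mu x -> D x -> ~ Q x ->
  exists y, [/\ D y, ~ Q y & forall h, Q (shift (A h) (mu h) y)].
Proof.
move=> hQ hA hD hDA hx Dx Qx.
have Qsh k c v : Q v -> Q (shift (A k) c v).
  by move=> ?; apply: subspB => //; [exact: hA|exact: subspZ].
suff [y [_ Dy Qy hy]] : exists y, [/\ gen_weight mu y, D y, ~ Q y &
    forall h, h \in (vbasis fullv : seq T) -> Q (shift (A h) (mu h) y)].
  exists y; split=> // h; rewrite (coord_vbasis (memvf h)).
  have Q0 : Q (shift (A 0) (mu 0) y).
    by rewrite /shift A0 linear0 scale0r subr0; case: hQ.
  have Ql a k l : Q (shift (A k) (mu k) y) -> Q (shift (A l) (mu l) y) ->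
      Q (shift (A (a *: k + l)) (mu (a *: k + l)) y).
    move=> Qk Ql; have := hQ; case=> _ /(_ a _ _ Qk Ql).
    by congr Q; rewrite /shift A_linear linearP scalerDl scalerBr !scalerA opprD addrACA.
  apply: (big_ind (fun k => Q (shift (A k) (mu k) y))) => // [k l hk hl|i _].
    by have := Ql 1 k l hk hl; rewrite scale1r.
  have hi : (vbasis fullv)`_i \in (vbasis fullv : seq T).
    by rewrite mem_nth // size_tuple.
  by have := Ql (coord (vbasis fullv) i h) _ 0 (hy _ hi) Q0; rewrite addr0.
elim: (vbasis fullv : seq T) => [|h hs [y [gy Dy Qy hy]]]; first by exists x.
have ex : exists n, `[< Q (iter n (shift (A h) (mu h)) y) >].
  by have [n hn] := gy h; exists n; apply/asboolP; rewrite hn; case: hQ.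
case: (ex_minnP ex) => [[|n]] /asboolP hn hmin; first by [].
exists (iter n (shift (A h) (mu h)) y); split.
- elim: (n) => //= m hm; apply: (subspB (gen_weight_subsp mu)).
    exact: gen_weight_stable.
  exact: (subspZ _ (gen_weight_subsp mu)).
- elim: (n) => //= m hm; apply: subspB => //; [exact: hDA|exact: subspZ].
- by move=> /asboolP /hmin; rewrite ltnn.
move=> k; rewrite inE => /orP[/eqP -> //|/hy hk].
rewrite -(@iter_comm F M (shift (A h) (mu h)) (shift (A k) (mu k))).
  by elim: (n) => //= m hm; exact: Qsh.
by move=> v; apply: shift_comm => w; exact: A_comm.
Qed.

End Weights.

Lemma hom_exists (F : fieldType) (U V : vectType F) (f : U -> V) :
  linear f -> exists h : 'Hom(U, V), forall x, h x = f x.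
Proof.
move=> lin; pose L : {linear U -> V} := HB.pack f (GRing.isLinear.Build F U V *:%R f lin).
by exists (linfun L) => x; rewrite lfunE.
Qed.

Section JointDecomposition.
Variables (F : closedFieldType) (T V : vectType F).
Variable A : T -> {linear V -> V}.
Hypothesis A_linear : forall a h k u, A (a *: h + k) u = a *: A h u + A k u.
Hypothesis A_comm : forall h k u, A h (A k u) = A k (A h u).

(** Decompose for the elements of a basis of [T] in turn. The conditions already
    obtained are carried along as a subspace stable under all the [A h], which is
    why the statement is relative to such a subspace [Q]. *)
Lemma joint_decomposition (Q : V -> Prop) x :
  subsp Q -> (forall h u, Q u -> Q (A h u)) -> Q x ->
  sum_of (fun y => (exists mu : 'Hom(T, F^o), gen_weight A mu y) /\ Q y) x.
Proof.
move=> hQ hA Qx.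
have : sum_of (fun y => (forall h, h \in (vbasis fullv : seq T) ->
    exists c, geig (A h) c y) /\ Q y) x.
  elim: (vbasis fullv : seq T) => [|h hs IH].
    by apply: sum_of1; split=> // h; rewrite in_nil.
  apply: sum_of_bind IH => y [hy Qy].
  have [cs hcs] := annihilator (A h) y.
  pose Q' (z : V) := Q z /\
    forall k, k \in hs -> forall c, geig (A k) c y -> geig (A k) c z.
  have sQ : subsp Q'.
    split=> [|a u v [Qu hu] [Qv hv]].
      by split=> [|k _ c _]; [case: hQ|case: (geig_subsp (A k) c)].
    split=> [|k ks c hc]; first by case: hQ => _; apply.
    by case: (geig_subsp (A k) c) => _; apply; [exact: hu|exact: hv].
  have := @primary_decomp _ _ (A h) Q' cs y sQ _ _ hcs.
  case=> [u [Qu hu]||s -> hs']; [|by split|].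
    split=> [|k ks c /hu hc]; first exact: hA.
    by apply: geig_stable; [move=> v; exact: A_comm|exact: hc].
  apply: sum_of_sum => z /hs' [hd [Qz Qz']]; apply: sum_of1; split=> // k.
  rewrite inE => /orP[/eqP -> //|ks]; have [c hc] := hy k ks.
  by exists c; apply: Qz'.
apply: sum_of_bind => y [hy Qy]; apply: sum_of1; split=> //.
pose e := vbasis (fullv : {vspace T}).
have [c hc] : exists c : 'I_(\dim (fullv : {vspace T})) -> F, forall i : 'I__, geig (A e`_i) (c i) y.
  apply: (@fin_all_exists _ (fun=> F) (fun (i : 'I__) c => geig (A e`_i) c y)) => i.
  apply: hy.
  by rewrite mem_nth // size_tuple.
have lin : linear (fun h : T => \sum_i coord e i h * c i : F^o).
  move=> a h k; rewrite scaler_sumr -big_split; apply: eq_bigr => i _ /=.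
  by rewrite linearP mulrDl -mulrA.
have [f fE] := hom_exists lin.
exists f; apply: gen_weight_basis => // i.
rewrite fE (bigD1 i) //= coord_free ?(basis_free (vbasisP _)) // eqxx mul1r.
rewrite big1 ?addr0 // => j ji; rewrite coord_free ?(basis_free (vbasisP _)) //.
by rewrite eq_sym (negbTE ji) mul0r.
Qed.

End JointDecomposition.

(** * Traces *)

Section Trace.
Variables (F : fieldType) (V : vectType F).

Definition fun_trace (f : V -> V) : F :=
  \sum_i coord (vbasis fullv) i (f (vbasis (fullv : {vspace V}))`_i).

Lemma endo_traceE (f : 'End(V)) : endo_trace f = fun_trace f.
Proof.
rewrite /endo_trace /mxtrace /fun_trace; apply: eq_bigr => i _.
rewrite !mxE /=; congr (coord _ _ (f _)).
by rewrite /passmx.vecof /= (bigD1 i) //= !mxE !eqxx scale1r big1 ?addr0 // => j ji; rewrite mxE eqxx (negbTE ji) scale0r.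
Qed.

Lemma trace_basis n (b : n.-tuple V) (f : {linear V -> V}) :
  basis_of fullv b -> fun_trace f = \sum_i coord b i (f b`_i).
Proof.
move=> hb; pose e := vbasis (fullv : {vspace V}).
transitivity (\sum_(k < \dim (fullv : {vspace V})) \sum_i coord b i e`_k * coord e k (f b`_i)).
  apply: eq_bigr => k _; rewrite {1}(coord_basis hb (memvf e`_k)) !linear_sum.
  by apply: eq_bigr => i _; rewrite !linearZ.
rewrite exchange_big; apply: eq_bigr => i _.
rewrite [in RHS](coord_vbasis (memvf (f b`_i))) linear_sum.
by apply: eq_bigr => k _; rewrite linearZ /= mulrC.
Qed.

Lemma fun_traceC (f h : {linear V -> V}) :
  fun_trace (fun x => f (h x)) = fun_trace (fun x => h (f x)).
Proof.
pose e := vbasis (fullv : {vspace V}).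
have E (p q : {linear V -> V}) : fun_trace (fun x => p (q x)) =
    \sum_(k < \dim (fullv : {vspace V})) \sum_(j < \dim (fullv : {vspace V}))
      coord e j (q e`_k) * coord e k (p e`_j).
  apply: eq_bigr => k _; rewrite {1}(coord_vbasis (memvf (q _))) !linear_sum.
  by apply: eq_bigr => j _; rewrite !linearZ.
rewrite !E exchange_big; apply: eq_bigr => i _; apply: eq_bigr => k _.
by rewrite mulrC.
Qed.

Lemma fun_traceD (f h : V -> V) :
  fun_trace (fun x => f x + h x) = fun_trace f + fun_trace h.
Proof. by rewrite -big_split; apply: eq_bigr => i _; rewrite linearD. Qed.

Lemma fun_traceZ a (f : V -> V) : fun_trace (fun x => a *: f x) = a * fun_trace f.
Proof. by rewrite mulr_sumr; apply: eq_bigr => i _; rewrite linearZ. Qed.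

Lemma eq_fun_trace (f h : V -> V) : f =1 h -> fun_trace f = fun_trace h.
Proof. by move=> e; apply: eq_bigr => i _; rewrite e. Qed.

Lemma fun_traceB (f h : V -> V) :
  fun_trace (fun x => f x - h x) = fun_trace f - fun_trace h.
Proof.
rewrite -[- fun_trace h]mulN1r -fun_traceZ -fun_traceD.
by apply: eq_fun_trace => x; rewrite scaleN1r.
Qed.

End Trace.

(** All roots of the characteristic polynomial are eigenvalues, hence zero; so the
    polynomial is a power of ['X], and the trace is one of its coefficients. *)
Lemma trace_nilpotent (F : closedFieldType) (V : vectType F) (f : {linear V -> V}) :
  (forall x, exists n, iter n f x = 0) -> fun_trace f = 0.
Proof.
move=> nil; pose e := vbasis (fullv : {vspace V}).
have he : basis_of fullv e by exact: vbasisP.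
pose M := passmx.mxof e e (linfun f).
have -> : fun_trace f = \tr M.
  by rewrite -/(endo_trace (linfun f)) endo_traceE; apply: eq_fun_trace => x; rewrite lfunE.
case: (posnP (\dim (fullv : {vspace V}))) => [d0|dpos].
  by rewrite /mxtrace big1 // => i _; exfalso; have := ltn_ord i; rewrite [X in (_ < X)%N]d0.
apply/eqP; rewrite -oppr_eq0 -char_poly_trace //.
have [r hr] := closed_field_poly_normal (char_poly M).
rewrite (monicP (char_poly_monic _)) scale1r in hr.
have r0 c : c \in r -> c = 0.
  rewrite -root_prod_XsubC -hr -eigenvalue_root_char => /eigenvalueP [v hv v0].
  have vZ a w : passmx.vecof e (a *: w) = a *: passmx.vecof e w.
    by rewrite scaler_sumr; apply: eq_bigr => i _; rewrite mxE scalerA.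
  have fv : f (passmx.vecof e v) = c *: passmx.vecof e v.
    have := congr1 (passmx.vecof e) hv.
    by rewrite vZ passmx.mul_mxof passmx.rVofK // lfunE.
  have [n hn] := nil (passmx.vecof e v).
  have {hn} : c ^+ n *: passmx.vecof e v = 0.
    rewrite -hn; elim: (n) => [|m IH]; first by rewrite expr0 scale1r.
    by rewrite iterSr fv iterZ -IH scalerA exprS.
  move=> /eqP; rewrite scaler_eq0 => /orP[|/eqP hv0].
    by rewrite expf_eq0 => /andP[_ /eqP].
  case/eqP: v0; rewrite -[v](passmx.vecofK he) hv0.
  by apply/rowP => i; rewrite !mxE linear0.
have : char_poly M = 'X^(size r).
  rewrite hr big_seq (eq_bigr (fun=> 'X)); first by rewrite -big_seq big_const_seq count_predT iter_mulr_1.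
  by move=> c /r0 ->; rewrite polyC0 subr0.
move=> h; have := size_char_poly M; rewrite h size_polyXn => -[sr].
by rewrite coefXn sr; case: (\dim _) dpos => //= m _; rewrite ltn_eqF.
Qed.

(** * Signs and homogeneous components *)

Section Signs.
Variable F : fieldType.
Local Notation sg := (sign F).

Let expD (x y : 'Z_2) : (-1) ^+ (x + y)%R = (-1) ^+ x * (-1) ^+ y :> F.
Proof. by rewrite -exprD -signr_odd -[RHS]signr_odd /= modn2 oddb. Qed.

Let expM (x y : 'Z_2) : (-1) ^+ (x * y)%R = (-1) ^+ (x * y)%N :> F.
Proof. by rewrite -signr_odd -[RHS]signr_odd /= modn2 oddb. Qed.

Let expN (x : 'Z_2) : (-1) ^+ (- x)%R = (-1) ^+ x :> F.
Proof. by case: x => -[|[|]]. Qed.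

(** A bicharacter [s] with [sign a b = s a b * s b a]: multiplying brackets by
    it turns the graded Lie algebra into an ordinary one. *)
Definition twist (a b : degree) : F := (-1) ^+ (a.1 * b.2)%N.

Lemma sign_twist a b : sg a b = twist a b * twist b a.
Proof. by rewrite /sign /pairing expD expN !expM [(a.2 * _)%N]mulnC. Qed.

Lemma twistDl a b c : twist (a + b) c = twist a c * twist b c.
Proof. by rewrite /twist -!expM mulrDl expD. Qed.

Lemma twistDr a b c : twist a (b + c) = twist a b * twist a c.
Proof. by rewrite /twist -!expM mulrDr expD. Qed.

Lemma twist0l a : twist 0 a = 1.
Proof. by rewrite /twist mul0n expr0. Qed.

Lemma twist0r a : twist a 0 = 1.
Proof. by rewrite /twist muln0 expr0. Qed.

Lemma twist_sq a b : twist a b * twist a b = 1.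
Proof. by rewrite /twist -expr2 sqrr_sign. Qed.

Lemma signC a b : sg a b = sg b a.
Proof. by rewrite !sign_twist mulrC. Qed.

Lemma sign_self a : sg a a = 1.
Proof. by rewrite sign_twist twist_sq. Qed.

Lemma sign0l a : sg 0 a = 1.
Proof. by rewrite sign_twist twist0l twist0r mulr1. Qed.

Lemma sign0r a : sg a 0 = 1.
Proof. by rewrite signC sign0l. Qed.

Lemma degree2 (a : degree) : a + a = 0.
Proof.
by case: a => -[[|[|//]] i] [[|[|//]] j]; apply/eqP; rewrite xpair_eqE -!val_eqE.
Qed.

Lemma degree_eq (a b : degree) : a + b = 0 -> a = b.
Proof. by move=> h; rewrite -[a]addr0 -(degree2 b) addrA h add0r. Qed.

End Signs.

Section Graded.
Variables (F : fieldType) (g : gradedLieAlgebra F).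

Lemma adDl x y z : ad g (x + y) z = ad g x z + ad g y z.
Proof. by rewrite linearD lfunE. Qed.

Lemma adZl a x z : ad g (a *: x) z = a *: ad g x z.
Proof. by rewrite linearZ lfunE. Qed.

Lemma ad0l z : ad g 0 z = 0.
Proof. by rewrite linear0 lfunE. Qed.

Lemma adBl x y z : ad g (x - y) z = ad g x z - ad g y z.
Proof. by rewrite adDl -scaleN1r adZl scaleN1r. Qed.

Lemma adDr x y z : ad g x (y + z) = ad g x y + ad g x z.
Proof. by rewrite linearD. Qed.

Lemma adZr a x z : ad g x (a *: z) = a *: ad g x z.
Proof. by rewrite linearZ. Qed.

Lemma adBr x y z : ad g x (y - z) = ad g x y - ad g x z.
Proof. by rewrite linearB. Qed.

Lemma ad0r x : ad g x 0 = 0.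
Proof. by rewrite linear0. Qed.

Lemma ad_suml (I : Type) (r : seq I) (f : I -> g) z :
  ad g (\sum_(i <- r) f i) z = \sum_(i <- r) ad g (f i) z.
Proof. by rewrite linear_sum sum_lfunE. Qed.

Lemma homogeneous_ind (Q : g -> Prop) :
  subsp Q -> (forall a x, x \in component g a -> Q x) -> forall x, Q x.
Proof.
move=> hQ h x; have := memvf x; rewrite -component_full => /memv_sumP [v hv ->].
by apply: subsp_sum => // a _; apply: (h a); exact: hv.
Qed.

Lemma ad_self a x : x \in component g a -> 2%:R != 0 :> F -> ad g x x = 0.
Proof.
move=> xa two; have := ad_antisym xa xa; rewrite sign_self scale1r => /eqP.
rewrite -subr_eq0 opprK -mulr2n -scaler_nat scaler_eq0 (negbTE two) /=.
by move/eqP.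
Qed.

End Graded.

(** * The weights of the Cartan subalgebra on the algebra *)

Section Cartan.
Variables (F : fieldType) (g : gradedLieAlgebra F) (t : {vspace g}).
Hypothesis ht : cartan_subalgebra t.
Hypothesis hs : self_centralizing t.

Local Notation T := (subvs_of t).

Lemma t_even h : h \in t -> h \in component g 0.
Proof. by case: ht => /subvP ts _ _ _; exact: ts. Qed.

Lemma t_abelian h k : h \in t -> k \in t -> ad g h k = 0.
Proof. by move=> /hs; apply. Qed.

Lemma ad_t_jacobi h y z : h \in t ->
  ad g h (ad g y z) = ad g (ad g h y) z + ad g y (ad g h z).
Proof.
move=> hh; move: y; apply: homogeneous_ind => [|b y yb].
  split=> [|a u v hu hv]; first by rewrite !(ad0l, linear0) addr0.
  rewrite [ad g h (a *: u + v)]linearP /= !(adDl, adZl).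
  by rewrite [LHS]linearP /= hu hv scalerDr addrACA.
by rewrite (ad_jacobi z (t_even hh) yb) sign0l scale1r.
Qed.

Definition ad_t (h : T) : {linear g -> g} := (ad g (vsval h) : {linear g -> g}).

Lemma ad_tE h u : ad_t h u = ad g (vsval h) u. Proof. by []. Qed.

Lemma ad_t_linear a h k u : ad_t (a *: h + k) u = a *: ad_t h u + ad_t k u.
Proof. by rewrite !ad_tE vsval_is_linear adDl adZl. Qed.

Lemma ad_t_comm h k u : ad_t h (ad_t k u) = ad_t k (ad_t h u).
Proof.
rewrite !ad_tE ad_t_jacobi ?subvsP // (t_abelian (subvsP h) (subvsP k)).
by rewrite ad0l add0r.
Qed.

Lemma ad_t_degree h a x : x \in component g a -> ad_t h x \in component g a.
Proof. by move=> xa; rewrite -[a]add0r ad_graded // t_even ?subvsP. Qed.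

Lemma component_subsp a : subsp (fun x => x \in component g a).
Proof. by split=> [|c u v hu hv]; rewrite ?mem0v // memvD // memvZ. Qed.

Lemma gen_weight_bracket mu nu x y : gen_weight ad_t mu x -> gen_weight ad_t nu y ->
  gen_weight ad_t (mu + nu) (ad g x y).
Proof.
move=> hx hy h; have [m hm] := hx h; have [n hn] := hy h; exists (m + n)%N.
apply: (@leibniz_nil F g _ g g (fun x y => ad g x y) (shift (ad_t h) (mu h))
  (shift (ad_t h) (nu h)) (fun z => z = 0) xpredT (fun z => z = 0)) => //.
- move=> u v _; split=> //; exists 1, 1; rewrite !scale1r /= /shift !ad_tE.
  rewrite ad_t_jacobi ?subvsP // lfunE /= scalerDl opprD addrACA.
  by rewrite adBl adZl adBr adZr.
- by move=> u v ->; rewrite ad0l.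
- by move=> u v ->; rewrite ad0r.
Qed.

End Cartan.

(** * The root space decomposition *)

Section KillingForm.
Variables (F : fieldType) (g : gradedLieAlgebra F).

Lemma killingE (x y : g) : killing x y = fun_trace (fun v => ad g x (ad g y v)).
Proof. by rewrite /killing endo_traceE; apply: eq_fun_trace => v; rewrite lfunE. Qed.

Lemma killingC (x y : g) : killing x y = killing y x.
Proof. by rewrite !killingE (fun_traceC (ad g x) (ad g y)). Qed.

Lemma killingP a (x y z : g) : killing x (a *: y + z) = a * killing x y + killing x z.
Proof.
rewrite !killingE -fun_traceZ -fun_traceD; apply: eq_fun_trace => v.
by rewrite adDl adZl adDr adZr.
Qed.

Lemma killingB (x y z : g) : killing x (y - z) = killing x y - killing x z.
Proof. by rewrite addrC -scaleN1r killingP mulN1r addrC. Qed.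

Lemma killingZ a (x y : g) : killing x (a *: y) = a * killing x y.
Proof.
rewrite !killingE -fun_traceZ; apply: eq_fun_trace => v.
by rewrite adZl adZr.
Qed.

Lemma killing0 (x : g) : killing x 0 = 0.
Proof. by rewrite -(scale0r 0) killingZ mul0r. Qed.

Lemma killing_sum (x : g) (I : Type) (r : seq I) (f : I -> g) :
  killing x (\sum_(i <- r) f i) = \sum_(i <- r) killing x (f i).
Proof.
apply: (big_morph (killing x)); last exact: killing0.
by move=> y z; rewrite -[y in LHS]scale1r killingP mul1r.
Qed.

Lemma component_disjoint a b (x : g) :
  x \in component g a -> x \in component g b -> a <> b -> x = 0.
Proof.
move=> xa xb ab; apply/eqP; rewrite -memv0.
have := component_direct g => /directv_sumP /(_ a isT) <-.
rewrite memv_cap xa /=; apply: (subvP (sumv_sup b _ (subvv _))) => //.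
by apply/eqP => e; apply: ab.
Qed.

End KillingForm.

Section AdaptedBasis.
Variables (F : closedFieldType) (g : gradedLieAlgebra F) (t : {vspace g}).
Hypothesis ht : cartan_subalgebra t.
Hypothesis hs : self_centralizing t.

Let A_lin := @ad_t_linear F g t.
Let A_comm := ad_t_comm ht hs.

(** Choose a counterexample that [t] maps into [t]. It would normalize [t] if its
    degree is zero; otherwise its brackets with [t] are zero, being of nonzero
    degree, and it would centralize [t]. *)
Lemma gen_zero_weight a x : x \in component g a -> gen_weight (ad_t (t:=t)) 0 x ->
  x \in t.
Proof.
move=> xa x0; apply: contrapT => xt.
have tQ : subsp (fun y => y \in t).
  by split=> [|c u v hu hv]; rewrite ?mem0v // memvD // memvZ.
have [h v vt|h v vt|y [ya yt hy]] := eigenvector_mod A_lin A_comm tQ _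
    (component_subsp g a) _ x0 xa xt.
- by case: ht => _ + _ _; apply=> //; exact: subvsP.
- exact: ad_t_degree.
have {}hy h : h \in t -> ad g y h \in t.
  move=> hh; rewrite (ad_antisym ya (t_even ht hh)) sign0r scale1r memvN.
  by have := hy (Subvs hh); rewrite /shift lfunE scale0r subr0.
apply: yt; have [a0|a0] := eqVneq a 0.
  by case: ht => _ _ _; apply=> //; rewrite /even_part -a0.
apply/hs => h hh; apply: (@component_disjoint _ g a 0); last exact/eqP.
  by rewrite -[a]addr0 ad_graded // (t_even ht).
exact: (t_even ht) (hy h hh).
Qed.

Lemma adapted_basis : exists b : seq g, basis_of fullv b /\
  forall x, x \in b -> exists a mu, x \in component g a /\ gen_weight (ad_t (t:=t)) mu x.
Proof.
pose pr (x : g) := exists a mu, x \in component g a /\ gen_weight (ad_t (t:=t)) mu x.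
have gen (v : g) : sum_of pr v.
  have := memvf v; rewrite -component_full => /memv_sumP [w hw ->].
  have -> : \sum_a w a = \sum_(a <- enum {: degree}) w a by rewrite big_enum.
  apply: sum_of_sum => a _.
  apply: sum_of_bind (joint_decomposition A_lin A_comm (component_subsp g a) _ (hw a isT)).
    by move=> y [[mu hmu] ya]; apply: sum_of1; exists a, mu.
  by move=> h u; exact: ad_t_degree.
have [s hs1 hs2] : exists2 s : seq g, (forall x, x \in s -> pr x) &
    forall v, v \in (vbasis fullv : seq g) -> v \in <<s>>%VS.
  elim: (vbasis fullv : seq g) => [|v l [s hs1 hs2]]; first by exists [::].
  have [s' e hs'] := gen v; exists (s' ++ s).
    by move=> x; rewrite mem_cat => /orP[/hs'|/hs1].
  move=> u; rewrite inE span_cat => /orP[/eqP ->|/hs2 us]; last first.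
    exact: (subvP (addvSr _ _)).
  apply: (subvP (addvSl _ _)); rewrite e big_seq.
  by apply: memv_suml => i ?; exact: memv_span.
have [b bf [bs be]] : exists2 b : seq g, free b &
    {subset b <= s} /\ <<b>>%VS = <<s>>%VS.
  elim: (s) => [|v l [b bf [bs be]]]; first by exists [::]; rewrite ?nil_free.
  have [vb|vb] := boolP (v \in <<b>>%VS).
    exists b => //; split; first by move=> x /bs xl; rewrite inE xl orbT.
    by rewrite span_cons -be; apply/esym/addv_idPr; rewrite -memvE.
  exists (v :: b); first by rewrite free_cons vb.
  split; last by rewrite !span_cons be.
  by move=> x; rewrite !inE => /orP[->//|/bs ->]; rewrite orbT.
exists b; split; last by move=> x /bs /hs1.
rewrite /basis_of bf andbT eqEsubv subvf /= be.
by rewrite -(span_basis (vbasisP fullv)); apply/span_subvP.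
Qed.

End AdaptedBasis.

Section Diagonalization.
Variables (F : closedFieldType) (g : gradedLieAlgebra F) (t : {vspace g}).
Hypothesis ht : cartan_subalgebra t.
Hypothesis hs : self_centralizing t.
Hypothesis hK : forall x : g, (forall y : g, killing x y = 0) -> x = 0.
Local Notation T := (subvs_of t).
Local Notation dual := (dual_space t).
Let A_comm := ad_t_comm ht hs.
Variables (n : nat) (b : n.-tuple g) (d : 'I_n -> degree) (wt : 'I_n -> dual).
Hypothesis hb : basis_of fullv b.
Hypothesis hd : forall i : 'I_n, b`_i \in component g (d i).
Hypothesis hw : forall i : 'I_n, gen_weight (ad_t (t:=t)) (wt i) b`_i.
Let lE := (comp_lfunE, add_lfunE, opp_lfunE, scale_lfunE).
Local Notation gw := (gen_weight (ad_t (t:=t))).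

Lemma coord_basis_elt (i j : 'I_n) : coord b j b`_i = (i == j)%:R.
Proof. by rewrite coord_free // (basis_free hb). Qed.

(** The part of [z] on the basis vectors of weight [wt i] must vanish unless
    [z] has this weight, as generalized weight spaces are independent. *)
Lemma coord_weight (i : 'I_n) mu z : gw mu z -> coord b i z != 0 -> wt i = mu.
Proof.
move=> hz ci; apply/eqP; apply: contraNT ci => wi.
pose u := \sum_(j | wt j == wt i) coord b j z *: b`_j.
have hu : gw (wt i) u.
  apply: (subsp_sum _ (gen_weight_subsp _ _)) => j /eqP <-.
  exact: (subspZ _ (gen_weight_subsp _ _)).
have ez : z = u + \sum_(j | wt j != wt i) coord b j z *: b`_j.
  by rewrite {1}(coord_basis hb (memvf z)) (bigID (fun j => wt j == wt i)).
have u0 : u = 0.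
  pose r : seq (option 'I_n) := None :: [seq Some j | j <- enum 'I_n & wt j != wt i].
  apply: (gen_weight_extract A_comm (r := r) (nu := fun o => if o is Some j then wt j else mu)
    (w := fun o => if o is Some j then coord b j z *: b`_j else - z) hu).
    move=> [j|]; rewrite inE /=.
      move=> /mapP [k]; rewrite mem_filter => /andP[wk _] [->]; split=> //.
      exact: (subspZ _ (gen_weight_subsp _ _)).
    by move=> _; split; [exact: subspN (gen_weight_subsp _ _) hz|rewrite eq_sym].
  rewrite big_cons big_map big_filter big_enum_cond /=.
  by rewrite addrCA -[X in _ + X]ez addNr.
have := congr1 (coord b i) u0; rewrite linear0 linear_sum (bigD1 i) //= big1.
  by rewrite addr0 linearZ /= coord_basis_elt eqxx mulr1 => /eqP.
by move=> j /andP[_ ji]; rewrite linearZ /= coord_basis_elt (negbTE ji) mulr0.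
Qed.

Lemma coord_degree (i : 'I_n) a z : z \in component g a -> coord b i z != 0 -> d i = a.
Proof.
move=> hz ci; apply/eqP; apply: contraNT ci => di.
pose u := \sum_(j | d j == d i) coord b j z *: b`_j.
have ez : z = u + \sum_(j | d j != d i) coord b j z *: b`_j.
  by rewrite {1}(coord_basis hb (memvf z)) (bigID (fun j => d j == d i)).
have u0 : u = 0.
  apply/eqP; rewrite -memv0.
  have := component_direct g => /directv_sumP /(_ (d i) isT) <-.
  rewrite memv_cap; apply/andP; split.
    by apply: memv_suml => j /eqP <-; rewrite memvZ.
  have -> : u = z - \sum_(j | d j != d i) coord b j z *: b`_j by rewrite {1}ez addrK.
  rewrite memvB //; first by apply: (subvP (sumv_sup a _ (subvv _))) => //; rewrite eq_sym.
  apply: memv_suml => j dj; rewrite memvZ //.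
  exact: (subvP (sumv_sup (d j) dj (subvv _))).
have := congr1 (coord b i) u0; rewrite linear0 linear_sum (bigD1 i) //= big1.
  by rewrite addr0 linearZ /= coord_basis_elt eqxx mulr1 => /eqP.
by move=> j /andP[_ ji]; rewrite linearZ /= coord_basis_elt (negbTE ji) mulr0.
Qed.

Lemma killing_basis (x y : g) :
  killing x y = \sum_(i < n) coord b i (ad g x (ad g y b`_i)).
Proof.
rewrite /killing endo_traceE (trace_basis _ hb).
by apply: eq_bigr => i _; rewrite /= comp_lfunE.
Qed.

(** The operator [ad x \o ad y] shifts degrees by [a + a'] and weights by
    [mu + nu], so its diagonal coefficients vanish unless both shifts are zero. *)
Lemma killing_orthogonal a a' mu nu x y : x \in component g a -> y \in component g a' ->
  gw mu x -> gw nu y -> killing x y != 0 -> a = a' /\ mu + nu = 0.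
Proof.
move=> xa ya hx hy; rewrite killing_basis => nz.
have [i hi] : exists i : 'I_n, coord b i (ad g x (ad g y b`_i)) != 0.
  apply: contrapT => no; case/eqP: nz; apply: big1 => i _; apply/eqP.
  by apply: contrapT => /negP h; apply: no; exists i.
have di := coord_degree (ad_graded xa (ad_graded ya (hd i))) hi.
have wi := coord_weight (gen_weight_bracket ht hx (gen_weight_bracket ht hy (hw i))) hi.
split; last by apply: (addIr (wt i)); rewrite add0r -addrA.
by apply: degree_eq; apply: (addIr (d i)); rewrite add0r -addrA.
Qed.

Lemma zero_weight_t (i : 'I_n) : wt i = 0 -> b`_i \in t.
Proof. by move=> w0; apply: (gen_zero_weight ht hs (hd i)); rewrite -w0. Qed.

Lemma t_zero_weight z : z \in t -> gw 0 z.
Proof.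
move=> zt h; exists 1%N; rewrite /= /shift ad_tE lfunE scale0r subr0.
by rewrite (t_abelian hs) ?subvsP.
Qed.

Lemma killing_t_nondegenerate z : z \in t -> (forall k, k \in t -> killing z k = 0) -> z = 0.
Proof.
move=> zt hz; apply: hK => y; rewrite (coord_basis hb (memvf y)) killing_sum.
apply: big1 => i _; rewrite killingZ; have [w0|w0] := eqVneq (wt i) 0.
  by rewrite hz ?mulr0 // zero_weight_t.
apply/eqP; rewrite mulf_eq0; apply/orP; right; apply: contraNT w0 => nz.
have [_] := killing_orthogonal (t_even ht zt) (hd i) (t_zero_weight zt) (hw i) nz.
by rewrite add0r => ->.
Qed.

(** The semisimple part of [ad h]. *)
Let S (h : T) (v : g) : g := \sum_(i < n) (coord b i v * (wt i h : F)) *: b`_i.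

Let S_linear h : linear (S h).
Proof.
move=> a u v; rewrite /S scaler_sumr -big_split; apply: eq_bigr => i _ /=.
by rewrite linearP mulrDl scalerDl scalerA mulrA.
Qed.
HB.instance Definition _ h := GRing.isLinear.Build F g g _ (S h) (S_linear h).

Let S_weight h mu v : gw mu v -> S h v = (mu h : F) *: v.
Proof.
move=> hv; rewrite [in RHS](coord_basis hb (memvf v)) scaler_sumr.
apply: eq_bigr => i _; rewrite scalerA mulrC.
have [->|/(coord_weight hv) -> //] := eqVneq (coord b i v) 0.
by rewrite !mulr0.
Qed.

Let basis_ext (f f' : {linear g -> g}) : (forall i : 'I_n, f b`_i = f' b`_i) -> f =1 f'.
Proof.
move=> h v; rewrite (coord_basis hb (memvf v)) !linear_sum.
by apply: eq_bigr => i _; rewrite !linearZ h.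
Qed.

(** [ad h - S h] commutes with [ad z] and is nilpotent on each generalized weight
    space, so it does not contribute to the trace. *)
Let trace_semisimple h z : z \in t ->
  fun_trace (fun v => ad g (vsval h) (ad g z v)) = fun_trace (fun v => S h (ad g z v)).
Proof.
move=> zt; apply/eqP; rewrite -subr_eq0 -fun_traceB; apply/eqP.
pose N0 := linfun (ad g (vsval h)) - linfun (S h).
pose N := (N0 \o linfun (ad g z))%VF.
rewrite (_ : fun_trace _ = fun_trace N); last first.
  by apply: eq_fun_trace => v; rewrite ?(lE, lfunE) /= ?(lE, lfunE).
apply: trace_nilpotent => x.
suff [m hm] : geig (N : {linear g -> g}) 0 x.
  exists m; rewrite -hm; apply: eq_iter => v.
  by rewrite /shift scale0r subr0.
rewrite (coord_basis hb (memvf x)); apply: (subsp_sum _ (geig_subsp _ _)) => i _.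
apply: (subspZ _ (geig_subsp _ _)); have [m hm] := hw i h; exists m.
pose Z := Subvs zt.
have comm v c : shift (ad_t h) c (ad_t Z v) = ad_t Z (shift (ad_t h) c v).
  by have := A_comm h Z v; rewrite /shift !ad_tE adBr adZr => ->.
have gsh v c : gw (wt i) v -> gw (wt i) (shift (ad_t h) c v).
  move=> hv; apply: (subspB (gen_weight_subsp _ _)).
    exact: gen_weight_stable A_comm _ _ _ hv.
  exact: (subspZ _ (gen_weight_subsp _ _)).
have NE v : gw (wt i) v -> N v = ad_t Z (shift (ad_t h) (wt i h) v).
  move=> hv; rewrite -comm ?(lE, lfunE) /= /shift (S_weight h (mu:=wt i)) //.
  exact: gen_weight_stable A_comm _ Z _ hv.
have NI k v : gw (wt i) v -> iter k (shift (N : {linear g -> g}) 0) v =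
       iter k (ad_t Z) (iter k (shift (ad_t h) (wt i h)) v).
  elim: k v => // k IH v hv.
  rewrite iterSr [X in iter k _ X](_ : _ = N v); last first.
    by rewrite /shift scale0r subr0.
  rewrite NE // IH; last by apply: (gen_weight_stable A_comm); exact: gsh.
  rewrite [iter k.+1 (ad_t Z) _]iterSr [iter k.+1 (shift _ _) v]iterSr.
  by congr (iter k _ _); apply: iter_comm => w; exact: comm.
by rewrite NI // hm iter0.
Qed.

(** Invariance of the trace form; the signs cancel because the pairing of a degree
    with itself is zero. *)
Lemma killing_bracket (h : T) x y a : x \in component g a -> y \in component g a ->
  killing (ad g (vsval h) x) y = killing (vsval h) (ad g x y).
Proof.
move=> xa ya; rewrite !killingE.
rewrite (eq_fun_trace (h := fun v => ad g (vsval h) (ad g x (ad g y v)) -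
   ad g x (ad g (vsval h) (ad g y v)))); last first.
  by move=> v; rewrite (ad_t_jacobi ht x (ad g y v) (subvsP h)) addrK.
rewrite [RHS](eq_fun_trace (h := fun v => ad g (vsval h) (ad g x (ad g y v)) -
   ad g (vsval h) (ad g y (ad g x v)))); last first.
  by move=> v; rewrite (ad_jacobi v xa ya) sign_self scale1r adDr addrK.
rewrite !fun_traceB; congr (_ - _).
pose hy := (ad g (vsval h) \o ad g y)%VF.
transitivity (fun_trace (fun v => ad g x (hy v))); last rewrite fun_traceC.
  by apply: eq_fun_trace => v; rewrite comp_lfunE.
by apply: eq_fun_trace => v; rewrite /= comp_lfunE.
Qed.

(** For [x], [y] of opposite weights and equal degree,
    [K([h, x], y) = K(h, [x, y])] is the trace of [S h] times [ad [x, y]],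
    which is [wt(h) K(x, y)] because [S h] is a derivation; so
    [[h, x] - wt(h) x] is orthogonal to everything. *)
Lemma ad_t_diagonal (i : 'I_n) h : ad_t h b`_i = (wt i h : F) *: b`_i.
Proof.
set x := b`_i; set a := d i; apply/eqP; rewrite -subr_eq0; apply/eqP; apply: hK => y.
have xa : x \in component g a by exact: hd.
have za : ad_t h x - (wt i h : F) *: x \in component g a.
  by rewrite memvB ?memvZ // ad_t_degree.
have zw : gw (wt i) (ad_t h x - (wt i h : F) *: x).
  apply: (subspB (gen_weight_subsp _ _)); first exact: (gen_weight_stable A_comm).
  exact: (subspZ _ (gen_weight_subsp _ _)).
rewrite (coord_basis hb (memvf y)) killing_sum; apply: big1 => j _.
rewrite killingZ; apply/eqP; rewrite mulf_eq0; apply/orP; right.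
apply: contrapT => /negP nz.
have [dj wj] := killing_orthogonal za (hd j) zw (hw j) nz.
have ya : b`_j \in component g a by rewrite dj.
move/negP: nz; apply; rewrite killingC killingB killingZ !(killingC b`_j).
rewrite ad_tE (killing_bracket h xa ya).
have zt : ad g x b`_j \in t.
  apply: (gen_zero_weight ht hs (ad_graded xa ya)); rewrite -wj.
  exact: gen_weight_bracket.
rewrite killingE trace_semisimple //.
rewrite (eq_fun_trace (h := fun v => S h (ad g x (ad g b`_j v)) -
   S h (ad g b`_j (ad g x v)))); last first.
  by move=> v; rewrite (ad_jacobi v xa ya) sign_self scale1r linearD /= addrK.
rewrite fun_traceB.
pose Sy := (linfun (S h) \o ad g b`_j)%VF.
have cyc : fun_trace (fun v => S h (ad g b`_j (ad g x v))) =
           fun_trace (fun v => ad g x (S h (ad g b`_j v))).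
  transitivity (fun_trace (fun v => Sy (ad g x v))).
    by apply: eq_fun_trace => v; rewrite comp_lfunE lfunE.
  by rewrite fun_traceC; apply: eq_fun_trace => v; rewrite /= comp_lfunE lfunE.
rewrite cyc -fun_traceB killingE -fun_traceZ subr_eq0; apply/eqP.
apply: eq_fun_trace => v; move: (ad g _ v) => {}v.
pose lhs := ((linfun (S h) \o ad g x) - (ad g x \o linfun (S h)))%VF.
pose rhs := (wt i h : F) *: ad g x.
transitivity (lhs v); first by rewrite ?(lE, lfunE) /=.
transitivity (rhs v); last by rewrite lfunE.
apply: basis_ext => k.
have hxk := gen_weight_bracket ht (hw i) (hw k).
rewrite /lhs /rhs /= !lE !lfunE /= (S_weight h hxk) (S_weight h (hw k)) adZr.
by rewrite add_lfunE scalerDl addrK.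
Qed.

End Diagonalization.

(** * Actions and sl2-strings *)

Section Actions.
Variables (F : fieldType) (g : gradedLieAlgebra F) (t : {vspace g}).
Local Notation T := (subvs_of t).
Local Notation dual := (dual_space t).

(** Representations on a space of arbitrary dimension: a highest weight module is
    first built as an action, and its dimension is bounded afterwards. *)
Record action (M : lmodType F) := Action {
  act :> g -> {linear M -> M};
  act_linear : forall a x y u, act (a *: x + y) u = a *: act x u + act y u;
  act_bracket : forall a b x y u, x \in component g a -> y \in component g b ->
    act (ad g x y) u = act x (act y u) - sign F a b *: act y (act x u)
}.

Lemma actDl M (X : action M) x y u : X (x + y) u = X x u + X y u.
Proof. by rewrite -[x in LHS]scale1r act_linear scale1r. Qed.

Lemma act0l M (X : action M) u : X 0 u = 0.
Proof. by have := act_linear X (-1) 0 0 u; rewrite scaler0 addr0 scaleN1r addNr. Qed.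

Lemma actZl M (X : action M) a x u : X (a *: x) u = a *: X x u.
Proof. by rewrite -[a *: x]addr0 act_linear act0l addr0. Qed.

Lemma act_suml M (X : action M) (I : Type) (r : seq I) (p : pred I) (f : I -> g) u :
  X (\sum_(i <- r | p i) f i) u = \sum_(i <- r | p i) X (f i) u.
Proof.
apply: (big_morph (fun x => X x u)); last exact: act0l.
by move=> x y; rewrite actDl.
Qed.

Program Definition adjoint : action g :=
  @Action g (fun x => ad g x : {linear g -> g}) _ _.
Next Obligation. by move=> a x y u /=; rewrite adDl adZl. Qed.
Next Obligation.
by move=> a b x y u xa yb /=; rewrite (ad_jacobi u xa yb) addrK.
Qed.

Program Definition rep_action (rho : representation g) : action (rep_space rho) :=
  @Action (rep_space rho) (fun x => rho x : {linear rep_space rho -> rep_space rho}) _ _.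
Next Obligation. by move=> rho a x y u /=; rewrite linearP /= !lfun_simp. Qed.
Next Obligation.
by move=> rho a b x y u xa yb /=; rewrite (rep_bracket rho xa yb) !lfun_simp.
Qed.

Definition t_act M (X : action M) (h : T) : {linear M -> M} := X (vsval h).

Definition weight M (X : action M) (mu : dual) (u : M) := weight_vec (t_act X) mu u.

Lemma t_act_linear M (X : action M) a h k u :
  t_act X (a *: h + k) u = a *: t_act X h u + t_act X k u.
Proof. by rewrite /t_act -act_linear. Qed.

Hypothesis ht : cartan_subalgebra t.
Hypothesis hs : self_centralizing t.

Section Weights.
Variables (M : lmodType F) (X : action M).

Lemma act_t_bracket h x u : h \in t ->
  X (ad g h x) u = X h (X x u) - X x (X h u).
Proof.
move=> hh; move: x; apply: homogeneous_ind => [|b y yb].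
  split=> [|a x y hx hy]; first by rewrite ad0r !act0l linear0 subr0.
  rewrite adDr adZr !act_linear hx hy linearP /= scalerBr opprD.
  by rewrite addrACA.
by rewrite (act_bracket X _ (t_even ht hh) yb) sign0l scale1r.
Qed.

Lemma t_act_comm h k u : t_act X h (t_act X k u) = t_act X k (t_act X h u).
Proof.
have := act_t_bracket (vsval k) u (subvsP h).
by rewrite (t_abelian hs (subvsP h) (subvsP k)) act0l => /esym/eqP; rewrite subr_eq0 => /eqP.
Qed.

Lemma act_weight mu nu x u : weight adjoint nu x -> weight X mu u ->
  weight X (nu + mu) (X x u).
Proof.
move=> hx hu h; rewrite /t_act.
have := act_t_bracket x u (subvsP h).
have -> : ad g (vsval h) x = (nu h : F) *: x by exact: hx.
rewrite actZl => /eqP; rewrite eq_sym subr_eq => /eqP ->.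
have -> : X (vsval h) u = (mu h : F) *: u by exact: hu.
by rewrite linearZ /= -scalerDl lfunE.
Qed.

Lemma iter_act_weight mu nu x u k : weight adjoint nu x -> weight X mu u ->
  weight X (mu + nu *+ k) (iter k (X x) u).
Proof.
move=> hx hu; elim: k => [|k IH] /=; first by rewrite mulr0n addr0.
by rewrite mulrS addrCA; exact: act_weight.
Qed.

End Weights.

Lemma independent_weights (V : vectType F) (X : action V) k (nu : 'I_k -> dual)
    (u : 'I_k -> V) :
  injective nu -> (forall i, weight X (nu i) (u i)) -> (forall i, u i != 0) ->
  (k <= \dim (fullv : {vspace V}))%N.
Proof.
move=> inj hu u0; pose Y := [tuple u i | i < k].
suff : free Y by rewrite /free size_tuple => /eqP <-; exact: dimvS (subvf _).
apply/freeP => c hc i; apply/eqP; apply: contrapT => /negP ci.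
have hY (j : 'I_k) : Y`_j = u j by rewrite -tnth_nth tnth_mktuple.
have : c i *: u i = 0.
  apply: (@weight_extract _ _ _ (t_act X) (fun v => v = 0) (nu i) _ 'I_k
    [seq j <- enum 'I_k | j != i] nu (fun j => c j *: u j)).
  - exact: subsp0.
  - by move=> h v ->; rewrite linear0.
  - by apply: (subspZ _ (weight_subsp _ _)); exact: hu.
  - move=> j; rewrite mem_filter => /andP[ji _]; split; last by rewrite (inj_eq inj).
    by apply: (subspZ _ (weight_subsp _ _)); exact: hu.
  - rewrite big_filter big_enum_cond /=.
    rewrite -[RHS]hc [RHS](bigD1 i) // hY; congr (_ + _).
    by apply: eq_bigr => j _; rewrite hY.
by move=> /eqP; rewrite scaler_eq0 (negbTE ci) /= (negbTE (u0 i)).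
Qed.

(** The nonzero iterates would have the pairwise distinct weights [mu + k nu]. *)
Lemma weight_nilpotent (V : vectType F) (X : action V) mu nu x u :
  (forall n : nat, (n%:R == 0 :> F) = (n == 0)%N) ->
  nu != 0 -> weight adjoint nu x -> weight X mu u -> exists k, iter k (X x) u = 0.
Proof.
move=> char0 nu0 hx hu; apply: contrapT => no.
pose n := \dim (fullv : {vspace V}).
suff : (n.+1 <= n)%N by rewrite ltnn.
apply: (@independent_weights V X n.+1 (fun j => mu + nu *+ j) (fun j => iter j (X x) u)).
- move=> i j /addrI /eqP e; apply: val_inj; move: e => /=.
  wlog lij : i j / (i <= j)%N.
    by move=> H; case: (leqP i j) => [/H //|/ltnW /H h]; rewrite eq_sym => /h.
  rewrite eq_sym -subr_eq0 -mulrnBr // -scaler_nat scaler_eq0 (negbTE nu0) orbF.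
  by rewrite char0 subn_eq0 => ji; apply/eqP; rewrite eqn_leq lij.
- by move=> j; exact: iter_act_weight.
- by move=> j; apply/eqP => h; apply: no; exists j.
Qed.

End Actions.

Section Sl2.
Variables (F : numClosedFieldType) (g : gradedLieAlgebra F) (t : {vspace g}).
Local Notation T := (subvs_of t).
Local Notation dual := (dual_space t).
Hypothesis ht : cartan_subalgebra t.

(** Both root vectors have the same degree, so they act with ordinary
    commutators whatever the sign rule. *)
Definition sl2_triple (alpha : dual) (e f : g) (h : T) :=
  [/\ exists2 a, e \in component g a & f \in component g a,
      weight (adjoint g) alpha e, weight (adjoint g) (- alpha) f,
      ad g e f = vsval h & alpha h = 2%:R].

Variables (M : lmodType F) (X : action g M).

Section Triple.
Variables (alpha : dual) (e f : g) (h : T) (mu : dual) (w : M).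
Hypothesis tri : sl2_triple alpha e f h.
Hypothesis hw : weight X mu w.
Hypothesis ew : X e w = 0.

Lemma sl2_bracket v : X e (X f v) = X (vsval h) v + X f (X e v).
Proof.
case: tri => -[a ea fa] _ _ <- _.
by rewrite (act_bracket X v ea fa) sign_self scale1r subrK.
Qed.

(** The classical formula [e f^(k+1) w = (k+1) (mu(h) - k) f^k w]. *)
Lemma sl2_string k : X e (iter k.+1 (X f) w) =
  (k.+1%:R * ((mu h : F) - k%:R)) *: iter k (X f) w.
Proof.
have [_ _ hf _ ah] := tri.
elim: k => [|k IH].
  by rewrite /= sl2_bracket ew linear0 addr0 mul1r subr0; exact: hw.
rewrite iterS sl2_bracket IH linearZ /= -iterS.
have -> : X (vsval h) (iter k.+1 (X f) w) = ((mu h : F) - 2%:R * k.+1%:R) *: iter k.+1 (X f) w.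
  have := iter_act_weight ht k.+1 hf hw h; rewrite /t_act => ->.
  rewrite add_lfunE mulNrn opp_lfunE; congr ((_ - _) *: _).
  by rewrite -scaler_nat scale_lfunE ah -[RHS]mulrC.
rewrite -scalerDl; congr (_ *: _); rewrite -!(natr1 k.+1) -!(natr1 k).
by ring.
Qed.

(** The least power of [f] killing [w] determines [mu h]. *)
Lemma sl2_dominant : w != 0 -> (exists k, iter k (X f) w = 0) ->
  exists2 n : nat, mu h = n%:R &
    iter n.+1 (X f) w = 0 /\ forall k, (k <= n)%N -> iter k (X f) w != 0.
Proof.
move=> w0 [k0 hk0].
have ex : exists k, iter k (X f) w == 0 by exists k0; apply/eqP.
case: (ex_minnP ex) => [[|n]] /eqP hn hmin; first by move: w0; rewrite -[w]/(iter 0 (X f) w) hn eqxx.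
have nz k : (k <= n)%N -> iter k (X f) w != 0.
  by move=> kn; apply/negP => /hmin; rewrite ltnNge kn.
exists n => //.
have := sl2_string n; rewrite hn linear0 => /esym/eqP.
rewrite scaler_eq0 (negbTE (nz n (leqnn n))) orbF mulf_eq0 pnatr_eq0 /=.
by rewrite subr_eq0 => /eqP.
Qed.

End Triple.
End Sl2.

(** * Roots *)

(** A basis of the algebra that diagonalizes [t]; [rb_wt] takes the value zero on
    the basis vectors of [t], and all roots as its other values. *)
Record root_basis (F : fieldType) (g : gradedLieAlgebra F) (t : {vspace g}) := RootBasis {
  rb_cartan : cartan_subalgebra t;
  rb_centralizing : self_centralizing t;
  rb_killing : forall x : g, (forall y : g, killing x y = 0) -> x = 0;
  rb_size : nat;
  rb_vec : rb_size.-tuple g;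
  rb_deg : 'I_rb_size -> degree;
  rb_wt : 'I_rb_size -> dual_space t;
  rb_basis : basis_of fullv rb_vec;
  rb_homogeneous : forall i : 'I_rb_size, rb_vec`_i \in component g (rb_deg i);
  rb_weight : forall i : 'I_rb_size, weight (adjoint g) (rb_wt i) rb_vec`_i;
  rb_zero : forall i : 'I_rb_size, rb_wt i = 0 -> rb_vec`_i \in t
}.

Arguments rb_vec {F g t} r.
Arguments rb_deg {F g t} r i.
Arguments rb_wt {F g t} r i.
Arguments rb_basis {F g t} r.
Arguments rb_homogeneous {F g t} r i.
Arguments rb_weight {F g t} r i.
Arguments rb_zero {F g t} r i.

Lemma root_basis_exists (F : closedFieldType) (g : gradedLieAlgebra F) (t : {vspace g}) :
  cartan_subalgebra t -> self_centralizing t ->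
  (forall x : g, (forall y : g, killing x y = 0) -> x = 0) -> exists B : root_basis t, True.
Proof.
move=> ht hs hK; have [b [hb hbs]] := adapted_basis ht hs.
pose B := in_tuple b; have hB : basis_of fullv B by [].
pose P (i : 'I_(size b)) a (mu : dual_space t) :=
  b`_i \in component g a /\ gen_weight (ad_t (t:=t)) mu b`_i.
have [d hd] := @fin_all_exists _ (fun=> degree) (fun i a => exists mu, P i a mu)
  (fun i => hbs b`_i (mem_nth 0 (ltn_ord i))).
have [wt hwt] := @fin_all_exists _ (fun=> dual_space t) (fun i mu => P i (d i) mu) hd.
have hd' (i : 'I_(size b)) : B`_i \in component g (d i) by case: (hwt i).
have hw' (i : 'I_(size b)) : gen_weight (ad_t (t:=t)) (wt i) B`_i by case: (hwt i).
exists (@RootBasis F g t ht hs hK (size b) B d wt hB hd'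
  (fun i h => ad_t_diagonal ht hs hK hB hd' hw' i h)
  (fun i => zero_weight_t ht hs hd' hw' (i := i))) => //.
Qed.

Section RootTheory.
Variables (F : numClosedFieldType) (g : gradedLieAlgebra F) (t : {vspace g}).
Local Notation T := (subvs_of t).
Local Notation dual := (dual_space t).
Variable B : root_basis t.
Local Notation n := (rb_size B).
Local Notation b := (rb_vec B).
Local Notation wt := (rb_wt B).
Local Notation d := (rb_deg B).
Local Notation Ad := (adjoint g).

Let ht := rb_cartan B.
Let hs := rb_centralizing B.
Let hK := rb_killing B.
Let hb := rb_basis B.
Let hd := rb_homogeneous B.
Let hw := rb_weight B.
Let gwt (i : 'I_n) : gen_weight (ad_t (t:=t)) (wt i) b`_i.
Proof. exact/weight_gen/hw. Qed.

Lemma weight_gen_ad mu x : weight Ad mu x -> gen_weight (ad_t (t:=t)) mu x.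
Proof. exact: weight_gen. Qed.

Lemma coord_rb (i : 'I_n) mu z : weight Ad mu z -> coord b i z != 0 -> wt i = mu.
Proof. by move=> /weight_gen_ad; exact: (coord_weight ht hs hb gwt). Qed.

Lemma coord_rb_deg (i : 'I_n) a z : z \in component g a -> coord b i z != 0 -> d i = a.
Proof. exact: (coord_degree hb hd). Qed.

Lemma weight_index mu z : weight Ad mu z -> z != 0 -> exists i : 'I_n, wt i = mu.
Proof.
move=> hz z0; have [i ci] : exists i : 'I_n, coord b i z != 0.
  apply: contrapT => no; case/eqP: z0.
  rewrite (coord_basis hb (memvf z)); apply: big1 => i _.
  have [->|/eqP ci] := eqVneq (coord b i z) 0; first by rewrite scale0r.
  by case: no; exists i; apply/eqP.
by exists i; exact: coord_rb ci.
Qed.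

Lemma rb_neq0 (i : 'I_n) : b`_i != 0.
Proof. by rewrite (free_not0 (basis_free hb)) // mem_nth ?size_tuple. Qed.

Lemma ad_rb (i j : 'I_n) : weight Ad (wt i + wt j) (ad g b`_i b`_j).
Proof. exact: (@act_weight _ _ _ ht g Ad). Qed.

Lemma rootsP alpha : roots t alpha <-> alpha != 0 /\ exists i : 'I_n, wt i = alpha.
Proof.
split=> [[a0 [x x0 hx]]|[a0 [i wi]]]; split=> //.
  have gx : gen_weight (ad_t (t:=t)) alpha x by move=> h; have [m _ hm] := hx h; exists m.
  have [i ci] : exists i : 'I_n, coord b i x != 0.
    apply: contrapT => no; case/eqP: x0.
    rewrite (coord_basis hb (memvf x)); apply: big1 => i _.
    have [->|/eqP ci] := eqVneq (coord b i x) 0; first by rewrite scale0r.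
    by case: no; exists i; apply/eqP.
  by exists i; apply: (coord_weight ht hs hb gwt gx ci).
exists b`_i; first exact: rb_neq0.
by move=> h; exists 1%N => //=; rewrite -wi; apply/eqP; rewrite subr_eq0; apply/eqP; exact: hw.
Qed.

Lemma killing_t_inj (z : T) : (forall k : T, killing (vsval z) (vsval k) = 0) -> z = 0.
Proof.
move=> hz; apply: val_inj => /=.
apply: (killing_t_nondegenerate ht hs hK hb hd gwt (subvsP z)) => k kt.
exact: hz (Subvs kt).
Qed.

Lemma killing_duality (alpha : dual) : exists H : T, forall h, alpha h = killing (vsval H) (vsval h).
Proof.
have lin1 (z : T) : linear (fun k : T => killing (vsval z) (vsval k) : F^o).
  by move=> a x y; rewrite vsval_is_linear killingP.
have [kf kfE] := choice (fun z => hom_exists (lin1 z)).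
have lin : linear kf.
  move=> a x y; apply/lfunP => k; rewrite add_lfunE scale_lfunE !kfE.
  by rewrite vsval_is_linear killingC killingP !(killingC (vsval k)).
have [L LE] := hom_exists lin.
have inj : lker L == 0%VS.
  apply/eqP/vspaceP => z; rewrite memv_ker memv0 LE.
  apply/eqP/eqP => [h|->]; last by rewrite -LE linear0.
  by apply: killing_t_inj => k; rewrite -kfE h lfunE.
have full : limg L = fullv.
  apply/eqP; rewrite eqEdim subvf limg_dim_eq; last by rewrite (eqP inj) capv0.
  by rewrite !dimvf /= /dim /= muln1.
have : alpha \in limg L by rewrite full memvf.
by move=> /memv_imgP [H _ ->]; exists H => h; rewrite LE kfE.
Qed.

Let vsvalB (x y : T) : vsval (x - y) = vsval x - vsval y. Proof. by []. Qed.
Let vsvalZ a (x : T) : vsval (a *: x) = a *: vsval x. Proof. by []. Qed.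

Lemma coroot_vectorP (alpha : dual) h : alpha h = killing (vsval (coroot_vector alpha)) (vsval h).
Proof.
have [H hH] := killing_duality alpha; move: h.
exact: (xgetPex (P := [set H : T | forall h : T, alpha h = killing (vsval H) (vsval h)]%classic)
  0 (ex_intro _ H hH)).
Qed.

Lemma dual_formE (alpha beta : dual) : dual_form alpha beta = alpha (coroot_vector beta).
Proof. by rewrite coroot_vectorP. Qed.

Lemma dual_formC (alpha beta : dual) : dual_form alpha beta = dual_form beta alpha.
Proof. exact: killingC. Qed.

Lemma dual_formDl a (x y z : dual) : dual_form (a *: x + y) z = a * dual_form x z + dual_form y z.
Proof. by rewrite !dual_formE add_lfunE scale_lfunE. Qed.

Lemma dual_formDr a (x y z : dual) : dual_form z (a *: x + y) = a * dual_form z x + dual_form z y.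
Proof. by rewrite dual_formC dual_formDl !(dual_formC z). Qed.

Lemma dual_formNl (x y : dual) : dual_form (- x) y = - dual_form x y.
Proof. by rewrite !dual_formE opp_lfunE. Qed.

Lemma dual_formNr (x y : dual) : dual_form x (- y) = - dual_form x y.
Proof. by rewrite dual_formC dual_formNl dual_formC. Qed.

Lemma zero_weight_in_t a z : z \in component g a -> weight Ad (0 : dual) z -> z \in t.
Proof.
move=> za z0; apply/hs => h hh; rewrite (ad_antisym za (t_even ht hh)) sign0r scale1r.
by have := z0 (Subvs hh); rewrite lfunE scale0r /t_act /= => ->; rewrite oppr0.
Qed.

(** Both sides lie in [t]; pair them with [h] in [t], using the invariance
    [K(h, [x, y]) = K([h, x], y)]. *)
Lemma bracket_opposite (i j : 'I_n) : wt i + wt j = 0 ->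
  ad g b`_i b`_j = killing b`_i b`_j *: vsval (coroot_vector (wt i)).
Proof.
move=> wij; have zc := ad_graded (hd i) (hd j).
have zt : ad g b`_i b`_j \in t.
  by apply: (zero_weight_in_t zc); rewrite -wij; exact: ad_rb.
have [dij|dij] := eqVneq (d i) (d j); last first.
  have -> : ad g b`_i b`_j = 0.
    apply: (component_disjoint zc (t_even ht zt)) => /degree_eq /eqP.
    by rewrite (negbTE dij).
  have [->|nz] := eqVneq (killing b`_i b`_j) 0; first by rewrite scale0r.
  by have [/eqP] := killing_orthogonal ht hs hb hd gwt (hd i) (hd j) (gwt i) (gwt j) nz;
    rewrite (negbTE dij).
pose Z := Subvs zt; apply/eqP; rewrite -subr_eq0.
suff -> : ad g b`_i b`_j = vsval (killing b`_i b`_j *: coroot_vector (wt i)).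
  by rewrite subrr.
apply: (congr1 vsval (x := Z)); apply/eqP; rewrite -subr_eq0; apply/eqP.
apply: killing_t_inj => k; rewrite vsvalB vsvalZ killingC killingB killingZ.
have hdj : b`_j \in component g (d i) by rewrite dij.
have := killing_bracket ht k (hd i) hdj.
have -> : ad g (vsval k) b`_i = (wt i k : F) *: b`_i by exact: hw.
rewrite killingC killingZ [killing b`_j _]killingC => <-.
by rewrite [killing (vsval k) _]killingC -coroot_vectorP mulrC subrr.
Qed.

(** The Killing form pairs the space of weight [wt i] and degree [d i] with the
    space of opposite weight and the same degree. *)
Lemma partner (i : 'I_n) : exists j : 'I_n,
  [/\ wt j = - wt i, d j = d i & killing b`_i b`_j != 0].
Proof.
have [j nz] : exists j : 'I_n, killing b`_i b`_j != 0.
  apply: contrapT => no; have := rb_neq0 i; case/negP; apply/eqP; apply: hK => y.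
  rewrite (coord_basis hb (memvf y)) killing_sum; apply: big1 => j _.
  rewrite killingZ; apply/eqP; rewrite mulf_eq0; apply/orP; right.
  by apply: contrapT => /negP h; apply: no; exists j.
have [-> wij] := killing_orthogonal ht hs hb hd gwt (hd i) (hd j) (gwt i) (gwt j) nz.
by exists j; split=> //; apply/eqP; rewrite -addr_eq0 addrC wij.
Qed.

(** If [<alpha, alpha> = 0] then [H_alpha], a multiple of a commutator, has trace
    zero on the sum of the weight spaces for any [alpha]-string, where it acts by
    a scalar; so every weight would vanish on it and it would be zero. *)
Lemma root_norm_neq0 (i : 'I_n) : wt i != 0 -> dual_form (wt i) (wt i) != 0.
Proof.
move=> wi0; apply/negP => /eqP; rewrite dual_formE; set z := coroot_vector _ => az.
have [j [wj dj nz]] := partner i.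
have wij : wt i + wt j = 0 by rewrite wj subrr.
have br := bracket_opposite wij; rewrite -/z in br.
have wz (k : 'I_n) : wt k z = 0.
  pose S := [pred l : 'I_n | `[< exists m : int, wt l = wt k + wt i *~ m >]].
  have kS : k \in S by apply/asboolP; exists 0; rewrite mulr0z addr0.
  pose E (x y l : 'I_n) := coord b y (ad g b`_x b`_l).
  have cz (x y l : 'I_n) : E x y l != 0 -> wt y = wt x + wt l.
    by move=> h; exact: coord_rb (ad_rb x l) h.
  have Si (l m : 'I_n) : E i m l != 0 -> (m \in S) = (l \in S).
    move=> /cz e; apply/asboolP/asboolP => -[p hp].
      by exists (p - 1); rewrite mulrzBr mulr1z addrA -hp e addrC addKr.
    by exists (p + 1); rewrite e hp mulrzDr mulr1z addrCA [wt i + _]addrC.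
  have Sj (l m : 'I_n) : E j m l != 0 -> (m \in S) = (l \in S).
    move=> /cz e; apply/asboolP/asboolP => -[p hp].
      by exists (p + 1); rewrite mulrzDr mulr1z addrA -hp e wj addrC addrA subrr add0r.
    by exists (p - 1); rewrite e hp wj mulrzBr mulr1z addrCA [- wt i + _]addrC.
  have comp (x y l : 'I_n) : coord b l (ad g b`_x (ad g b`_y b`_l)) = \sum_m E x l m * E y m l.
    rewrite {1}(coord_basis hb (memvf (ad g b`_y b`_l))) !linear_sum.
    by apply: eq_bigr => m _; rewrite !linearZ /= mulrC.
  have tr : \sum_(l in S) coord b l (ad g (ad g b`_i b`_j) b`_l) = 0.
    have hdj : b`_j \in component g (d i) by rewrite -dj.
    transitivity (\sum_(l in S) \sum_(m in S) (E i l m * E j m l - E j l m * E i m l)).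
      apply: eq_bigr => l lS.
      have := ad_jacobi b`_l (hd i) hdj; rewrite sign_self scale1r => /esym/eqP.
      rewrite eq_sym -subr_eq => /eqP <-; rewrite linearB /= !comp -sumrB.
      rewrite [RHS]big_mkcond; apply: eq_bigr => m _; case: ifPn => // mS.
      have z1 : E i m l = 0 by apply/eqP; apply: contraNT mS => /Si ->.
      have z2 : E j m l = 0 by apply/eqP; apply: contraNT mS => /Sj ->.
      by rewrite z1 z2 !mulr0 subr0.
    under eq_bigr => l _ do rewrite sumrB.
    rewrite sumrB [X in _ - X]exchange_big /=.
    apply/eqP; rewrite subr_eq0; apply/eqP; apply: eq_bigr => l _.
    by apply: eq_bigr => m _; rewrite mulrC.
  have cw (l : 'I_n) : l \in S -> coord b l (ad g (ad g b`_i b`_j) b`_l) = killing b`_i b`_j * (wt k z : F).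
    move=> /asboolP [m hm]; rewrite br adZl.
    have -> : ad g (vsval z) b`_l = (wt l z : F) *: b`_l by exact: hw.
    rewrite !linearZ /= (coord_basis_elt hb) eqxx mulr1 hm add_lfunE.
    congr (_ * _); rewrite -[RHS]addr0; congr (_ + _).
    by case: m {hm} => m; rewrite ?NegzE ?mulrNz -?pmulrn ?opp_lfunE -scaler_nat scale_lfunE az scaler0 ?oppr0.
  move: tr; rewrite (eq_bigr _ cw) sumr_const -mulr_natr => /eqP.
  rewrite !mulf_eq0 (negbTE nz) /= pnatr_eq0 => /orP[/eqP //|/eqP c0].
  by have := max_card (mem S); rewrite (cardD1 k) kS in c0.
have z0 : vsval z = 0.
  apply: hK => y; rewrite killingC killingE.
  rewrite (eq_fun_trace (h := fun v => 0 *: v)) ?fun_traceZ ?mul0r // => v.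
  rewrite scale0r (coord_basis hb (memvf v)) linear_sum big1 ?ad0r // => k _.
  by rewrite /= adZr; have := hw k z; rewrite /t_act /= => ->; rewrite wz scale0r scaler0.
case/eqP: wi0; apply/lfunP => h; rewrite coroot_vectorP -/z z0.
by rewrite killingC killing0 lfunE.
Qed.

End RootTheory.

Section Strings.
Variables (F : numClosedFieldType) (g : gradedLieAlgebra F) (t : {vspace g}).
Local Notation T := (subvs_of t).
Local Notation dual := (dual_space t).
Variable B : root_basis t.
Local Notation n := (rb_size B).
Local Notation b := (rb_vec B).
Local Notation wt := (rb_wt B).
Local Notation d := (rb_deg B).
Local Notation Ad := (adjoint g).
Let ht := rb_cartan B.
Let hb := rb_basis B.
Let hd := rb_homogeneous B.
Let hw := rb_weight B.

(** The coroot; by [hrootE], evaluation at it is the quantity in the conditions of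
    dominance and integrality. *)
Definition hroot (alpha : dual) : T :=
  (2%:R / dual_form alpha alpha) *: coroot_vector alpha.

Lemma hrootE (lambda alpha : dual) :
  lambda (hroot alpha) = 2 * dual_form lambda alpha / dual_form alpha alpha.
Proof.
by rewrite /hroot linearZ /= (dual_formE B lambda) [RHS]mulrAC.
Qed.

Lemma hroot_self (i : 'I_n) : wt i != 0 -> wt i (hroot (wt i)) = 2.
Proof. by move=> wi; rewrite hrootE mulfK // root_norm_neq0. Qed.

Lemma hrootNE (lambda alpha : dual) : lambda (hroot (- alpha)) = - lambda (hroot alpha) :> F.
Proof. by rewrite !hrootE !(dual_formNr B, dual_formNl B) opprK mulrN mulNr. Qed.

Lemma root_triple (i : 'I_n) : wt i != 0 -> exists j : 'I_n, exists c,
  [/\ c != 0, wt j = - wt i, killing b`_i b`_j != 0 &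
      sl2_triple (wt i) b`_i (c *: b`_j) (hroot (wt i))].
Proof.
move=> wi; have [j [wj dj nz]] := partner i.
have no := root_norm_neq0 wi.
have two : 2%:R != 0 :> F by rewrite pnatr_eq0.
pose c := 2%:R / dual_form (wt i) (wt i) / killing b`_i b`_j.
exists j, c; split=> //; first by rewrite !mulf_neq0 ?invr_neq0.
split.
- by exists (d i); [exact: hd|rewrite memvZ // -dj; exact: hd].
- exact: hw.
- apply: (subspZ _ (weight_subsp _ _)); rewrite -wj; exact: hw.
- rewrite adZr (bracket_opposite) ?wj ?subrr // scalerA.
  by rewrite /c mulfVK.
- by rewrite hroot_self.
Qed.

Lemma root_nilpotent (V : vectType F) (X : action g V) (i : 'I_n) (mu : dual) c u :
  wt i != 0 -> weight X mu u -> exists k, iter k (X (c *: b`_i)) u = 0.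
Proof.
move=> wi hu; apply: (@weight_nilpotent _ _ _ ht V X mu (wt i)) => //.
  by move=> k; rewrite pnatr_eq0.
by apply: (subspZ _ (weight_subsp _ _)); exact: hw.
Qed.

Lemma last_nonzero (V : lmodType F) (f : V -> V) u : u != 0 -> (exists k, iter k f u = 0) ->
  exists q, iter q f u != 0 /\ f (iter q f u) = 0.
Proof.
move=> u0 [k hk]; have ex : exists k, iter k f u == 0 by exists k; apply/eqP.
case: (ex_minnP ex) => [[|q]] /eqP hq hmin.
  by move: u0; rewrite -[u]/(iter 0 f u) hq eqxx.
by exists q; split=> //; apply/negP => /hmin; rewrite ltnn.
Qed.

(** A vector of the root space of [- alpha] orthogonal to that of [alpha] would
    be a highest weight vector of eigenvalue [-2]. *)
Lemma rb_wt_inj (i j : 'I_n) : wt i != 0 -> wt i = wt j -> i = j.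
Proof.
move=> wi wij; have [k [wk _ _]] := partner i.
have wk0 : wt k != 0 by rewrite wk oppr_eq0.
have [m [c [c0 wm nz tri]]] := root_triple wk0.
have wik : wt i = - wt k by rewrite wk opprK.
have wjk : wt j = - wt k by rewrite -wij.
suff uniq l : wt l = - wt k -> l = m by rewrite (uniq i wik) (uniq j wjk).
move=> wl; apply/eqP; apply: contrapT => /negP lm.
pose x := b`_l - (killing b`_k b`_l / killing b`_k b`_m) *: b`_m.
have x0 : x != 0.
  apply/eqP => /(congr1 (coord b l)); rewrite linear0 linearB linearZ /=.
  rewrite !(coord_basis_elt hb) eqxx eq_sym (negbTE lm) mulr0 subr0 => /eqP.
  by rewrite oner_eq0.
have hx : weight Ad (- wt k) x.
  apply: (subspB (weight_subsp _ _)); first by rewrite -wl; exact: hw.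
  by apply: (subspZ _ (weight_subsp _ _)); rewrite -wm; exact: hw.
have ex : Ad b`_k x = 0.
  rewrite /= adBr adZr !(bracket_opposite) ?wl ?wm ?subrr //.
  by rewrite scalerA mulfVK // subrr.
have [|r hr _] := sl2_dominant ht tri hx ex x0.
  by apply: (root_nilpotent _ _ hx); rewrite wm oppr_eq0.
move: hr; rewrite opp_lfunE hroot_self // => /eqP.
by rewrite eq_sym -subr_eq0 opprK -natrD pnatr_eq0 addn2.
Qed.

(** Raising a root vector of weight [k alpha] to the top and lowering it again
    passes through the line of [e], which [e] kills; but in such a string only the
    top is killed by [e]. *)
Lemma multiple_not_root (i p : 'I_n) k : wt i != 0 -> (1 < k)%N -> wt p <> wt i *+ k.
Proof.
move=> wi k1 wp; have [m [c [c0 wm nz tri]]] := root_triple wi.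
have [q [w0 ew]] : exists q, iter q (Ad b`_i) b`_p != 0 /\ Ad b`_i (iter q (Ad b`_i) b`_p) = 0.
  apply: last_nonzero; first exact: rb_neq0.
  have := root_nilpotent 1 wi (hw p); rewrite scale1r; exact.
have hww := iter_act_weight ht q (hw i) (hw p).
have [|r hr [_ nzr]] := sl2_dominant ht tri hww ew w0.
  by apply: (root_nilpotent _ _ hww); rewrite wm oppr_eq0.
have hr2 : r = (2 * (k + q))%N.
  apply/eqP; rewrite -(eqr_nat F) -hr wp -mulrnDr -scaler_nat scale_lfunE.
  by rewrite hroot_self // natrM mulrC.
have kq : (k + q = (k + q).-1.+1)%N by rewrite prednK // addn_gt0 (ltnW k1).
(* The top has weight [(k + q) wt i]: the root space of [wt i] itself is reached
   after [s] steps down, in a string of [2 (k + q)] steps. *)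
set s := (k + q).-1 in kq; set w := iter q _ _ in w0 ew hww nzr.
have ss : (s.-1.+1 = s)%N by lia.
have [_ _ hf _ _] := tri.
have su : weight Ad (wt i) (iter s (Ad (c *: b`_m)) w).
  have := iter_act_weight ht s hf hww.
  rewrite wp -mulrnDr kq mulrS mulNrn addrK //.
have snz : iter s (Ad (c *: b`_m)) w != 0.
  by apply: nzr; rewrite hr2; lia.
have es : Ad b`_i (iter s (Ad (c *: b`_m)) w) = 0.
  set u := iter s _ _ in su snz *.
  have -> : u = coord b i u *: b`_i.
    rewrite {1}(coord_basis hb (memvf u)) (bigD1 i) //= big1 ?addr0 // => j ji.
    have [->|nzj] := eqVneq (coord b j u) 0; first by rewrite scale0r.
    have wj := coord_rb su nzj.
    by case/eqP: ji; apply: rb_wt_inj; rewrite wj.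
  by rewrite /= adZr (ad_self (hd i)) ?scaler0 // pnatr_eq0.
have := sl2_string ht tri hww ew s.-1; rewrite ss es => /esym/eqP.
have sr : (s.-1 <= r)%N by rewrite hr2; lia.
rewrite scaler_eq0 (negbTE (nzr _ sr)) orbF mulf_eq0 hr subr_eq0 eqr_nat.
rewrite pnatr_eq0 => /orP[/eqP|/eqP]; rewrite ?hr2; lia.
Qed.

(** Raise [b`_p] to the top of its string, [q] steps up, and lower it again: the
    string has [k + 2 q] steps, so [j + q] steps down from the top are
    possible. *)
Lemma root_string (i p : 'I_n) (k : nat) : wt i != 0 -> wt p (hroot (wt i)) = k%:R ->
  forall j, (j <= k)%N -> exists q : 'I_n, wt q = wt p - wt i *+ j.
Proof.
move=> wi hk j jk; have [m [c [c0 wm nz tri]]] := root_triple wi.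
have [q [w0 ew]] : exists q, iter q (Ad b`_i) b`_p != 0 /\ Ad b`_i (iter q (Ad b`_i) b`_p) = 0.
  apply: last_nonzero; first exact: rb_neq0.
  have := root_nilpotent 1 wi (hw p); rewrite scale1r; exact.
have hww := iter_act_weight ht q (hw i) (hw p).
have [|r hr [_ nzr]] := sl2_dominant ht tri hww ew w0.
  by apply: (root_nilpotent _ _ hww); rewrite wm oppr_eq0.
have hr2 : r = (k + 2 * q)%N.
  apply/eqP; rewrite -(eqr_nat F) -hr add_lfunE hk -[wt i *+ q]scaler_nat scale_lfunE.
  by rewrite hroot_self // natrD natrM [2 * _]mulrC.
have [_ _ hf _ _] := tri.
have hu := iter_act_weight ht (j + q) hf hww.
have [|l wl] := weight_index B hu.
  by apply: nzr; rewrite hr2; lia.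
by exists l; rewrite wl mulrnDr !mulNrn addrACA subrr addr0.
Qed.

(** At the top of the string, [q] steps up from [wt p], the value is a natural
    number. *)
Lemma root_integral (i p : 'I_n) : wt i != 0 -> exists m : int, wt p (hroot (wt i)) = m%:~R.
Proof.
move=> wi; have [m [c [c0 wm nz tri]]] := root_triple wi.
have [q [w0 ew]] : exists q, iter q (Ad b`_i) b`_p != 0 /\ Ad b`_i (iter q (Ad b`_i) b`_p) = 0.
  apply: last_nonzero; first exact: rb_neq0.
  have := root_nilpotent 1 wi (hw p); rewrite scale1r; exact.
have hww := iter_act_weight ht q (hw i) (hw p).
have [|r hr _] := sl2_dominant ht tri hww ew w0.
  by apply: (root_nilpotent _ _ hww); rewrite wm oppr_eq0.
exists (r%:Z - (2 * q)%:Z); rewrite rmorphB /= -!pmulrn -hr add_lfunE -[wt i *+ q]scaler_nat.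
by rewrite scale_lfunE hroot_self // natrM [2 * _]mulrC addrK.
Qed.

Definition reflect (alpha beta : dual) : dual := beta - (beta (hroot alpha) : F) *: alpha.

Lemma reflectD alpha x y : reflect alpha (x + y) = reflect alpha x + reflect alpha y.
Proof. by rewrite /reflect add_lfunE scalerDl opprD addrACA. Qed.

Lemma reflect0 alpha : reflect alpha 0 = 0.
Proof. by rewrite /reflect lfunE scale0r subr0. Qed.

Lemma reflectN alpha x : reflect alpha (- x) = - reflect alpha x.
Proof. by rewrite /reflect opp_lfunE scaleNr opprK opprB addrC. Qed.

Lemma reflectK (i : 'I_n) x : wt i != 0 -> reflect (wt i) (reflect (wt i) x) = x.
Proof.
move=> wi; rewrite /reflect add_lfunE opp_lfunE scale_lfunE hroot_self //.
rewrite scalerBl -scalerA opprB addrA.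
set y := _ *: wt i; set z := _ *: (_ *: _).
have -> : z = y + y by rewrite /z /y !scalerA -scalerDl -mulr2n mulr_natr.
by rewrite addrA subrK addrK.
Qed.

Lemma reflect_neg alpha x : reflect (- alpha) x = reflect alpha x.
Proof. by rewrite /reflect hrootNE scaleNr scalerN opprK. Qed.

Lemma reflect_self (i : 'I_n) : wt i != 0 -> reflect (wt i) (wt i) = - wt i.
Proof. by move=> wi; rewrite /reflect hroot_self // scaler_nat mulr2n opprD addrA subrr add0r. Qed.

Lemma reflect_form (i : 'I_n) x y : wt i != 0 ->
  dual_form (reflect (wt i) x) y = dual_form x (reflect (wt i) y).
Proof.
move=> wi; rewrite /reflect !hrootE -!scaleNr [x + _]addrC [y + _]addrC.
rewrite (dual_formDl B) (dual_formDr B); congr (_ + _).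
rewrite [dual_form (wt i) y]dual_formC !mulNr; congr (- _).
by ring.
Qed.

Lemma reflect_coroot (i : 'I_n) x beta : wt i != 0 ->
  reflect (wt i) x (hroot beta) = x (hroot (reflect (wt i) beta)).
Proof. by move=> wi; rewrite !hrootE reflect_form // reflect_form // reflectK. Qed.

(** The reflection of [wt p] lies on its string, on the side given by the sign of
    [wt p (hroot (wt i))]. *)
Lemma reflect_root (i p : 'I_n) : wt i != 0 -> exists q : 'I_n, wt q = reflect (wt i) (wt p).
Proof.
move=> wi; have [m hm] := root_integral p wi.
case: m hm => m hm.
  have [q wq] := root_string wi hm (leqnn m).
  by exists q; rewrite wq /reflect hm -scaler_nat.
have [j [wj _ _]] := partner i.
have wj0 : wt j != 0 by rewrite wj oppr_eq0.
have hm' : wt p (hroot (wt j)) = m.+1%:R.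
  by rewrite wj hrootNE hm NegzE mulrNz opprK.
have [q wq] := root_string wj0 hm' (leqnn _).
by exists q; rewrite -reflect_neg -wj wq /reflect hm' -scaler_nat.
Qed.

End Strings.

(** * Highest weight vectors *)

Section Generic.
Variables (F : fieldType).

Lemma sum_of_subsp (M : lmodType F) (pr : M -> Prop) :
  (forall a y, pr y -> pr (a *: y)) -> subsp (sum_of pr).
Proof.
move=> h; split=> [|a u v hu hv]; first exact: sum_of0.
apply: sum_ofD hv; case: hu => s -> hs'; rewrite scaler_sumr.
by apply: sum_of_sum => y /hs' /(h a); exact: sum_of1.
Qed.

Lemma subsp_preim (M N : lmodType F) (f : {linear M -> N}) (Q : N -> Prop) :
  subsp Q -> subsp (fun u => Q (f u)).
Proof.
move=> hQ; split=> [|a u v hu hv]; first by rewrite linear0; case: hQ.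
by rewrite linearP; case: hQ => _; apply.
Qed.

(** A subspace of maximal dimension contained in [Q]. *)
Lemma subsp_vspace (V : vectType F) (Q : V -> Prop) :
  subsp Q -> exists U : {vspace V}, forall v, v \in U <-> Q v.
Proof.
move=> hQ; pose P k := `[< exists2 U : {vspace V}, \dim U = k & forall v, v \in U -> Q v >].
have ex : exists k, P k.
  exists 0%N; apply/asboolP; exists 0%VS; rewrite ?dimv0 // => v.
  by rewrite memv0 => /eqP ->; case: hQ.
have ub k : P k -> (k <= \dim (fullv : {vspace V}))%N.
  by move=> /asboolP [U <- _]; exact: dimvS (subvf _).
case: (ex_maxnP ex ub) => k /asboolP [U dU hU] hmax; exists U => v; split; first exact: hU.
move=> Qv; apply: contrapT => /negP vU.
have : (k < \dim (U + <[v]>))%N.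
  rewrite ltnNge; apply: contra vU => h; rewrite memvE.
  have -> : U = (U + <[v]>)%VS by apply/eqP; rewrite eqEdim addvSl dU.
  exact: addvSr.
rewrite ltnNge => /negP; apply; apply: hmax; apply/asboolP.
exists (U + <[v]>)%VS => // w /memv_addP [u /hU Qu [x /vlineP [a ->] ->]].
by apply: subspD => //; exact: subspZ.
Qed.

End Generic.

Section HighestWeight.
Variables (F : numClosedFieldType) (g : gradedLieAlgebra F) (t : {vspace g}).
Local Notation dual := (dual_space t).
Variable B : root_basis t.
Local Notation n := (rb_size B).
Local Notation b := (rb_vec B).
Local Notation wt := (rb_wt B).
Let ht := rb_cartan B.
Let hb := rb_basis B.
Let hd := rb_homogeneous B.
Let hw := rb_weight B.

(** Positivity on the whole dual, in the weak form that is stable under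
    reflections. *)
Definition posys (P : dual -> Prop) :=
  [/\ ~ P 0, forall x y, P x -> P y -> P (x + y) &
      forall i : 'I_n, wt i != 0 -> P (wt i) \/ P (- wt i)].

Definition singular (P : dual -> Prop) M (X : action g M) (mu : dual) v :=
  weight X mu v /\ forall i : 'I_n, P (wt i) -> X b`_i v = 0.

Definition word_act M (X : action g M) (w : seq 'I_n) (v : M) : M :=
  foldr (fun (i : 'I_n) u => X b`_i u) v w.

Definition word_wt (w : seq 'I_n) : dual := \sum_(i <- w) wt i.

Definition negative (P : dual -> Prop) (w : seq 'I_n) := forall i, i \in w -> P (- wt i).

(** By [descendant_stable] this is the submodule generated by [v], when [v] is
    singular. *)
Definition descendant (P : dual -> Prop) M (X : action g M) (v : M) : M -> Prop :=
  sum_of (fun y => exists c w, negative P w /\ y = c *: word_act X w v).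

Section Descendants.
Variables (P : dual -> Prop) (hP : posys P).
Variables (M : lmodType F) (X : action g M).

Lemma descendant_subsp v : subsp (descendant P X v).
Proof.
by apply: sum_of_subsp => a y [c [w [hw' ->]]]; exists (a * c), w; rewrite scalerA.
Qed.

Lemma descendant_word v w : negative P w -> descendant P X v (word_act X w v).
Proof. by move=> hw'; apply: sum_of1; exists 1, w; rewrite scale1r. Qed.

Lemma act_basis_ind (Q : M -> Prop) u x : subsp Q ->
  (forall i : 'I_n, coord b i x != 0 -> Q (X b`_i u)) -> Q (X x u).
Proof.
move=> hQ h; rewrite (coord_basis hb (memvf x)) act_suml.
apply: subsp_sum => // i _; rewrite actZl.
have [->|nz] := eqVneq (coord b i x) 0; first by rewrite scale0r; case: hQ.
by apply: subspZ => //; exact: h.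
Qed.

(** Commute [X b_i] to the right through the word; the commutator terms only
    involve the shorter word that remains. *)
Lemma descendant_stable mu v : singular P X mu v ->
  forall x u, descendant P X v u -> descendant P X v (X x u).
Proof.
case=> hv sv; have hD := descendant_subsp v.
have D1 (i : 'I_n) u : P (- wt i) -> descendant P X v u -> descendant P X v (X b`_i u).
  move=> Pi; apply: (sum_of_ind (subsp_preim (X b`_i) hD)) => y [c [w [nw ->]]].
  rewrite linearZ /=; apply: subspZ => //; apply: (@descendant_word v (i :: w)).
  by move=> j; rewrite inE => /orP[/eqP ->|/nw].
have W w : negative P w -> forall x, descendant P X v (X x (word_act X w v)).
  elim: w => [|j w IH] nw x.
    apply: act_basis_ind => // i _ /=.
    have [wi0|wi] := eqVneq (wt i) 0.
      have it := rb_zero B i wi0; have := hv (Subvs it); rewrite /t_act /= => ->.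
      by apply: subspZ => //; apply: (@descendant_word v [::]).
    have [_ _ /(_ i wi) [/sv ->|Pi]] := hP; first by case: hD.
    by apply: (@descendant_word v [:: i]) => k; rewrite inE => /eqP ->.
  have nj : P (- wt j) by apply: nw; rewrite mem_head.
  have {}nw : negative P w by move=> k kw; apply: nw; rewrite inE kw orbT.
  apply: act_basis_ind => // i _ /=.
  have := act_bracket X (word_act X w v) (hd i) (hd j).
  move=> /eqP; rewrite eq_sym subr_eq => /eqP ->.
  apply: subspD => //; first exact: IH.
  by apply: subspZ => //; apply: D1 => //; exact: IH.
move=> x u; apply: (sum_of_ind (subsp_preim (X x) hD)) => y [c [w [nw ->]]].
by rewrite linearZ /=; apply: subspZ => //; exact: W.
Qed.

Lemma word_weight mu v w : weight X mu v -> weight X (mu + word_wt w) (word_act X w v).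
Proof.
move=> hv; elim: w => [|i w IH] /=; first by rewrite /word_wt big_nil addr0.
by rewrite /word_wt big_cons addrCA; apply: act_weight.
Qed.

Lemma negative_weight w : negative P w -> w = [::] \/ P (- word_wt w).
Proof.
case: w => [|i w] nw; [by left|right]; have [_ PD _] := hP.
elim: w i nw => [|j w IH] i nw.
  by rewrite /word_wt big_seq1; apply: nw; rewrite mem_head.
rewrite /word_wt big_cons opprD; apply: PD; first by apply: nw; rewrite mem_head.
by apply: IH => k kw; apply: nw; rewrite inE kw orbT.
Qed.

Lemma weight_extract_sum (Q : M -> Prop) mu u u' :
  subsp Q -> (forall h v, Q v -> Q (t_act (t:=t) X h v)) -> weight X mu u ->
  sum_of (fun y => exists2 nu : dual, weight X nu y & nu != mu) u' ->
  Q (u + u') -> Q u.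
Proof.
move=> hQ hA hu [s -> hs'].
have /choice [nu hnu] : forall y : M, exists nu : dual, y \in s -> weight X nu y /\ nu != mu.
  move=> y; case: (boolP (y \in s)) => [/hs' [nu ? ?]|_]; last by exists 0.
  by exists nu.
exact: (weight_extract hQ hA hu (nu := nu) (w := id)).
Qed.

Lemma descendant_split mu v u : weight X mu v -> descendant P X v u ->
  exists c, sum_of (fun y => exists2 nu : dual, weight X nu y & P (mu - nu)) (u - c *: v).
Proof.
move=> hv; set low := sum_of _.
have sl : subsp low.
  apply: sum_of_subsp => a y [nu hy Pnu]; exists nu => //.
  exact: (subspZ _ (weight_subsp _ _)).
apply: (sum_of_ind (Q := fun u => exists c, low (u - c *: v))).
  split=> [|a x y [c hc] [c' hc']]; first by exists 0; rewrite scale0r subr0; case: sl.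
  exists (a * c + c'); rewrite scalerDl -scalerA opprD addrACA -scalerBr.
  by case: sl => _; apply.
move=> y [c [w [nw ->]]].
have [->|Pw] := negative_weight nw; first by exists c; rewrite subrr; case: sl.
exists 0; rewrite scale0r subr0; apply: subspZ => //; apply: sum_of1.
exists (mu + word_wt w); first exact: word_weight.
by rewrite opprD addrA subrr add0r.
Qed.

Lemma low_neq (mu : dual) (y : M) : (exists2 nu : dual, weight X nu y & P (mu - nu)) ->
  exists2 nu : dual, weight X nu y & nu != mu.
Proof.
case=> nu hy Pnu; exists nu => //; apply/eqP => e.
by have [] := hP; rewrite -(subrr mu) -{2}e.
Qed.

(** Subtract the multiple of [v] that leaves only lower weights. *)
Lemma descendant_top (mu : dual) v u : weight X mu v -> descendant P X v u -> weight X mu u ->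
  exists c, u = c *: v.
Proof.
move=> hv /(descendant_split hv) [c hc] hu; exists c; apply/eqP; rewrite -subr_eq0.
apply/eqP; apply: (@weight_extract_sum (fun v => v = 0) mu _ (- (u - c *: v))).
- exact: subsp0.
- by move=> h y ->; rewrite linear0.
- apply: (subspB (weight_subsp _ _)) => //; exact: (subspZ _ (weight_subsp _ _)).
- have := sum_of_bind _ hc (pr' := fun y => exists2 nu : dual, weight X nu y & nu != mu).
  move=> h; apply: subspN; last by apply: h => y /low_neq ?; apply: sum_of1.
  apply: sum_of_subsp => a y [nu hy Pnu]; exists nu => //.
  exact: (subspZ _ (weight_subsp _ _)).
- by rewrite subrr.
Qed.

Lemma descendant_weight (mu : dual) v u (nu : dual) : weight X mu v -> descendant P X v u ->
  weight X nu u -> u != 0 -> exists2 w, negative P w & nu = mu + word_wt w.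
Proof.
move=> hv du hu /eqP u0; apply: contrapT => no; apply: u0.
apply: (@weight_extract_sum (fun v => v = 0) nu _ (- u)).
- exact: subsp0.
- by move=> h y ->; rewrite linear0.
- by [].
- have sl : subsp (sum_of (fun y : M => exists2 k : dual, weight X k y & k != nu)).
    apply: sum_of_subsp => a y [k hy Pnu]; exists k => //.
    exact: (subspZ _ (weight_subsp _ _)).
  apply: subspN => //; apply: sum_of_ind du => // y [c [w [nw ->]]].
  apply: subspZ => //; apply: sum_of1; exists (mu + word_wt w); first exact: word_weight.
  by apply/eqP => e; apply: no; exists w.
- by rewrite subrr.
Qed.

End Descendants.
End HighestWeight.

(** * Highest weights of irreducible representations *)

Section Irreducible.
Variables (F : numClosedFieldType) (g : gradedLieAlgebra F) (t : {vspace g}).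
Local Notation dual := (dual_space t).
Variable B : root_basis t.
Local Notation n := (rb_size B).
Local Notation b := (rb_vec B).
Local Notation wt := (rb_wt B).
Let ht := rb_cartan B.
Let hs := rb_centralizing B.
Let hw := rb_weight B.
Variables (P : dual -> Prop) (hP : posys B P) (Dp : set dual).
Hypothesis hDp : forall alpha, Dp alpha <-> roots t alpha /\ P alpha.

Local Notation RX := (@rep_action F g).

Lemma irreducible_ind (rho : representation g) (Q : rep_space rho -> Prop) v :
  irreducible rho -> subsp Q -> (forall x u, Q u -> Q (rho x u)) -> Q v -> v != 0 ->
  forall u, Q u.
Proof.
move=> [_ irr] hQ hX Qv v0 u; have [U hU] := subsp_vspace hQ.
have [|U0|UT] := irr U; first by move=> x w /hU /(hX x) /hU.
  by move/hU: Qv; rewrite U0 memv0 (negbTE v0).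
by apply/hU; rewrite UT memvf.
Qed.

Lemma weight_vector_exists (V : vectType F) (X : action g V) (v : V) : v != 0 ->
  exists mu : dual, exists2 u, weight X mu u & u != 0.
Proof.
move=> v0; have Xl := @t_act_linear F g t V X.
have Xc := @t_act_comm F g t ht hs V X.
have [s ev hs'] := joint_decomposition Xl Xc (Q := fun _ => True)
  (conj I (fun _ _ _ _ _ => I)) (fun _ _ _ => I) I (x := v).
have [y ys y0] : exists2 y, y \in s & y != 0.
  apply: contrapT => no; case/eqP: v0; rewrite ev big_seq big1 // => y ys.
  by apply/eqP; apply: contrapT => /negP y0; apply: no; exists y.
have [[mu hmu] _] := hs' y ys; exists mu.
have [h u ->|h u _|/eqP|u [_ u0 hu]] := eigenvector_mod Xl Xc (@subsp0 F V) _
    (D := fun _ => True) (conj I (fun _ _ _ _ _ => I)) _ hmu I.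
- by rewrite linear0.
- by [].
- by rewrite (negbTE y0).
by exists u; [move=> h; apply/eqP; rewrite -subr_eq0; apply/eqP; exact: hu|apply/eqP].
Qed.

(** Otherwise raising operators would produce weight vectors with strictly
    increasing weights forever. *)
Lemma singular_exists (V : vectType F) (X : action g V) (v : V) : v != 0 ->
  exists mu u, u != 0 /\ singular B P X mu u.
Proof.
move=> v0; have [mu0 [u0 hu0 nz0]] := weight_vector_exists X v0.
apply: contrapT => no.
pose S := {p : dual * V | weight X p.1 p.2 /\ p.2 != 0}.
have step (s : S) : exists s' : S, P ((sval s').1 - (sval s).1).
  case: s => -[mu u] /= [hu nz].
  have [i [Pi nzi]] : exists i : 'I_n, P (wt i) /\ X b`_i u != 0.
    apply: contrapT => no'; apply: no; exists mu, u; split=> //; split=> // i Pi.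
    by apply/eqP; apply: contrapT => /negP h; apply: no'; exists i.
  have hX : weight X (wt i + mu) (X b`_i u) by apply: act_weight.
  by exists (exist _ (wt i + mu, X b`_i u) (conj hX nzi)); rewrite /= addrK.
have [f hf] := choice step.
pose s0 : S := exist _ (mu0, u0) (conj hu0 nz0).
pose nu k := (sval (iter k f s0)).1.
have [P0 PD _] := hP.
have inc k m : P (nu (k + m.+1)%N - nu k).
  elim: m => [|m IH]; first by rewrite addn1; exact: hf.
  by rewrite -(subrK (nu (k + m.+1)%N) (nu _)) -addrA; apply: PD => //; rewrite addnS; exact: hf.
have nneq i j : (i < j)%N -> nu i <> nu j.
  by move=> /subnKC <- e; apply: P0; rewrite -(subrr (nu i)) {1}e addSnnS; exact: inc.
pose m := \dim (fullv : {vspace V}).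
suff : (m.+1 <= m)%N by rewrite ltnn.
apply: (@independent_weights _ _ t V X m.+1 (fun i => nu i) (fun i => (sval (iter i f s0)).2)).
- move=> i j e; apply: val_inj => /=; apply/eqP; rewrite eqn_leq.
  by apply/andP; split; rewrite leqNgt; apply/negP => /nneq; rewrite e.
- by move=> i; case: (svalP (iter i f s0)).
- by move=> i; case: (svalP (iter i f s0)).
Qed.

Lemma descendant_full (rho : representation g) mu v : irreducible rho -> v != 0 ->
  singular B P (RX rho) mu v -> forall u, descendant B P (RX rho) v u.
Proof.
move=> irr v0 sv; apply: (irreducible_ind irr (v := v)) => //.
- exact: descendant_subsp.
- by move=> x u; exact: (descendant_stable hP sv).
- exact: (@descendant_word _ _ _ B P _ (RX rho) v [::]).
Qed.

(** In finite dimension the opposite root vector acts nilpotently, so this is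
    [sl2_dominant]. *)
Lemma singular_dominant (V : vectType F) (X : action g V) mu v (i : 'I_n) :
  v != 0 -> singular B P X mu v -> wt i != 0 -> P (wt i) ->
  exists k : nat, mu (hroot (wt i)) = k%:R.
Proof.
move=> v0 [hv sv] wi Pi; have [j [c [c0 wj nz tri]]] := root_triple wi.
have [|k hk _] := sl2_dominant ht tri hv (sv i Pi) v0; last by exists k.
by apply: (root_nilpotent (i := j) _ _ hv); rewrite wj oppr_eq0.
Qed.

Lemma posys_neq0 (alpha : dual) : P alpha -> alpha != 0.
Proof. by move=> Pa; apply/eqP => a0; have [] := hP; rewrite a0 in Pa. Qed.

Lemma positive_roots_finite : finite_set Dp.
Proof.
apply: (sub_finite_set _ (finite_seq [seq wt i | i <- enum 'I_n])) => alpha /=.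
by move=> /hDp [/(rootsP B) [_ [i <-]] _]; rewrite /= map_f // mem_enum.
Qed.

Let S : seq dual := finmap.enum_fset (fset_set Dp).

Let fsumE (f : dual -> nat) : \sum_(alpha \in Dp) (alpha *+ f alpha) = \sum_(alpha <- S) (alpha *+ f alpha).
Proof. by rewrite (fsbig_finite _ _ positive_roots_finite). Qed.

Let SP alpha : (alpha \in S) = (alpha \in Dp).
Proof. by have := in_fset_set positive_roots_finite alpha. Qed.

Lemma positive_sum (f : dual -> nat) :
  \sum_(alpha \in Dp) (alpha *+ f alpha) = 0 \/ P (\sum_(alpha \in Dp) (alpha *+ f alpha)).
Proof.
have [_ PD _] := hP; rewrite fsumE big_seq.
apply: (big_ind (fun x => x = 0 \/ P x)) => [|x y|alpha]; first by left.
  by move=> [->|Px] [->|Py]; rewrite ?addr0 ?add0r; [left|right|right|right; exact: PD].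
rewrite SP inE => /hDp [_ Pa]; elim: (f alpha) => [|k [IH|IH]]; first by left.
  by right; rewrite mulrS IH addr0.
by right; rewrite mulrS; exact: PD.
Qed.

Lemma negative_word_sum (w : seq 'I_n) : negative P w ->
  exists f : dual -> nat, word_wt w = - \sum_(alpha \in Dp) (alpha *+ f alpha).
Proof.
move=> nw; exists (fun alpha => count (fun i => - wt i == alpha) w); rewrite fsumE.
elim: w nw => [|i w IH] nw.
  by rewrite /word_wt big_nil big1 ?oppr0.
rewrite /word_wt big_cons -/(word_wt w) IH; last first.
  by move=> j jw; apply: nw; rewrite inE jw orbT.
have Pi : P (- wt i) by apply: nw; rewrite mem_head.
have iS : - wt i \in S.
  rewrite SP inE; apply/hDp; split=> //; apply/(rootsP B); split; first exact: posys_neq0.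
  by have [j [wj _ _]] := partner i; exists j.
rewrite /= -[wt i]opprK -opprD; congr (- _); rewrite opprK.
under [RHS]eq_bigr => a _ do rewrite mulrnDr.
rewrite big_split /=; congr (_ + _).
rewrite (bigD1_seq (- wt i)) ?finmap.fset_uniq //= eqxx mulr1n big1 ?addr0 // => a ai.
by rewrite eq_sym (negbTE ai).
Qed.

Lemma singular_highest (rho : representation g) mu v : irreducible rho -> v != 0 ->
  singular B P (RX rho) mu v -> is_highest_weight Dp rho mu.
Proof.
move=> irr v0 sv; have [hv _] := sv; split; first by exists v.
move=> nu [u u0 hu].
have [w nw ->] := descendant_weight hv (descendant_full irr v0 sv u) hu u0.
have [f ->] := negative_word_sum nw; by exists f.
Qed.

(** The two differences are sums of positive roots, opposite to each other. *)
Lemma highest_weight_unique (rho : representation g) (mu nu : dual) :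
  is_highest_weight Dp rho mu -> is_highest_weight Dp rho nu -> mu = nu.
Proof.
move=> [hm Hm] [hn Hn]; have [f ef] := Hm _ hn; have [f' ef'] := Hn _ hm.
have [P0 PD _] := hP.
have [e|Pf] := positive_sum f; first by rewrite ef e subr0.
have [e|Pf'] := positive_sum f'; first by rewrite ef' e subr0.
case: P0; have := PD _ _ Pf Pf'; congr P; apply/eqP.
by rewrite -oppr_eq0 opprD -(inj_eq (addrI mu)) addrA -ef -ef' addr0.
Qed.

Lemma highest_weight_exists (rho : representation g) : irreducible rho ->
  exists mu v, [/\ v != 0, singular B P (RX rho) mu v & is_highest_weight Dp rho mu].
Proof.
move=> irr; have [v v0] : exists v : rep_space rho, v != 0.
  apply: contrapT => no; case: irr => nz _; apply: nz; apply/vspaceP => v.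
  rewrite memvf memv0; apply/esym; apply: contrapT => /negP h.
  by apply: no; exists v.
have [mu [u [u0 su]]] := singular_exists (RX rho) v0.
by exists mu, u; split=> //; exact: singular_highest su.
Qed.

Lemma highest_weight_singular (rho : representation g) mu : irreducible rho ->
  is_highest_weight Dp rho mu -> exists2 v, v != 0 & singular B P (RX rho) mu v.
Proof.
move=> irr hm; have [nu [v [v0 sv hn]]] := highest_weight_exists irr.
by rewrite (highest_weight_unique hm hn); exists v.
Qed.

Lemma highest_weight_dominant (rho : representation g) mu : irreducible rho ->
  is_highest_weight Dp rho mu ->
  (forall alpha, Dp alpha -> 0 <= 2 * dual_form mu alpha / dual_form alpha alpha) /\
  (forall alpha, roots t alpha -> exists m : int,
     2 * dual_form mu alpha / dual_form alpha alpha = m%:~R).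
Proof.
move=> irr hm; have [v v0 sv] := highest_weight_singular irr hm.
split=> alpha.
  move=> /hDp [/(rootsP B) [a0 [i wi]] Pa]; rewrite -wi in a0 Pa *.
  have [k hk] := singular_dominant v0 sv a0 Pa.
  by rewrite -(hrootE B) hk ler0n.
move=> /(rootsP B) [a0 [i wi]]; rewrite -wi in a0 *; rewrite -(hrootE B).
have [_ _ /(_ i a0) [Pi|Pi]] := hP.
  by have [k ->] := singular_dominant v0 sv a0 Pi; exists k; rewrite -pmulrn.
have [j [wj _ _]] := partner i.
have wj0 : wt j != 0 by rewrite wj oppr_eq0.
rewrite -wj in Pi; have [k] := singular_dominant v0 sv wj0 Pi.
rewrite wj (hrootNE B) => /eqP; rewrite eqr_oppLR => /eqP ->.
by exists (- k%:Z); rewrite mulrNz -pmulrn.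
Qed.

Lemma equiv_highest_weight (rho sigma : representation g) mu :
  rep_equiv rho sigma -> is_highest_weight Dp rho mu -> is_highest_weight Dp sigma mu.
Proof.
move=> [f [f' fK f'K] hf].
have fw (nu : dual) : is_weight rho nu <-> is_weight sigma nu.
  split=> -[v v0 hv].
    exists (f v); last by move=> h; rewrite -hf hv linearZ.
    by apply: contra_neq v0 => e; rewrite -(fK v) e -(linear0 f) fK.
  exists (f' v); last first.
    by move=> h; rewrite -[LHS]fK hf f'K hv -[v in LHS]f'K -linearZ fK.
  by apply: contra_neq v0 => e; rewrite -(f'K v) e linear0.
by move=> [/fw hm H]; split=> // nu /fw; exact: H.
Qed.

End Irreducible.

(** * Irreducible representations with the same highest weight *)

Section Product.
Variables (F : fieldType) (g : gradedLieAlgebra F).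
Variables (M N : lmodType F) (X : action g M) (Y : action g N).

Let pr (x : g) (p : M * N) : M * N := (X x p.1, Y x p.2).

Let pr_linear x : linear (pr x).
Proof. by move=> a u v; rewrite /pr !linearP. Qed.

HB.instance Definition _ x :=
  GRing.isLinear.Build F (M * N)%type (M * N)%type _ (pr x) (pr_linear x).

Program Definition product_action : action g (M * N)%type :=
  @Action F g (M * N)%type (fun x => pr x : {linear (M * N)%type -> (M * N)%type}) _ _.
Next Obligation.
by move=> a x y u; apply/pair_equal_spec; split; rewrite /= act_linear.
Qed.
Next Obligation.
move=> a c x y u xa yb; apply/pair_equal_spec; split.
  by rewrite /= (act_bracket X u.1 xa yb).
by rewrite /= (act_bracket Y u.2 xa yb).
Qed.

Lemma product_actionE x u v : product_action x (u, v) = (X x u, Y x v).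
Proof. by []. Qed.

End Product.

Lemma pairZD (F : fieldType) (U V : lmodType F) a (x y : U) (x' y' : V) :
  a *: (x, x') + (y, y') = (a *: x + y, a *: x' + y').
Proof. by []. Qed.

Section Equivalence.
Variables (F : numClosedFieldType) (g : gradedLieAlgebra F) (t : {vspace g}).
Local Notation dual := (dual_space t).
Variable B : root_basis t.
Variables (P : dual -> Prop) (hP : posys B P).
Variables (rho sigma : representation g) (mu : dual).
Variables (v : rep_space rho) (w : rep_space sigma).
Hypotheses (irho : irreducible rho) (isigma : irreducible sigma).
Hypotheses (v0 : v != 0) (w0 : w != 0).
Hypothesis sv : singular B P (rep_action rho) mu v.
Hypothesis sw : singular B P (rep_action sigma) mu w.

Let V := rep_space rho.
Let W := rep_space sigma.
Let XY := product_action (rep_action rho) (rep_action sigma).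

Let svw : singular B P XY mu (v, w).
Proof.
have [[hv kv] [hw kw]] := (sv, sw); split=> [h|i Pi].
  by rewrite /t_act product_actionE; congr pair; [exact: hv|exact: hw].
by rewrite product_actionE kv ?kw.
Qed.

(** The submodule generated by [(v, w)]; as its vectors of weight [mu] are the
    multiples of [(v, w)], it meets neither factor and so is the graph of an
    isomorphism. *)
Let graph (p : V * W) := descendant B P XY (v, w) p.

Let graph_subsp : subsp graph. Proof. exact: descendant_subsp. Qed.
Let graph_act x p : graph p -> graph (XY x p).
Proof. exact: (descendant_stable hP svw). Qed.
Let graph_vw : graph (v, w).
Proof. exact: (@descendant_word _ _ _ B P _ XY (v, w) [::]). Qed.

Let graph_top p : graph p -> weight XY mu p -> exists c, p = c *: (v, w).
Proof. by case: svw => hvw _; exact: (descendant_top hP hvw). Qed.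

Let graph_0r u : graph (0, u) -> u = 0.
Proof.
move=> gu; apply/eqP; apply: contrapT => /negP u0; have [h0 hD] := graph_subsp.
have all : forall u', graph (0, u').
  apply: (irreducible_ind isigma (v := u)) => //.
    split=> // a x y hx hy; have := hD a _ _ hx hy.
    by rewrite pairZD scaler0 addr0.
  by move=> x y /(graph_act x); rewrite product_actionE linear0.
have [|c [/esym/eqP]] := graph_top (all w).
  move=> h; rewrite /t_act product_actionE linear0; congr pair; first by rewrite scaler0.
  by case: sw => hw _; exact: hw.
rewrite scaler_eq0 (negbTE v0) orbF => /eqP ->; rewrite scale0r => /eqP.
by rewrite (negbTE w0).
Qed.

Let graph_0l u : graph (u, 0) -> u = 0.
Proof.
move=> gu; apply/eqP; apply: contrapT => /negP u0; have [h0 hD] := graph_subsp.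
have all : forall u', graph (u', 0).
  apply: (irreducible_ind irho (v := u)) => //.
    split=> // a x y hx hy; have := hD a _ _ hx hy.
    by rewrite pairZD scaler0 addr0.
  by move=> x y /(graph_act x); rewrite product_actionE linear0.
have [|c [+ /esym/eqP]] := graph_top (all v).
  move=> h; rewrite /t_act product_actionE linear0; congr pair; last by rewrite scaler0.
  by case: sv => hv _; exact: hv.
rewrite scaler_eq0 (negbTE w0) orbF => + /eqP c0; rewrite c0 scale0r => /eqP.
by rewrite (negbTE v0).
Qed.

Let graph_r u : exists u', graph (u, u').
Proof.
have [h0 hD] := graph_subsp.
apply: (irreducible_ind (Q := fun u => exists u', graph (u, u')) irho (v := v)) => //; last by exists w.
  split=> [|a x y [x' hx] [y' hy]]; first by exists 0.
  by exists (a *: x' + y'); exact: hD hx hy.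
by move=> x y [y' /(graph_act x) hy]; exists (sigma x y').
Qed.

Let graph_l u' : exists u, graph (u, u').
Proof.
have [h0 hD] := graph_subsp.
apply: (irreducible_ind (Q := fun u' => exists u, graph (u, u')) isigma (v := w)) => //; last by exists v.
  split=> [|a x y [x' hx] [y' hy]]; first by exists 0.
  by exists (a *: x' + y'); exact: hD hx hy.
by move=> x y [y' /(graph_act x) hy]; exists (rho x y').
Qed.

Let graph_funr u u1 u2 : graph (u, u1) -> graph (u, u2) -> u1 = u2.
Proof.
move=> g1 g2; apply/eqP; rewrite -subr_eq0; apply/eqP; apply: graph_0r.
by have := graph_subsp.2 (-1) _ _ g2 g1; rewrite pairZD !scaleN1r addNr addrC.
Qed.

Let graph_funl u u1 u2 : graph (u1, u) -> graph (u2, u) -> u1 = u2.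
Proof.
move=> g1 g2; apply/eqP; rewrite -subr_eq0; apply/eqP; apply: graph_0l.
by have := graph_subsp.2 (-1) _ _ g2 g1; rewrite pairZD !scaleN1r addNr addrC.
Qed.

Lemma equiv_of_singular : rep_equiv rho sigma.
Proof.
have [f gf] := choice graph_r; have [f' gf'] := choice graph_l.
have [_ hD] := graph_subsp.
have lin : linear f by move=> a x y; apply: (graph_funr (gf _)); exact: hD (gf x) (gf y).
have [L LE] := hom_exists lin.
exists L.
  exists f' => u; first by rewrite LE; apply: (graph_funl (gf' _) (gf u)).
  by rewrite LE; apply: (graph_funr (gf _) (gf' u)).
by move=> x u; rewrite !LE; apply: (graph_funr (gf _)); exact: graph_act (gf u).
Qed.

End Equivalence.

(** * The shuffle algebra *)

Section Shuffle.
Variables (F : fieldType) (I : Type).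

(** Linear functionals on the free algebra on [I], given by their values on
    words, with the product dual to the coproduct for which letters are
    primitive. *)
Definition shuffle := seq I -> F.

HB.instance Definition _ := GRing.Lmodule.copy shuffle (seq I -> F^o).

(** Dual to left and right multiplication by a letter; both are derivations of
    the shuffle product. *)
Definition lderiv (i : I) (f : shuffle) : shuffle := fun w => f (i :: w).
Definition rderiv (i : I) (f : shuffle) : shuffle := fun w => f (rcons w i).

Fixpoint shmul_at (w : seq I) (f h : shuffle) : F :=
  if w is i :: w' then shmul_at w' (lderiv i f) h + shmul_at w' f (lderiv i h)
  else f [::] * h [::].

Definition shmul (f h : shuffle) : shuffle := fun w => shmul_at w f h.
Definition shone : shuffle := fun w => if w is [::] then 1 else 0.

Lemma shmulDl f f' h : shmul (f + f') h = shmul f h + shmul f' h.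
Proof.
apply/funext => w; rewrite /shmul.
elim: w f f' h => [|i w IH] f f' h /=; first by rewrite mulrDl.
by rewrite -[lderiv i (f + f')]/(lderiv i f + lderiv i f') !IH addrACA.
Qed.

Lemma shmulC f h : shmul f h = shmul h f.
Proof.
apply/funext => w; rewrite /shmul; elim: w f h => [|i w IH] f h /=; first by rewrite mulrC.
by rewrite addrC; congr (_ + _); exact: IH.
Qed.

Lemma shmulA f h k : shmul f (shmul h k) = shmul (shmul f h) k.
Proof.
apply/funext => w; elim: w f h k => [|i w IH] f h k; first by rewrite /shmul /= mulrA.
have L p q : lderiv i (shmul p q) = shmul (lderiv i p) q + shmul p (lderiv i q) by [].
have E p q : shmul p q (i :: w) = shmul (lderiv i p) q w + shmul p (lderiv i q) w by [].
have Dr p q r : shmul p (q + r) = shmul p q + shmul p r.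
  by rewrite shmulC shmulDl !(shmulC _ p).
have D (p q : shuffle) : (p + q) w = p w + q w by [].
by rewrite !E !L Dr shmulDl !D addrA !IH.
Qed.

Lemma shmul1 f : shmul shone f = f.
Proof.
apply/funext => w; rewrite /shmul; elim: w f => [|i w IH] f /=; first by rewrite mul1r.
rewrite IH; suff -> : shmul_at w (lderiv i shone) f = 0 by rewrite add0r.
elim: w f {IH} => [|j w IH] f /=; first by rewrite mul0r.
by rewrite IH -[lderiv j _]/(lderiv i shone) IH addr0.
Qed.

Lemma shone_neq0 : shone != 0.
Proof. by apply/eqP => /(congr1 (fun f : shuffle => f [::])) /eqP; rewrite /= oner_eq0. Qed.

HB.instance Definition _ := GRing.Zmodule_isComNzRing.Build shuffle
  shmulA shmulC shmul1 shmulDl shone_neq0.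

Lemma shZl a (f h : shuffle) : (a *: f) * h = a *: (f * h).
Proof.
apply/funext => w; rewrite -[RHS]/(a * shmul_at w f h) -[LHS]/(shmul_at w (a *: f) h).
elim: w f h => [|i w IH] f h /=; first by rewrite -mulrA.
by rewrite -[lderiv i (a *: f)]/(a *: lderiv i f) !IH mulrDr.
Qed.

Lemma shZr a (f h : shuffle) : f * (a *: h) = a *: (f * h).
Proof. by rewrite mulrC shZl mulrC. Qed.

Lemma shmul_cons i w (f h : shuffle) :
  (f * h) (i :: w) = (lderiv i f * h) w + (f * lderiv i h) w.
Proof. by []. Qed.

Lemma shmul_nil (f h : shuffle) : (f * h) [::] = f [::] * h [::].
Proof. by []. Qed.

Lemma shaddE (f h : shuffle) w : (f + h) w = f w + h w. Proof. by []. Qed.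
Lemma shoppE (f : shuffle) w : (- f) w = - f w. Proof. by []. Qed.
Lemma shscaleE a (f : shuffle) w : (a *: f) w = a * f w. Proof. by []. Qed.

Lemma shsumE (J : Type) (r : seq J) (p : pred J) (f : J -> shuffle) w :
  (\sum_(j <- r | p j) f j) w = \sum_(j <- r | p j) f j w.
Proof. by elim/big_rec2: _ => // j x y _ <-. Qed.

Lemma rderiv_additive i : {morph rderiv i : f h / f + h}. Proof. by []. Qed.

Lemma rderivM i (f h : shuffle) : rderiv i (f * h) = rderiv i f * h + f * rderiv i h.
Proof.
apply/funext => w; elim: w f h => [|j w IH] f h.
  by rewrite /rderiv /= shaddE !shmul_nil.
rewrite -[LHS]/(rderiv i (lderiv j f * h) w + rderiv i (f * lderiv j h) w).
by rewrite !IH !shaddE !shmul_cons addrACA.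
Qed.

(** The filtration by the length of the shortest words on which a functional is
    nonzero is multiplicative; this gives a meaning to power series in [f] when
    [f [::] = 0]. *)
Lemma shmul_vanish m n (f h : shuffle) :
  (forall w, (size w < m)%N -> f w = 0) -> (forall w, (size w < n)%N -> h w = 0) ->
  forall w, (size w < m + n)%N -> (f * h) w = 0.
Proof.
move=> hf hh w; elim: w m n f h hf hh => [|i w IH] m n f h hf hh /=.
  by case: m hf => [|m] hf hmn; rewrite shmul_nil; [rewrite hh ?mulr0|rewrite hf ?mul0r].
move=> hw; rewrite shmul_cons (IH m.-1 n) //; last 2 first.
- by move=> u hu; rewrite /lderiv hf //=; lia.
- by lia.
rewrite add0r (IH m n.-1) //; last by lia.
by move=> u hu; rewrite /lderiv hh //=; lia.
Qed.

Lemma shpow_vanish (f : shuffle) k w : f [::] = 0 -> (size w < k)%N -> (f ^+ k) w = 0.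
Proof.
move=> f0; elim: k w => // k IH w hw; rewrite exprS.
apply: (@shmul_vanish 1 k) => // u; case: u => //.
Qed.

End Shuffle.

(** * Functionals on an enveloping algebra *)

Section Enveloping.
Variables (F : fieldType) (I : finType) (c : I -> I -> I -> F).

(** Vanishing on the two-sided ideal generated by the elements
    [i j - j i - sum_k c i j k k]. *)
Definition enveloping (f : shuffle F I) := forall u w i j,
  f (u ++ i :: j :: w) - f (u ++ j :: i :: w) = \sum_k c i j k * f (u ++ k :: w).

Lemma enveloping_lderiv i f : enveloping f -> enveloping (lderiv i f).
Proof. by move=> hf u w j k; exact: (hf (i :: u)). Qed.

Lemma enveloping_subsp : subsp enveloping.
Proof.
split=> [u w i j|a f h hf hh u w i j].
  by rewrite subrr big1 // => k _; rewrite mulr0.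
rewrite !shaddE !shscaleE opprD addrACA -mulrBr hf hh mulr_sumr -big_split.
by apply: eq_bigr => k _; rewrite shaddE shscaleE mulrDr mulrCA.
Qed.

Lemma enveloping1 : enveloping 1.
Proof.
move=> u w i j.
have z l : (1 : shuffle F I) (u ++ l :: w) = 0 by case: u.
rewrite big1 => [|k _]; last by rewrite z mulr0.
by case: u {z} => [|a u]; rewrite /= subrr.
Qed.

(** Both sides of the defining relations are primitive, so the ideal that they
    generate is a coideal. *)
Lemma envelopingM f h : enveloping f -> enveloping h -> enveloping (f * h).
Proof.
move=> hf hh u; elim: u f h hf hh => [|a u IH] f h hf hh w i j; last first.
  rewrite !cat_cons !shmul_cons opprD addrACA !IH //; try exact: enveloping_lderiv.
  by rewrite -big_split; apply: eq_bigr => k _; rewrite cat_cons shmul_cons mulrDr.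
rewrite !cat0s !shmul_cons.
have E (p : shuffle F I) : enveloping p ->
    lderiv j (lderiv i p) - lderiv i (lderiv j p) = \sum_k c i j k *: lderiv k p.
  move=> hp; apply/funext => v; rewrite shsumE -[LHS]/(p ([::] ++ i :: j :: v) - p ([::] ++ j :: i :: v)).
  by rewrite hp.
transitivity (((lderiv j (lderiv i f) - lderiv i (lderiv j f)) * h +
   f * (lderiv j (lderiv i h) - lderiv i (lderiv j h))) w).
  rewrite mulrBl mulrBr !shaddE !shoppE; ring.
rewrite !E // mulr_suml mulr_sumr -big_split shsumE; apply: eq_bigr => k _.
by rewrite /= shZl shZr shaddE !shscaleE shmul_cons mulrDr.
Qed.

Variables (n : nat) (A : I -> 'M[F]_n).

Definition word_mx (w : seq I) : 'M[F]_n := foldr (fun i M => A i *m M) 1%:M w.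

Definition mcoef (p q : 'I_n) : shuffle F I := fun w => word_mx w p q.

Lemma word_mx_cat u w : word_mx (u ++ w) = word_mx u *m word_mx w.
Proof. by elim: u => [|i u IH] /=; rewrite ?mul1mx // IH mulmxA. Qed.

Lemma mcoef_nil p q : mcoef p q [::] = (p == q)%:R.
Proof. by rewrite /mcoef mxE. Qed.

Lemma mcoef_rderiv i p q : rderiv i (mcoef p q) = \sum_r A i r q *: mcoef p r.
Proof.
apply/funext => w; rewrite shsumE /rderiv /mcoef -cats1 word_mx_cat /= mulmx1 mxE.
by apply: eq_bigr => r _; rewrite shscaleE mulrC.
Qed.

Lemma mcoef_enveloping p q :
  (forall i j, A i *m A j - A j *m A i = \sum_k c i j k *: A k) ->
  enveloping (mcoef p q).
Proof.
move=> hA u w i j; rewrite /mcoef !word_mx_cat /=.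
transitivity ((word_mx u *m (A i *m A j - A j *m A i) *m word_mx w) p q).
  have E (Y Z : 'M[F]_n) : (Y - Z) p q = Y p q - Z p q by rewrite !mxE.
  by rewrite mulmxBr mulmxBl E !mulmxA.
rewrite hA mulmx_sumr mulmx_suml summxE; apply: eq_bigr => k _.
by rewrite -scalemxAr -scalemxAl mxE word_mx_cat mulmxA.
Qed.

End Enveloping.

(** * The derivative of a determinant *)

Section DetDerivation.
Variables (R : comNzRingType) (D : R -> R).
Hypothesis D_add : {morph D : x y / x + y}.
Hypothesis D_mul : forall x y, D (x * y) = D x * y + x * D y.

Let D0 : D 0 = 0.
Proof. by apply: (addIr (D 0)); rewrite -D_add !add0r. Qed.

Let D1 : D 1 = 0.
Proof. by have := D_mul 1 1; rewrite !mul1r mulr1 => h; apply: (addIr (D 1)); rewrite -h add0r. Qed.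

Let DN x : D (- x) = - D x.
Proof. by apply: (addIr (D x)); rewrite -D_add !addNr D0. Qed.

Let D_sign (b : bool) x : D ((-1) ^+ b * x) = (-1) ^+ b * D x.
Proof. by case: b; rewrite ?expr1 ?expr0 ?mulN1r ?mul1r. Qed.

Let D_sum (J : Type) (r : seq J) (p : pred J) (f : J -> R) :
  D (\sum_(j <- r | p j) f j) = \sum_(j <- r | p j) D (f j).
Proof. exact: (big_morph D D_add D0). Qed.

Let D_prod (J : eqType) (r : seq J) (f : J -> R) : uniq r ->
  D (\prod_(j <- r) f j) = \sum_(p <- r) \prod_(j <- r) (if j == p then D (f j) else f j).
Proof.
elim: r => [|a r IH] /=; first by rewrite !big_nil D1.
move=> /andP[ar ur]; rewrite !big_cons D_mul IH // eqxx; congr (_ + _).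
  congr (_ * _); apply: eq_big_seq => j jr.
  by case: eqP => // ja; rewrite -ja jr in ar.
rewrite mulr_sumr; apply: eq_big_seq => p pr; rewrite big_cons.
by case: eqP => // ap; rewrite ap pr in ar.
Qed.

(** Jacobi's formula, [D (det M) = tr (D M adj M)], where [adj M M = det M]. *)
Lemma det_derivation n (M X : 'M[R]_n) :
  (forall p q, D (M p q) = (M *m X) p q) -> D (\det M) = \tr X * \det M.
Proof.
move=> hM; pose Mp p := \matrix_(i, j) (if i == p then D (M i j) else M i j).
have -> : D (\det M) = \sum_p \det (Mp p).
  rewrite D_sum; under eq_bigr => s _ do rewrite D_sign D_prod ?index_enum_uniq // mulr_sumr.
  rewrite exchange_big; apply: eq_bigr => p _; apply: eq_bigr => s _.
  by congr (_ * _); apply: eq_bigr => i _; rewrite mxE.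
transitivity (\tr ((M *m X) *m \adj M)).
  apply: eq_bigr => p _; rewrite (expand_det_row _ p) mxE; apply: eq_bigr => q _.
  rewrite !mxE eqxx hM mxE; congr (_ * _); rewrite /cofactor; congr (_ * \det _).
  apply/matrixP => i j; rewrite !mxE; case: eqP => // e.
  by have := neq_lift p i; rewrite e eqxx.
rewrite -mulmxA mxtrace_mulC -mulmxA mul_adj_mx mul_mx_scalar linearZ /=.
by rewrite mulrC.
Qed.

End DetDerivation.

(** * Complex powers *)

Section BinomialPower.
Variables (F : numFieldType) (I : Type).
Local Notation sh := (shuffle F I).

Definition binomial_coef (a : F) (k : nat) : F := (\prod_(j < k) (a - j%:R)) / k`!%:R.

Lemma binomial_coef_rec a k :
  k.+1%:R * binomial_coef a k.+1 + k%:R * binomial_coef a k = a * binomial_coef a k.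
Proof.
rewrite /binomial_coef big_ord_recr factS natrM /=.
have k0 : k.+1%:R != 0 :> F by rewrite pnatr_eq0.
have f0 : k`!%:R != 0 :> F by rewrite pnatr_eq0 -lt0n fact_gt0.
by field; rewrite -natr1 in k0; rewrite f0 addrC k0.
Qed.

(** The binomial series for [(1 + (f - 1)) ^ a]; on a word [w] its terms of index
    greater than [size w] vanish when [f [::] = 1]. *)
Definition bpow (a : F) (f : sh) : sh :=
  fun w => \sum_(k < (size w).+1) binomial_coef a k * ((f - 1) ^+ k) w.

Variables (f : sh) (f1 : f [::] = 1).

Let fm1 : (f - 1) [::] = 0.
Proof. by rewrite shaddE f1 shoppE subrr. Qed.

Lemma bpow_wide a K w : (size w < K)%N ->
  bpow a f w = (\sum_(k < K) binomial_coef a k *: (f - 1) ^+ k) w.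
Proof.
move=> wK; rewrite shsumE /bpow.
rewrite (big_ord_widen K (fun k => binomial_coef a k * ((f - 1) ^+ k) w)) // big_mkcond /=.
apply: eq_bigr => k _; case: ltnP => // h.
by rewrite shscaleE shpow_vanish ?mulr0 //.
Qed.

Lemma bpow_nil a : bpow a f [::] = 1.
Proof. by rewrite /bpow big_ord1 /binomial_coef big_ord0 expr0 fact0 divr1 mulr1. Qed.

(** [f ^ a] has derivative [a f ^ (a - 1) D f], which is [a c f ^ a]; on
    coefficients this is [binomial_coef_rec]. *)
Lemma bpow_rderiv a i c : rderiv i f = c *: f -> rderiv i (bpow a f) = (a * c) *: bpow a f.
Proof.
move=> hf; apply/funext => w; pose K := (size w).+1.
rewrite /rderiv (@bpow_wide a K.+1) ?size_rcons //.
rewrite shscaleE (@bpow_wide a K.+1) ?ltnS //.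
set s := \sum_(k < K.+1) _; rewrite -[LHS]/(rderiv i s w).
have d1 : rderiv i (1 : sh) = 0.
  by apply/funext => u; rewrite /rderiv; case: u.
have df : rderiv i (f - 1) = c *: ((f - 1) + 1).
  by rewrite subrK -hf /rderiv; apply/funext => u; rewrite !shaddE !shoppE; case: u => *; rewrite subr0.
have dpow k : rderiv i ((f - 1) ^+ k) = (k%:R * c) *: ((f - 1) ^+ k + (f - 1) ^+ k.-1).
  elim: k => [|k IH]; first by rewrite d1 mul0r scale0r.
  rewrite exprS rderivM df IH shZl shZr mulrDl mul1r -exprS mulrDr -exprS.
  case: k {IH} => [|k]; first by rewrite mul0r scale0r addr0 mul1r.
  rewrite /= -exprS -scalerDl; congr (_ *: _).
  by rewrite -[k.+2%:R]natr1 mulrDl mul1r addrC.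
have -> : rderiv i s = \sum_(k < K.+1) binomial_coef a k *: rderiv i ((f - 1) ^+ k).
  by rewrite /s; elim/big_rec2: _ => [|k x y _ <-].
pose G k := ((f - 1) ^+ k) w.
have GK : G K = 0 by rewrite /G shpow_vanish.
have -> : (\sum_(k < K.+1) binomial_coef a k *: rderiv i ((f - 1) ^+ k)) w =
    \sum_(k < K.+1) (binomial_coef a k * (k%:R * c) * G k +
                     binomial_coef a k * (k%:R * c) * G k.-1).
  rewrite shsumE; apply: eq_bigr => k _.
  by rewrite dpow !shscaleE shaddE mulrA mulrDr.
have -> : s w = \sum_(k < K.+1) binomial_coef a k * G k by rewrite /s shsumE.
rewrite big_split /= [X in _ + X]big_ord_recl /= mul0r mulr0 mul0r add0r.
rewrite big_ord_recr [in RHS]big_ord_recr /= GK !mulr0 !addr0 -big_split mulr_sumr.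
apply: eq_bigr => k _; rewrite /= /bump /= add1n -mulrDl [RHS]mulrA; congr (_ * _).
transitivity (c * (a * binomial_coef a k)); last by ring.
by rewrite -binomial_coef_rec; ring.
Qed.

End BinomialPower.

(** * The functional of a Verma module *)

Section Verma.
Variables (F : numClosedFieldType) (g : gradedLieAlgebra F) (t : {vspace g}).
Local Notation T := (subvs_of t).
Local Notation dual := (dual_space t).
Variable B : root_basis t.
Local Notation n := (rb_size B).
Local Notation b := (rb_vec B).
Local Notation wt := (rb_wt B).
Local Notation d := (rb_deg B).
Let ht := rb_cartan B.
Let hb := rb_basis B.
Let hd := rb_homogeneous B.
Let hw := rb_weight B.
Variables (P : dual -> Prop) (hP : posys B P).
Local Notation tw := (twist F).
Local Notation sh := (shuffle F 'I_n).

(** Structure constants of the twisted, ordinary Lie algebra. *)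
Definition tconst (i j k : 'I_n) : F := tw (d i) (d j) * coord b k (ad g b`_i b`_j).

Definition tad (i : 'I_n) : 'M[F]_n := \matrix_(r, q) tconst i q r.

Lemma coord_ad_deg (i j k : 'I_n) : coord b k (ad g b`_i b`_j) != 0 -> d k = d i + d j.
Proof. by move=> h; apply: (coord_rb_deg _ h); exact: ad_graded. Qed.

Lemma coord_ad_wt (i j k : 'I_n) : coord b k (ad g b`_i b`_j) != 0 -> wt k = wt i + wt j.
Proof. by move=> h; apply: (coord_rb _ h); exact: ad_rb. Qed.

Lemma tad_weight (i r q : 'I_n) : tad i r q != 0 -> wt r = wt i + wt q.
Proof. by rewrite mxE /tconst mulf_eq0 negb_or => /andP[_ /coord_ad_wt]. Qed.

Let coord_ad2r (x : g) (j q p : 'I_n) :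
  coord b p (ad g x (ad g b`_j b`_q)) =
  \sum_(r < n) coord b p (ad g x b`_r) * coord b r (ad g b`_j b`_q).
Proof.
rewrite {1}(coord_basis hb (memvf (ad g b`_j b`_q))) !linear_sum.
by apply: eq_bigr => r _; rewrite !linearZ /= mulrC.
Qed.

Let coord_ad2l (i j q p : 'I_n) :
  coord b p (ad g (ad g b`_i b`_j) b`_q) =
  \sum_(k < n) coord b k (ad g b`_i b`_j) * coord b p (ad g b`_k b`_q).
Proof.
rewrite {1}(coord_basis hb (memvf (ad g b`_i b`_j))) ad_suml linear_sum.
by apply: eq_bigr => r _; rewrite adZl linearZ.
Qed.

Let tad_mul (i j p q : 'I_n) : (tad i *m tad j) p q =
  tw (d j) (d q) * (tw (d i) (d j) * tw (d i) (d q)) * coord b p (ad g b`_i (ad g b`_j b`_q)).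
Proof.
rewrite mxE coord_ad2r mulr_sumr; apply: eq_bigr => r _; rewrite !mxE /tconst.
have [->|/coord_ad_deg ->] := eqVneq (coord b r (ad g b`_j b`_q)) 0; first by rewrite !mulr0.
by rewrite twistDr; ring.
Qed.

(** The adjoint representation of the twisted Lie algebra. The sign in the Jacobi
    identity is [tw (d i) (d j) * tw (d j) (d i)]; multiplied by the first of these
    factors, whose square is one, the identity has an ordinary commutator of the
    twisted operators on one side. *)
Lemma tad_bracket (i j : 'I_n) : tad i *m tad j - tad j *m tad i = \sum_k tconst i j k *: tad k.
Proof.
apply/matrixP => p q.
have E (Y Z : 'M[F]_n) : (Y - Z) p q = Y p q - Z p q by rewrite !mxE.
rewrite E !tad_mul summxE.
have -> : \sum_k (tconst i j k *: tad k) p q =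
    tw (d i) (d j) * (tw (d i) (d q) * tw (d j) (d q)) * coord b p (ad g (ad g b`_i b`_j) b`_q).
  rewrite coord_ad2l mulr_sumr; apply: eq_bigr => k _; rewrite !mxE /tconst.
  have [->|/coord_ad_deg ->] := eqVneq (coord b k (ad g b`_i b`_j)) 0.
    by rewrite mul0r !mulr0 mul0r.
  by rewrite twistDl; ring.
rewrite (ad_jacobi b`_q (hd i) (hd j)) linearD linearZ /= sign_twist.
have sq := twist_sq F (d i) (d j).
set a := coord b p _; set e := coord b p _.
set x := tw (d i) (d j) in sq *; set y := tw (d j) (d i).
have -> : x * y * e = x * (y * e) by rewrite mulrA.
have -> : tw (d j) (d q) * (x * tw (d i) (d q)) * (a + x * (y * e)) =
  tw (d j) (d q) * (x * tw (d i) (d q)) * a + (x * x) * (tw (d j) (d q) * tw (d i) (d q) * (y * e)).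
  by ring.
rewrite sq; ring.
Qed.

(** [f] is a highest weight functional of weight [chi] on the enveloping algebra
    of the twisted Lie algebra. *)
Definition verma (chi : dual) (f : sh) := [/\ f [::] = 1, enveloping tconst f,
  (forall i, P (wt i) -> rderiv i f = 0) &
  forall i, wt i = 0 -> rderiv i f = (chi (vsproj t b`_i) : F) *: f].

Lemma verma0 : verma 0 1.
Proof.
have r1 i : rderiv i (1 : sh) = 0 by apply/funext => u; rewrite /rderiv; case: u.
split=> // [|i _]; first exact: enveloping1.
by rewrite r1 lfunE scale0r.
Qed.

(** Weights add because [rderiv i] is a derivation; the product is the functional
    of the tensor product of two highest weight vectors. *)
Lemma vermaD chi chi' f f' : verma chi f -> verma chi' f' -> verma (chi + chi') (f * f').
Proof.
move=> [f1 fe fp ft] [f1' fe' fp' ft']; split.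
- by rewrite shmul_nil f1 f1' mulr1.
- exact: envelopingM.
- by move=> i Pi; rewrite rderivM fp // fp' // mul0r mulr0 addr0.
- by move=> i wi; rewrite rderivM ft // ft' // shZl shZr -scalerDl lfunE.
Qed.

Lemma vermaZ a chi f : verma chi f -> verma (a *: chi) (bpow a f).
Proof.
move=> [f1 fe fp ft]; split.
- exact: bpow_nil.
- have ge K : enveloping tconst (\sum_(k < K) binomial_coef a k *: (f - 1) ^+ k : sh).
    apply: (subsp_sum _ (enveloping_subsp _)) => k _; apply: (subspZ _ (enveloping_subsp _)).
    elim: (k : nat) => [|m IH]; first exact: enveloping1.
    rewrite exprS; apply: envelopingM => //.
    by apply: (subspB (enveloping_subsp _)) => //; exact: enveloping1.
  move=> u w i j; pose K := (size u + size w).+3.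
  have wide v : (size v <= (size w).+2)%N ->
      bpow a f (u ++ v) = (\sum_(k < K) binomial_coef a k *: (f - 1) ^+ k : sh) (u ++ v).
    by move=> hv; apply: bpow_wide => //; rewrite size_cat /K -!addnS leq_add2l ltnS.
  by rewrite !wide // ge; apply: eq_bigr => k _; rewrite wide.
- move=> i Pi; have e : rderiv i f = 0 *: f by rewrite fp // scale0r.
  by rewrite (bpow_rderiv f1 a e) mulr0 scale0r.
- by move=> i wi; rewrite (bpow_rderiv f1 a (ft i wi)) scale_lfunE.
Qed.

(** * Minors of the adjoint representation *)

Section Minor.
Variable S : pred 'I_n.
Hypothesis S_up : forall i q r, P (wt i) \/ wt i = 0 -> q \in S -> wt r = wt i + wt q -> r \in S.

(** The block of the adjoint matrix coefficients on [S], completed by an identity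
    block. Since [S] is stable under raising, the derivation [rderiv i] sends this
    matrix to its product with a constant matrix when [wt i] is positive or zero,
    and so sends its determinant to a multiple of itself by a trace: zero for a
    raising vector, the sum of the weights in [S] for an element of [t]. The
    determinant is the diagonal matrix coefficient of a highest weight vector of
    an exterior power of the adjoint representation. *)
Let D : 'M[sh]_n :=
  \matrix_(p, q) (if (p \in S) && (q \in S) then mcoef tad p q else (p == q)%:R).

Let r1 i : rderiv i (1 : sh) = 0.
Proof. by apply/funext => u; rewrite /rderiv; case: u. Qed.

Let minor_rderiv i : P (wt i) \/ wt i = 0 ->
  rderiv i (\det D) = (\sum_(p in S) tad i p p) *: \det D.
Proof.
move=> hi; pose X : 'M[sh]_n :=
  \matrix_(r, q) (if (r \in S) && (q \in S) then tad i r q *: (1 : sh) else 0).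
rewrite (@det_derivation _ (rderiv i) (rderiv_additive i) (rderivM i) _ D X).
  rewrite -[in RHS](mul1r (\det D)) -shZl scaler_suml; congr (_ * _).
  rewrite [RHS]big_mkcond; apply: eq_bigr => p _; rewrite mxE andbb.
  by case: ifP.
move=> p q; rewrite !mxE; case pS: (p \in S) => /=; last first.
  rewrite big1 => [|r _]; last first.
    by rewrite !mxE pS /=; case: eqP => [<-|_]; rewrite ?mul0r // pS /= mulr0.
  by case: (p == q); rewrite // r1.
case qS: (q \in S) => /=; last first.
  rewrite big1 => [|r _]; last by rewrite !mxE qS andbF mulr0.
  by case: eqP => // e; rewrite e qS in pS.
rewrite mcoef_rderiv; apply: eq_bigr => r _; rewrite !mxE pS qS andbT /=.
case rS: (r \in S); first by rewrite shZr mulr1.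
have [z|nz] := eqVneq (tad i r q) 0; first by move: z; rewrite mxE => ->; rewrite scale0r mulr0.
by have := S_up hi qS (tad_weight nz); rewrite rS.
Qed.

Let nil_eval_det : (\det D) [::] = 1.
Proof.
have sgn (s : bool) (x : sh) : ((-1) ^+ s * x) [::] = (-1) ^+ s * x [::].
  by case: s; rewrite ?expr0 ?expr1 ?mul1r ?mulN1r.
have prd (r : seq 'I_n) (f : 'I_n -> sh) : (\prod_(k <- r) f k) [::] = \prod_(k <- r) f k [::].
  by elim: r => [|k r IH]; rewrite ?big_nil // !big_cons shmul_nil IH.
transitivity (\det (1%:M : 'M[F]_n)); last exact: det1.
rewrite /determinant shsumE; apply: eq_bigr => s _; rewrite sgn prd; congr (_ * _).
apply: eq_bigr => k _; rewrite !mxE; case: ifP => _; first exact: mcoef_nil.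
by case: (k == _).
Qed.

Lemma verma_minor : exists f, verma (\sum_(p in S) wt p) f.
Proof.
exists (\det D); split.
- exact: nil_eval_det.
- apply: (subsp_sum _ (enveloping_subsp _)) => s _.
  move: (perm.odd_perm s) => o; suff : enveloping tconst (\prod_k D k (perm.fun_of_perm.body s k)).
    case: o; rewrite ?expr0 ?expr1 ?mul1r ?mulN1r //.
    exact: (subspN (enveloping_subsp _)).
  apply: big_ind => [||k _]; [exact: enveloping1|exact: envelopingM|].
  rewrite mxE; case: ifP => _; first exact: (mcoef_enveloping _ _ tad_bracket).
  by case: (k == _); [exact: enveloping1|case: (enveloping_subsp tconst)].
- move=> i Pi; rewrite minor_rderiv; last by left.
  rewrite big1 ?scale0r // => p _; apply/eqP; apply: contraT => /tad_weight /eqP.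
  rewrite -subr_eq0 opprD addrCA subrr addr0 oppr_eq0 => /eqP w0.
  by have [] := hP; rewrite -w0.
- move=> i wi; rewrite minor_rderiv; last by right.
  congr (_ *: _); rewrite sum_lfunE; apply: eq_bigr => p _; rewrite mxE /tconst.
  have it := rb_zero B i wi.
  have di : d i = 0.
    apply/eqP; apply: contraT => /eqP di.
    have := component_disjoint (hd i) (t_even ht it) di => /eqP.
    by rewrite (negbTE (rb_neq0 i)).
  rewrite di twist0l mul1r.
  have := hw p (vsproj t b`_i); rewrite /t_act /= vsprojK // => ->.
  by rewrite linearZ /= (coord_basis_elt hb) eqxx mulr1.
Qed.

End Minor.

Let vermaP (chi : dual) := exists f, verma chi f.

Let vermaP_subsp : subsp vermaP.
Proof.
split=> [|a x y [f hf] [h hh]]; first by exists 1; exact: verma0.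
by exists (bpow a f * h); apply: vermaD => //; exact: vermaZ.
Qed.

(** The minors for the weights [>= wt j] and for the weights [> wt j] have weights
    that differ by a positive multiple of [wt j]. *)
Let vermaP_wt (j : 'I_n) : vermaP (wt j).
Proof.
have [P0 PD _] := hP.
pose S1 : pred 'I_n := fun p => `[< wt p = wt j \/ P (wt p - wt j) >].
pose S2 : pred 'I_n := fun p => `[< P (wt p - wt j) >].
have h1 : vermaP (\sum_(p in S1) wt p).
  apply: verma_minor => i q r hi /asboolP hq hr; apply/asboolP; rewrite hr -addrA.
  case: hi => [Pi|->]; last by rewrite !add0r.
  by right; case: hq => [->|Pq]; [rewrite subrr addr0|exact: PD].
have h2 : vermaP (\sum_(p in S2) wt p).
  apply: verma_minor => i q r hi /asboolP hq hr; apply/asboolP; rewrite hr -addrA.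
  by case: hi => [Pi|->]; [exact: PD|rewrite add0r].
pose S3 : pred 'I_n := fun p => wt p == wt j.
have e : \sum_(p in S1) wt p - \sum_(p in S2) wt p = #|S3|%:R *: wt j.
  have e1 : \sum_(p in S1 | S3 p) wt p = \sum_(p in S3) wt j.
    apply: eq_big => [p|p /andP[_ /eqP //]]; rewrite andbC -[p \in S3]/(S3 p).
    by case h: (S3 p) => //=; apply/asboolP; left; apply/eqP.
  have e2 : \sum_(p in S1 | ~~ S3 p) wt p = \sum_(p in S2) wt p.
    apply: eq_bigl => p; apply/andP/asboolP => [[/asboolP [e|//] /negP []]|Pp].
      exact/eqP.
    split; first by apply/asboolP; right.
    by apply/negP => /eqP e; apply: P0; move: Pp; rewrite e subrr.
  by rewrite scaler_nat -sumr_const (bigID S3) /= e1 e2 addrK.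
have c0 : #|S3|%:R != 0 :> F.
  by rewrite pnatr_eq0 -lt0n; apply/card_gt0P; exists j; apply/eqP.
have := subspZ #|S3|%:R^-1 vermaP_subsp (subspB vermaP_subsp h1 h2).
by rewrite e scalerA mulVf // scale1r.
Qed.

(** The weights span the dual: the trace form gives coordinates. *)
Lemma verma_exists (chi : dual) : exists f, verma chi f.
Proof.
have -> : chi = \sum_(p < n) (wt p (coroot_vector chi) : F) *: wt p.
  apply/lfunP => h; rewrite (coroot_vectorP B) (killing_basis hb) sum_lfunE.
  apply: eq_bigr => p _; rewrite scale_lfunE.
  have E (k : T) : ad g (vsval k) b`_p = (wt p k : F) *: b`_p by exact: hw.
  by rewrite E adZr E scalerA linearZ /= (coord_basis_elt hb) eqxx mulr1 mulrC.
by apply: (subsp_sum _ vermaP_subsp) => p _; apply: (subspZ _ vermaP_subsp); exact: vermaP_wt.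
Qed.

End Verma.

(** * The irreducible highest weight module *)

Section SubModule.
Variables (F : fieldType) (M : lmodType F) (Q : M -> Prop).

Definition subsp_pred (hQ : subsp Q) : {pred M} := fun x => `[< Q x >].

Variable hQ : subsp Q.

Lemma subsp_pred_closed : submod_closed (subsp_pred hQ).
Proof.
split; first by apply/asboolP; case: hQ.
by move=> a u v /asboolP hu /asboolP hv; apply/asboolP; case: hQ => _; apply.
Qed.

HB.instance Definition _ := GRing.isSubmodClosed.Build F M (subsp_pred hQ) subsp_pred_closed.

Record submodule := SubModule { sub_val : M; sub_valP : sub_val \in subsp_pred hQ }.

HB.instance Definition _ := [isSub for sub_val].
HB.instance Definition _ := [Choice of submodule by <:].
HB.instance Definition _ := [SubChoice_isSubLmodule of submodule by <:].

Definition sub_elt u (Qu : Q u) : submodule := SubModule (introT (asboolP (Q u)) Qu).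

Lemma sub_prop (u : submodule) : Q (sub_val u).
Proof. exact/asboolP/sub_valP. Qed.

Lemma sub_val_inj (u v : submodule) : sub_val u = sub_val v -> u = v.
Proof. exact: val_inj. Qed.

Lemma sub_val_linear a (u v : submodule) :
  sub_val (a *: u + v) = a *: sub_val u + sub_val v.
Proof. exact: (linearP (val : submodule -> M)). Qed.

End SubModule.

Section Coloured.
Variables (F : numClosedFieldType) (g : gradedLieAlgebra F) (t : {vspace g}).
Local Notation dual := (dual_space t).
Variable B : root_basis t.
Local Notation n := (rb_size B).
Local Notation b := (rb_vec B).
Local Notation wt := (rb_wt B).
Local Notation d := (rb_deg B).
Let ht := rb_cartan B.
Let hb := rb_basis B.
Let hd := rb_homogeneous B.
Variables (P : dual -> Prop) (hP : posys B P).
Local Notation tw := (twist F).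
Local Notation sh := (shuffle F 'I_n).

(** The defining relations are those of the enveloping algebra of [g] itself, with
    its signs, in contrast with [enveloping]. *)
Definition coloured (f : sh) := forall u w (i j : 'I_n),
  f (u ++ i :: j :: w) - sign F (d i) (d j) * f (u ++ j :: i :: w) =
  \sum_(k < n) coord b k (ad g b`_i b`_j) * f (u ++ k :: w).

Lemma coloured_subsp : subsp coloured.
Proof.
split=> [u w i j|a f h hf hh u w i j].
  by rewrite mulr0 subrr big1 // => k _; rewrite mulr0.
rewrite !shaddE !shscaleE mulrDr opprD addrACA mulrCA -mulrBr hf hh mulr_sumr -big_split.
by apply: eq_bigr => k _; rewrite shaddE shscaleE mulrDr mulrCA.
Qed.

Let word_deg (w : seq 'I_n) : degree := \sum_(i <- w) d i.

(** The factor by which a word in the graded enveloping algebra differs from the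
    same word in that of the twisted Lie algebra. *)
Fixpoint word_twist (w : seq 'I_n) : F :=
  if w is i :: w' then tw (d i) (word_deg w') * word_twist w' else 1.

Let word_deg_cons i w : word_deg (i :: w) = d i + word_deg w.
Proof. by rewrite /word_deg big_cons. Qed.

Let word_deg_cat u w : word_deg (u ++ w) = word_deg u + word_deg w.
Proof. by rewrite /word_deg big_cat. Qed.

Let word_twist_cat u w : word_twist (u ++ w) =
  word_twist u * word_twist w * tw (word_deg u) (word_deg w).
Proof.
elim: u => [|i u IH] /=; first by rewrite /word_deg big_nil twist0l mul1r mulr1.
rewrite IH word_deg_cons twistDl word_deg_cat twistDr; ring.
Qed.

Let zero_weight_degree (i : 'I_n) : wt i = 0 -> d i = 0.
Proof.
move=> wi; apply/eqP; apply: contraT => /eqP di.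
have := component_disjoint (hd i) (t_even ht (rb_zero B i wi)) di => /eqP.
by rewrite (negbTE (rb_neq0 i)).
Qed.

(** Undo the twist, and keep the values on words of weight zero only: the relations
    are homogeneous for the weight, and in the module generated by [f] the value at
    the empty word then ignores every weight other than [chi]. *)
Lemma coloured_functional (chi : dual) : exists f : sh, [/\ f [::] = 1, coloured f,
  (forall w i, P (wt i) -> f (rcons w i) = 0),
  (forall w i, wt i = 0 -> f (rcons w i) = (chi (vsproj t b`_i) : F) * f w) &
  forall w, word_wt w != 0 -> f w = 0].
Proof.
have [f [f1 fe fp ft]] := verma_exists hP chi.
exists (fun w => if word_wt w == 0 then word_twist w * f w else 0); split.
- by rewrite /word_wt big_nil eqxx /= mul1r.
- move=> u w i j.
  have wE v : word_wt (u ++ v) = word_wt u + word_wt v by rewrite /word_wt big_cat.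
  have wtc k v : word_wt (k :: v) = wt k + word_wt v by rewrite /word_wt big_cons.
  pose W := word_wt u + (wt i + wt j + word_wt w).
  have W1 : word_wt (u ++ i :: j :: w) = W by rewrite wE !wtc /W -addrA.
  have W2 : word_wt (u ++ j :: i :: w) = W.
    by rewrite wE !wtc /W -addrA [wt j + (_ + _)]addrCA.
  pose C := word_twist u * (tw (d i) (word_deg w) * tw (d j) (word_deg w) * word_twist w) *
    tw (word_deg u) (d i + d j + word_deg w).
  have T1 : word_twist (u ++ i :: j :: w) = tw (d i) (d j) * C.
    by rewrite word_twist_cat /= !word_deg_cons addrA [tw (d i) _]twistDr /C; ring.
  have T2 : word_twist (u ++ j :: i :: w) = tw (d j) (d i) * C.
    by rewrite word_twist_cat /= !word_deg_cons addrA [d j + d i]addrC [tw (d j) _]twistDr /C; ring.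
  have Tk (k : 'I_n) : coord b k (ad g b`_i b`_j) != 0 ->
      word_twist (u ++ k :: w) = C /\ word_wt (u ++ k :: w) = W.
    move=> nz; rewrite word_twist_cat /= word_deg_cons (coord_ad_deg nz) twistDl wE wtc.
    by rewrite (coord_ad_wt nz); split=> //; rewrite /C; ring.
  rewrite W1 W2 T1 T2; have [W0|W0] := eqVneq W 0; last first.
    rewrite mulr0 subrr big1 // => k _.
    have [->|/Tk [_ ->]] := eqVneq (coord b k (ad g b`_i b`_j)) 0; first by rewrite mul0r.
    by rewrite (negbTE W0) mulr0.
  have := fe u w i j => /(congr1 ( *%R (tw (d i) (d j) * C))).
  have -> : sign F (d i) (d j) * (tw (d j) (d i) * C * f (u ++ [:: j, i & w])) =
     tw (d i) (d j) * C * f (u ++ [:: j, i & w]).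
    rewrite sign_twist; have := twist_sq F (d j) (d i).
    by move: (tw (d j) (d i)) => y yy; rewrite -[RHS]mulr1 -yy; ring.
  rewrite mulrBr => ->; rewrite mulr_sumr; apply: eq_bigr => k _; rewrite /tconst.
  have [->|/Tk [-> ->]] := eqVneq (coord b k (ad g b`_i b`_j)) 0.
    by rewrite mulr0 !mul0r mulr0.
  rewrite W0 eqxx; have := twist_sq F (d i) (d j).
  by move: (tw (d i) (d j)) => y yy; rewrite -[RHS]mul1r -yy; ring.
- move=> w i Pi; case: ifP => // _.
  by rewrite -[f (rcons w i)]/(rderiv i f w) fp // mulr0.
- move=> w i wi; rewrite -cats1.
  have -> : word_wt (w ++ [:: i]) = word_wt w.
    by rewrite /word_wt big_cat big_seq1 /= wi addr0.
  case: ifP => _; last by rewrite mulr0.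
  rewrite cats1 -[f (rcons w i)]/(rderiv i f w) ft // shscaleE mulrCA; congr (_ * (_ * _)).
  rewrite -cats1 word_twist_cat word_deg_cons /= zero_weight_degree //.
  by rewrite twist0l /word_deg big_nil addr0 twist0r !mulr1.
- by move=> w /negbTE ->.
Qed.

Local Notation CM := (submodule coloured_subsp).

(** Right translation, [(x f)(w) = f(w x)]. *)
Definition right_act (x : g) (f : sh) : sh := \sum_(i < n) coord b i x *: rderiv i f.

Lemma right_actE x f w : right_act x f w = \sum_(i < n) coord b i x * f (rcons w i).
Proof. by rewrite /right_act shsumE; apply: eq_bigr => i _. Qed.

Lemma right_act_linear x a f h : right_act x (a *: f + h) = a *: right_act x f + right_act x h.
Proof.
apply/funext => w; rewrite !(shaddE, shscaleE, right_actE) mulr_sumr -big_split.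
by apply: eq_bigr => i _; rewrite shaddE shscaleE mulrDr mulrCA.
Qed.

Lemma right_act_coloured x f : coloured f -> coloured (right_act x f).
Proof.
move=> hf; apply: (subsp_sum _ coloured_subsp) => k _; apply: (subspZ _ coloured_subsp).
move=> u w i j; rewrite /rderiv !rcons_cat !rcons_cons hf.
by apply: eq_bigr => l _; rewrite rcons_cat.
Qed.

Definition coloured_act (x : g) (f : CM) : CM :=
  sub_elt coloured_subsp (right_act_coloured x (sub_prop f)).

Lemma coloured_actE x f : sub_val (coloured_act x f) = right_act x (sub_val f).
Proof. by []. Qed.

Lemma coloured_act_linear x : linear (coloured_act x).
Proof.
by move=> a f h; apply: sub_val_inj; rewrite sub_val_linear !coloured_actE sub_val_linear right_act_linear.
Qed.

HB.instance Definition _ x :=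
  GRing.isLinear.Build F CM CM _ (coloured_act x) (coloured_act_linear x).

Lemma coloured_act_suml a x y f :
  coloured_act (a *: x + y) f = a *: coloured_act x f + coloured_act y f.
Proof.
apply: sub_val_inj; apply/funext => w.
rewrite sub_val_linear !coloured_actE shaddE shscaleE !right_actE mulr_sumr -big_split.
by apply: eq_bigr => i _; rewrite linearP /= mulrDl mulrA.
Qed.

Lemma coloured_act_bracket a c x y f : x \in component g a -> y \in component g c ->
  coloured_act (ad g x y) f = coloured_act x (coloured_act y f) -
    sign F a c *: coloured_act y (coloured_act x f).
Proof.
move=> xa yc; apply: sub_val_inj; apply/funext => w; have hf := sub_prop f.
rewrite addrC -scaleNr sub_val_linear !coloured_actE addrC shaddE shscaleE mulNr.
set h := sub_val f in hf *.
have D z z' : right_act z (right_act z' h) w =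
    \sum_(i < n) \sum_(j < n) coord b i z * coord b j z' * h (w ++ [:: i; j]).
  rewrite right_actE; apply: eq_bigr => i _; rewrite right_actE mulr_sumr.
  by apply: eq_bigr => j _; rewrite mulrA -!cats1 -catA.
rewrite !D [X in _ - _ * X]exchange_big mulr_sumr -sumrB right_actE /=.
transitivity (\sum_(i < n) \sum_(j < n) coord b i x * coord b j y *
    \sum_(k < n) coord b k (ad g b`_i b`_j) * h (rcons w k)); last first.
  apply: eq_bigr => i _; rewrite mulr_sumr -sumrB; apply: eq_bigr => j _.
  have [->|ix] := eqVneq (coord b i x) 0; first by rewrite !(mul0r, mulr0) subrr.
  have [->|jy] := eqVneq (coord b j y) 0; first by rewrite !(mul0r, mulr0) subrr.
  have := hf w [::] i j; rewrite (coord_rb_deg xa ix) (coord_rb_deg yc jy).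
  move=> e; rewrite (eq_bigr (fun k => coord b k (ad g b`_i b`_j) * h (w ++ [:: k]))).
    by rewrite -e; ring.
  by move=> k _; rewrite cats1.
have E (k : 'I_n) : coord b k (ad g x y) * h (rcons w k) = \sum_(i < n) \sum_(j < n)
    coord b i x * coord b j y * (coord b k (ad g b`_i b`_j) * h (rcons w k)).
  rewrite {1}(coord_basis hb (memvf x)) ad_suml linear_sum mulr_suml.
  apply: eq_bigr => i _; rewrite adZl {1}(coord_basis hb (memvf y)).
  rewrite linear_sum scaler_sumr linear_sum mulr_suml.
  by apply: eq_bigr => j _; rewrite !linearZ /= !mulrA.
rewrite (eq_bigr _ (fun k _ => E k)) exchange_big; apply: eq_bigr => i _.
rewrite exchange_big; apply: eq_bigr => j _.
by rewrite mulr_sumr.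
Qed.

Definition coloured_action : action g CM :=
  Action (act := fun x => coloured_act x : {linear CM -> CM})
    coloured_act_suml coloured_act_bracket.

Lemma coloured_wordE (w u : seq 'I_n) (f : CM) :
  sub_val (word_act coloured_action w f) u = sub_val f (u ++ w).
Proof.
elim: w u => [|i w IH] u; first by rewrite cats0.
rewrite -[LHS]/(right_act b`_i (sub_val (word_act coloured_action w f)) u) right_actE.
rewrite (bigD1 i) //= big1 ?addr0 => [|j ji].
  by rewrite (coord_basis_elt hb) eqxx mul1r IH -cats1 -catA.
by rewrite (coord_basis_elt hb) eq_sym (negbTE ji) mul0r.
Qed.

(** The coefficient of the highest weight vector is evaluation at the empty
    word, so a nonzero descendant can be raised back to it. *)
Lemma highest_weight_module (chi : dual) : exists (v : CM),
  [/\ v != 0, singular B P coloured_action chi v &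
   forall u (Q : CM -> Prop), descendant B P coloured_action v u -> u != 0 ->
     subsp Q -> (forall x y, Q y -> Q (coloured_action x y)) -> Q u -> Q v].
Proof.
have [f [f1 fc fp ft fz]] := coloured_functional chi.
pose v := sub_elt coloured_subsp fc.
have vE : sub_val v = f by [].
have basisE (i : 'I_n) (h : CM) w : sub_val (coloured_action b`_i h) w = sub_val h (rcons w i).
  by have := coloured_wordE [:: i] w h; rewrite cats1.
have hv : weight coloured_action chi v.
  move=> h; apply: sub_val_inj; apply/funext => w.
  rewrite -[LHS]/(right_act (vsval h) f w) -[RHS]/((chi h : F) * f w) right_actE.
  have c0 (i : 'I_n) : coord b i (vsval h) != 0 -> wt i = 0.
    move=> nz; apply: (coord_rb _ nz) => k.
    by rewrite lfunE scale0r; exact: (t_abelian (rb_centralizing B) (subvsP k) (subvsP h)).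
  have -> : chi h = \sum_(i < n) coord b i (vsval h) * (chi (vsproj t b`_i) : F) :> F.
    rewrite -[h in LHS](vsvalK h) {1}(coord_basis hb (memvf (vsval h))) !linear_sum.
    by apply: eq_bigr => i _; rewrite !linearZ.
  rewrite mulr_suml; apply: eq_bigr => i _.
  have [->|/c0 wi] := eqVneq (coord b i (vsval h)) 0; first by rewrite !mul0r.
  by rewrite ft // mulrA.
have sv : singular B P coloured_action chi v.
  by split=> // i Pi; apply: sub_val_inj; apply/funext => w; rewrite basisE vE fp.
exists v; split=> //.
  apply/eqP => /(congr1 (fun h : CM => sub_val h [::])) /eqP.
  by rewrite vE f1 oner_eq0.
move=> u Q du u0 hQ hX Qu.
have [a ha] : exists a, sub_val u a != 0.
  apply: contrapT => no; case/eqP: u0; apply: sub_val_inj; apply/funext => a.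
  by apply/eqP; apply: contrapT => /negP h; apply: no; exists a.
pose u1 := word_act coloured_action a u.
have [d1 Q1] : descendant B P coloured_action v u1 /\ Q u1.
  rewrite /u1; elim: (a) => [|i a' [IHd IHQ]] //=.
  by split; [exact: (descendant_stable hP sv)|exact: hX].
have e1 : sub_val u1 [::] != 0 by rewrite coloured_wordE.
set low := sum_of (fun y : CM => exists2 nu : dual, weight coloured_action nu y & nu != chi).
have sl : subsp low.
  apply: sum_of_subsp => c y [nu hy Pnu]; exists nu => //.
  exact: (subspZ _ (weight_subsp _ _)).
have split1 : low (u1 - sub_val u1 [::] *: v).
  apply: (sum_of_ind (Q := fun y : CM => low (y - sub_val y [::] *: v))) d1.
    split=> [|c x y hx hy]; first by rewrite scale0r subr0; case: sl.
    have -> : sub_val (c *: x + y) [::] = c * sub_val x [::] + sub_val y [::] by [].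
    rewrite scalerDl -scalerA opprD addrACA -scalerBr.
    by case: sl => _; apply.
  move=> y [c [w [nw ->]]].
  have -> : sub_val (c *: word_act coloured_action w v) [::] = c * f w.
    by rewrite -[LHS]/(c * sub_val (word_act coloured_action w v) [::]) coloured_wordE.
  have [->|Pw] := negative_weight hP nw.
    by rewrite f1 mulr1 subrr; case: sl.
  have w0 : word_wt w != 0 by rewrite -oppr_eq0; apply: (posys_neq0 hP).
  rewrite fz // mulr0 scale0r subr0; apply: subspZ => //; apply: sum_of1.
  exists (chi + word_wt w); first exact: word_weight.
  by rewrite -subr_eq0 addrAC subrr add0r.
have hv1 : weight coloured_action chi (sub_val u1 [::] *: v).
  exact: (subspZ _ (weight_subsp _ _)).
have := @weight_extract_sum _ _ _ _ coloured_action Q chi _ _ hQ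
  (fun h y => hX (vsval h) y) hv1 split1.
rewrite addrC subrK => /(_ Q1) /(subspZ (sub_val u1 [::])^-1 hQ).
by rewrite scalerA mulVf // scale1r.
Qed.

End Coloured.

(** * Dominance and finite dimension *)

Lemma finset_minimal (I : finType) (R : I -> I -> Prop) (A : {set I}) x :
  (forall i, ~ R i i) -> (forall i j k, R i j -> R j k -> R i k) -> x \in A ->
  exists2 i, i \in A & forall j, j \in A -> ~ R j i.
Proof.
move=> irr tr xA; pose below i := [set j in A | `[< R j i >]].
case: (arg_minnP (fun i => #|below i|) xA) => i iA imin; exists i => // j jA ji.
have := imin j jA; rewrite leqNgt => /negP; apply; apply: proper_card.
apply/properP; split.
  apply/fintype.subsetP => k; rewrite !inE => /andP[-> /asboolP kj].
  by apply/asboolP; exact: tr ji.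
exists j; rewrite !inE jA /=; first exact/asboolP.
by apply/negP => /asboolP /irr.
Qed.

Section Reflections.
Variables (F : numClosedFieldType) (g : gradedLieAlgebra F) (t : {vspace g}).
Local Notation dual := (dual_space t).
Variable B : root_basis t.
Local Notation n := (rb_size B).
Local Notation wt := (rb_wt B).

Lemma posys_asym P (x : dual) : posys B P -> P x -> P (- x) -> False.
Proof. by case=> P0 PD _ px pnx; apply: P0; rewrite -(subrr x); exact: PD. Qed.

Lemma posys_reflect P (i : 'I_n) : posys B P -> wt i != 0 ->
  posys B (fun x => P (reflect (wt i) x)).
Proof.
move=> [P0 PD PT] wi; split=> [|x y|q wq].
- by rewrite reflect0.
- by rewrite reflectD; exact: PD.
- have [q' wq'] := reflect_root q wi.
  rewrite reflectN -wq'; apply: PT; rewrite wq'; apply: contra_neq wq => e.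
  by rewrite -(reflectK (wt q) wi) e reflect0.
Qed.

Definition simple_root (P : dual -> Prop) (i : 'I_n) :=
  P (wt i) /\ forall j k : 'I_n, P (wt j) -> P (wt k) -> wt i <> wt j + wt k.

Section Simple.
Variables (P : dual -> Prop) (hP : posys B P) (i : 'I_n) (si : simple_root P i).

Let wi : wt i != 0. Proof. by apply: (posys_neq0 hP); case: si. Qed.

Lemma simple_lower (j k : 'I_n) : P (wt j) -> wt j != wt i -> wt k = wt j - wt i ->
  P (wt k) /\ wt k != wt i.
Proof.
move=> Pj ji wk; have k0 : wt k != 0 by rewrite wk subr_eq0.
split; last first.
  apply/eqP => e; apply: (@multiple_not_root _ _ _ B i j 2 wi) => //.
  by rewrite mulr2n -{2}e wk addrC subrK.
have [_ _ /(_ k k0) [//|Pk]] := hP.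
have [m [wm _ _]] := partner k; case: si => _ /(_ j m Pj) [] //; first by rewrite wm.
by rewrite wm wk opprB addrC subrK.
Qed.

(** The roots met while subtracting [wt i] step by step stay positive by
    [simple_lower]. *)
Lemma simple_reflect (j : 'I_n) : P (wt j) -> wt j != wt i -> P (reflect (wt i) (wt j)).
Proof.
move=> Pj ji; have [P0 PD _] := hP; have [Pi _] := si.
have [m hm] := root_integral j wi; rewrite /reflect hm.
case: m hm => k hk.
  rewrite -pmulrn scaler_nat.
  suff H l : (l <= k)%N -> exists q : 'I_n, [/\ wt q = wt j - wt i *+ l, P (wt q) & wt q != wt i].
    by have [q [<-]] := H k (leqnn k).
  elim: l => [|l IH] lk; first by exists j; rewrite mulr0n subr0.
  have [q [wq Pq qi]] := IH (ltnW lk); have [q' wq'] := root_string wi hk lk.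
  have wqq : wt q' = wt q - wt i by rewrite wq' wq mulrSr opprD addrA.
  by have [Pq' q'i] := simple_lower Pq qi wqq; exists q'.
rewrite NegzE mulrNz -pmulrn scaleNr opprK scaler_nat.
elim: (k) => [|l IH]; first exact: PD.
by rewrite mulrSr addrA; exact: PD.
Qed.

Lemma reflect_positive (q : 'I_n) : P (reflect (wt i) (wt q)) ->
  wt q = - wt i \/ (P (wt q) /\ wt q != wt i).
Proof.
move=> Pr; have [Pi _] := si; have [P0 PD PT] := hP.
have [->|qi] := eqVneq (wt q) (- wt i); [by left|right].
have q0 : wt q != 0 by apply/eqP => e; rewrite e reflect0 in Pr.
have nqi : wt q != wt i.
  by apply/eqP => e; rewrite e reflect_self // in Pr; exact: (posys_asym hP Pi).
split=> //; have [//|Pq] := PT q q0.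
have [m [wm _ _]] := partner q.
have mi : wt m != wt i by rewrite wm eqr_oppLR.
rewrite -wm in Pq; have := simple_reflect Pq mi.
by rewrite wm reflectN => /(posys_asym hP Pr).
Qed.

End Simple.
End Reflections.

Section Span.
Variables (F : fieldType) (M : lmodType F).

Definition lspan (s : seq M) : M -> Prop :=
  sum_of (fun y => exists c u, u \in s /\ y = c *: u).

Lemma lspan_subsp s : subsp (lspan s).
Proof. by apply: sum_of_subsp => a y [c [u [us ->]]]; exists (a * c), u; rewrite scalerA. Qed.

Lemma lspan_mem s u : u \in s -> lspan s u.
Proof. by move=> us; apply: sum_of1; exists 1, u; rewrite scale1r. Qed.

Lemma lspan_sub (Q : M -> Prop) s u : subsp Q -> (forall y, y \in s -> Q y) -> lspan s u -> Q u.
Proof. by move=> hQ h; apply: sum_of_ind => // y [c [z [zs ->]]]; apply: subspZ => //; exact: h. Qed.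

End Span.

Section FiniteDimension.
Variables (F : numClosedFieldType) (g : gradedLieAlgebra F) (t : {vspace g}).
Local Notation dual := (dual_space t).
Variable B : root_basis t.
Local Notation n := (rb_size B).
Local Notation b := (rb_vec B).
Local Notation wt := (rb_wt B).
Let ht := rb_cartan B.
Let hd := rb_homogeneous B.
Let hw := rb_weight B.
Variables (P0 : dual -> Prop) (hP0 : posys B P0).
Variables (M : lmodType F) (X : action g M) (chi : dual) (v : M).
Hypotheses (v0 : v != 0) (sv : singular B P0 X chi v).
Local Notation L := (descendant B P0 X v).
Hypothesis irr : forall u (Q : M -> Prop), L u -> u != 0 -> subsp Q ->
  (forall x y, Q y -> Q (X x y)) -> Q u -> Q v.

Definition dominant_for (P : dual -> Prop) (mu : dual) :=
  forall i : 'I_n, P (wt i) -> exists k : nat, mu (hroot (wt i)) = k%:R.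

Hypothesis dom : dominant_for P0 chi.

Let Lsub : subsp L. Proof. exact: descendant_subsp. Qed.
Let Lact x u : L u -> L (X x u). Proof. exact: descendant_stable sv x u. Qed.
Let Lv : L v. Proof. exact: (@descendant_word _ _ _ B P0 _ X v [::]). Qed.

Lemma irreducible_span u (Q : M -> Prop) : L u -> u != 0 -> subsp Q ->
  (forall x y, Q y -> Q (X x y)) -> Q u -> forall z, L z -> Q z.
Proof.
move=> Lu u0 hQ hX Qu; have Qv := irr Lu u0 hQ hX Qu.
move=> z; apply: sum_of_ind => // y [c [w [_ ->]]]; apply: subspZ => //.
by elim: w => //= i w IH; exact: hX.
Qed.

(** A singular vector of lower weight would generate a submodule avoiding the
    singular vector above it. *)
Lemma singular_lower P mu w nu z : posys B P -> L w -> w != 0 -> singular B P X mu w ->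
  L z -> singular B P X nu z -> P (mu - nu) -> z = 0.
Proof.
move=> hP Lw w0 sw Lz sz Pmn; apply/eqP; apply: contraT => z0.
have dw : descendant B P X z w.
  apply: (irreducible_span Lz z0 _ _ _ Lw); first exact: descendant_subsp.
    by move=> x y; exact: (descendant_stable hP sz).
  exact: (@descendant_word _ _ _ B P _ X z [::]).
have [a na e] := descendant_weight (proj1 sz) dw (proj1 sw) w0.
have {}e : mu - nu = word_wt a by rewrite e addrC addKr.
have [a0|Pa] := negative_weight hP na.
  by have [[]] := hP; rewrite -(_ : mu - nu = 0) // e a0 /word_wt big_nil.
by exfalso; apply: (posys_asym hP Pmn); rewrite e.
Qed.

Let iter_L x u k : L u -> L (iter k (X x) u).
Proof. by move=> Lu; elim: k => //= k; exact: Lact. Qed.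

(** Lower [w] to the bottom [f^k w] of its string for a simple root. Root vectors
    of the other positive roots still kill it, since [simple_lower] keeps the
    commutators with [f] among them; and [f^(k+1) w] is zero, being singular of
    weight lower than [mu]. *)
Let reflection_step P mu w (i : 'I_n) : posys B P -> simple_root P i ->
  L w -> w != 0 -> singular B P X mu w -> dominant_for P mu ->
  exists w', [/\ L w', w' != 0,
    singular B (fun x => P (reflect (wt i) x)) X (reflect (wt i) mu) w' &
    dominant_for (fun x => P (reflect (wt i) x)) (reflect (wt i) mu)].
Proof.
move=> hP si Lw w0 [hw' kw] hdom; have [Pi _] := si.
have wi : wt i != 0 by exact: (posys_neq0 hP).
have [m [c [c0 wm nz tri]]] := root_triple wi.
have [k hk] := hdom i Pi.
set f := c *: b`_m in tri; have [_ _ hf _ _] := tri.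
have low l (j : 'I_n) : P (wt j) -> wt j != wt i -> X b`_j (iter l (X f) w) = 0.
  elim: l j => [|l IH] j Pj ji; first exact: kw.
  have fm : f \in component g (rb_deg B m) by rewrite memvZ.
  have := act_bracket X (iter l (X f) w) (hd j) fm.
  rewrite IH // linear0 scaler0 subr0 iterS => <-.
  rewrite /f adZr actZl; apply/eqP; rewrite scaler_eq0; apply/orP; right; apply/eqP.
  apply: (act_basis_ind (B := B) (Q := fun u => u = 0)); first exact: subsp0.
  move=> q cq; have wq := coord_rb (ad_rb _ _) cq; rewrite wm in wq.
  by have [Pq qi] := simple_lower hP si Pj ji wq; exact: IH.
have ew : X b`_i w = 0 by exact: kw.
have fz : iter k.+1 (X f) w = 0.
  have hz := iter_act_weight ht k.+1 hf hw'.
  apply: (singular_lower hP Lw w0 (conj hw' kw) (iter_L f k.+1 Lw)).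
    split; first exact: hz.
    move=> j Pj; have [ji|ji] := eqVneq (wt j) (wt i); last exact: low.
    have -> : j = i by apply: rb_wt_inj; rewrite ?ji.
    by rewrite (sl2_string ht tri hw' ew) hk subrr mulr0 scale0r.
  rewrite opprD addrA subrr add0r mulNrn opprK; have [_ PD _] := hP.
  by elim: (k) => [|l IH]; rewrite ?mulr1n // mulrSr; exact: PD.
have [|r hr [_ nzr]] := sl2_dominant ht tri hw' ew w0; first by exists k.+1.
have kr : k = r by apply/eqP; rewrite -(eqr_nat F) -hk -hr.
exists (iter k (X f) w); split.
- exact: iter_L.
- by apply: nzr; rewrite kr.
- split.
    have := iter_act_weight ht k hf hw'.
    by rewrite /reflect hk scaler_nat mulNrn.
  move=> q /(reflect_positive hP si) [qi|[Pq qi]]; last exact: low.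
  have -> : q = m by apply: rb_wt_inj; rewrite ?wm // qi oppr_eq0.
  move: fz; rewrite iterS /f actZl => /eqP.
  by rewrite scaler_eq0 (negbTE c0) /= => /eqP.
- move=> q Pq; rewrite (reflect_coroot mu _ wi).
  have [q' wq'] := reflect_root q wi.
  by rewrite -wq' in Pq *; exact: hdom.
Qed.

(** Walk from [P0] to [- P0] by reflections in roots that are simple for the
    current positive system [P] and positive for [P0]; each step loses one of the
    roots in [A P], those that are positive for both. *)
Lemma lowest_vector : exists w, [/\ L w, w != 0 &
  forall q : 'I_n, P0 (- wt q) -> X b`_q w = 0].
Proof.
pose A P := [set q : 'I_n | `[< P (wt q) /\ P0 (wt q) >]].
suff H m P mu w : posys B P -> L w -> w != 0 -> singular B P X mu w ->
    dominant_for P mu -> (#|A P| <= m)%N ->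
    exists w, [/\ L w, w != 0 & forall q : 'I_n, P0 (- wt q) -> X b`_q w = 0].
  exact: (H _ P0 chi v hP0 Lv v0 sv dom (leqnn _)).
elim: m P mu w => [|m IH] P mu w hP Lw w0 sw hdom cA.
all: have [A0|[x xA]] := set_0Vmem (A P).
1, 3: exists w; split=> // q Pq; have [_ kw] := sw; apply: kw.
1, 2: have q0 : wt q != 0 by rewrite -oppr_eq0; exact: (posys_neq0 hP0).
1, 2: have [_ _ /(_ q q0) [//|Pnq]] := hP; have [q' [wq' _ _]] := partner q.
1, 2: have : q' \in A P by rewrite inE; apply/asboolP; rewrite wq'.
1, 2: by rewrite A0 inE.
  by move: cA; rewrite leqn0 => /eqP /cards0_eq A0; rewrite A0 inE in xA.
have [P00 PD PT] := hP; have [P000 PD0 PT0] := hP0.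
have [i iA imin] := @finset_minimal _ (fun j k => P (wt k - wt j)) (A P) x
  (fun j h => P00 (eq_ind _ P h _ (subrr (wt j))))
  (fun j k l h h' => eq_ind _ P (PD _ _ h' h) _ (subrKA _ _ _)) xA.
have [Pi Pi0] : P (wt i) /\ P0 (wt i) by move: iA; rewrite inE => /asboolP.
have wi : wt i != 0 by exact: (posys_neq0 hP).
have si : simple_root P i.
  split=> // j k Pj Pk e.
  have [Pj0|Nj0] := PT0 j (posys_neq0 hP Pj).
    have jA : j \in A P by rewrite inE; exact/asboolP.
    by apply: (imin j jA); rewrite e addrC addKr.
  have [Pk0|Nk0] := PT0 k (posys_neq0 hP Pk).
    have kA : k \in A P by rewrite inE; exact/asboolP.
    by apply: (imin k kA); rewrite e addrK.
  by apply: (posys_asym hP0 Pi0); rewrite e opprD; exact: PD0.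
have [w' [Lw' w'0 sw' dom']] := reflection_step hP si Lw w0 sw hdom.
apply: (IH _ _ w' (posys_reflect hP wi) Lw' w'0 sw' dom').
rewrite -ltnS; apply: leq_trans cA; apply: proper_card; apply/properP; split.
  apply/fintype.subsetP => q; rewrite inE => /asboolP [Pq Pq0].
  have [e|[Pq' _]] := reflect_positive hP si Pq.
    by exfalso; apply: (posys_asym hP0 Pi0); rewrite -e.
  by rewrite inE; apply/asboolP; split.
exists i => //; rewrite inE; apply/negP => /asboolP [Pr _].
by rewrite reflect_self // in Pr; exact: (posys_asym hP Pi).
Qed.

(** The vectors on which [X b`_q] is nilpotent form a submodule, because [ad b`_q]
    is nilpotent; it contains the lowest vector. *)
Lemma locally_nilpotent (q : 'I_n) u : P0 (- wt q) -> L u -> exists k, iter k (X b`_q) u = 0.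
Proof.
move=> Pq Lu; have [w [Lw w0 kw]] := lowest_vector.
have wq : wt q != 0 by rewrite -oppr_eq0; exact: (posys_neq0 hP0).
pose Q (y : M) := exists k, iter k (X b`_q) y = 0.
have hQ : subsp Q.
  split=> [|a x y [k hk] [m hm]]; first by exists 0%N.
  exists (k + m)%N; rewrite iter_addv iterZ (iter_wide _ hk) ?leq_addr //.
  by rewrite (iter_wide _ hm) ?leq_addl // scaler0 addr0.
apply: (irreducible_span Lw w0 hQ _ _ Lu); last by exists 1%N; exact: kw.
move=> x y [m hm]; apply: (act_basis_ind (B := B)) => // i _.
have := root_nilpotent 1 wq (hw i); rewrite scale1r => -[k hk].
exists (k + m)%N.
apply: (@leibniz_nil F M (X b`_q) g M (fun x y => X x y) (ad g b`_q) (X b`_q)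
  (fun x => x = 0) (fun x => exists a, x \in component g a) (fun y => y = 0)) => //.
- move=> z y' [a za]; split; first by exists (rb_deg B q + a); rewrite ad_graded.
  exists 1, (sign F (rb_deg B q) a).
  by rewrite scale1r (act_bracket X y' (hd q) za) subrK.
- by move=> z y' ->; rewrite act0l.
- by move=> z y' ->; rewrite linear0.
- by exists (rb_deg B i).
Qed.

(** Add the negative roots one at a time, the most negative ones first, so that
    the root vectors already added form an ideal; each step multiplies the
    spanning set by finitely many powers of the new root vector. *)
Lemma finite_span : exists s : seq M, forall u, L u <-> lspan s u.
Proof.
have [P00 PD PT] := hP0.
pose lower (A : {set 'I_n}) := (forall q, q \in A -> P0 (- wt q)) /\
  (forall q r, q \in A -> P0 (- wt r) -> P0 (wt q - wt r) -> r \in A).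
suff H m (A : {set 'I_n}) : lower A -> #|A| = m -> exists s : seq M,
    [/\ (forall u, u \in s -> L u), lspan s v &
        forall q u, q \in A -> lspan s u -> lspan s (X b`_q u)].
  have lA : lower [set q | `[< P0 (- wt q) >]].
    split=> [q|q r _ Pr _]; first by rewrite inE => /asboolP.
    by rewrite inE; apply/asboolP.
  have [s [sL sv' st]] := H _ _ lA erefl; exists s => u; split; last first.
    by apply: lspan_sub.
  apply: sum_of_ind => [|y [c [w [nw ->]]]]; first exact: lspan_subsp.
  apply: subspZ; first exact: lspan_subsp.
  elim: w nw => //= q w IH nw; apply: st; first by rewrite inE; apply/asboolP; apply: nw; rewrite mem_head.
  by apply: IH => r rw; apply: nw; rewrite inE rw orbT.
elim: m A => [|m IH] A lA cA.
  exists [:: v]; split=> [u||q u]; first by rewrite inE => /eqP ->.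
    by apply: lspan_mem; rewrite mem_head.
  by rewrite (cards0_eq cA) inE.
have [x xA] : exists x, x \in A by apply/card_gt0P; rewrite cA.
have [i iA imax] := @finset_minimal _ (fun j k => P0 (wt j - wt k)) A x
  (fun j h => P00 (eq_ind _ P0 h _ (subrr (wt j))))
  (fun j k l h h' => eq_ind _ P0 (PD _ _ h h') _ (subrKA _ _ _)) xA.
have [An Al] := lA; have Pi := An i iA.
have lA' : lower (A :\ i).
  split=> [q|q r]; rewrite !inE => /andP[qi qA]; first exact: An.
  move=> Pr Pqr; rewrite (Al q r) // andbT; apply/eqP => ri.
  by apply: (imax q qA); rewrite -ri.
have cA' : #|A :\ i| = m by move: cA; rewrite (cardsD1 i) iA add1n => -[].
have [s [sL sv' st]] := IH _ lA' cA'.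
have [K hK] : exists K, forall u, u \in s -> iter K (X b`_i) u = 0.
  elim: (s) (sL) => [|u s' IHs] hs'; first by exists 0%N.
  have [k hk] := locally_nilpotent Pi (hs' u (mem_head _ _)).
  have [K hK] := IHs (fun y ys => hs' y (mem_behead (s := u :: s') ys)).
  exists (k + K)%N => y; rewrite inE => /orP[/eqP ->|/hK h].
    by rewrite (iter_wide _ hk) // leq_addr.
  by rewrite (iter_wide _ h) // leq_addl.
pose f := X b`_i.
pose s2 := [seq iter k f u | u <- s, k <- iota 0 K.+1].
have s2P u k : u \in s -> lspan s2 (iter k f u).
  move=> us; case: (ltnP k K.+1) => kK.
    by apply: lspan_mem; apply/allpairsP; exists (u, k); rewrite mem_iota.
  by rewrite (iter_wide _ (hK u us)) ?(ltnW kK) //; case: (lspan_subsp s2).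
have fst2 u : lspan s2 u -> lspan s2 (f u).
  apply: (lspan_sub (subsp_preim f (lspan_subsp s2))) => y /allpairsP [[z k] [/= zs _ ->]].
  exact: (s2P z k.+1).
have ss2 u : lspan s u -> lspan s2 u.
  by apply: lspan_sub => [|y ys]; [exact: lspan_subsp|exact: (s2P y 0%N)].
have main k u j : j \in A :\ i -> lspan s u -> lspan s2 (X b`_j (iter k f u)).
  elim: k u j => [|k IHk] u j jA hu; first by apply: ss2; exact: st.
  rewrite iterS; have := act_bracket X (iter k f u) (hd j) (hd i).
  move=> /eqP; rewrite eq_sym subr_eq => /eqP ->.
  apply: subspD; first exact: lspan_subsp; last first.
    by apply: subspZ; [exact: lspan_subsp|apply: fst2; exact: IHk].
  apply: (act_basis_ind (B := B)); first exact: lspan_subsp.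
  move=> p cp; apply: IHk => //; have wp := coord_rb (ad_rb _ _) cp.
  have Pj : P0 (- wt j) by apply: An; move: jA; rewrite inE => /andP[].
  have jA' : j \in A by move: jA; rewrite inE => /andP[].
  rewrite !inE; apply/andP; split.
    apply/eqP => pi; apply: P00; rewrite -(_ : - wt j = 0) //.
    by apply/eqP; rewrite oppr_eq0 -(inj_eq (addIr (wt i))) add0r -wp pi.
  by apply: (Al j p jA'); rewrite wp opprD; [exact: PD|rewrite addrA subrr add0r].
exists s2; split.
- move=> y /allpairsP [[z k] [/= zs _ ->]]; exact: iter_L (sL z zs).
- exact: ss2.
- move=> q u qA; have [->|qi] := eqVneq q i; first exact: fst2.
  apply: (lspan_sub (subsp_preim (X b`_q) (lspan_subsp s2))) => y /allpairsP [[z k] [/= zs _ ->]].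
  by apply: main; [rewrite !inE qi|exact: lspan_mem].
Qed.

End FiniteDimension.

Section FiniteRestriction.
Variables (F : fieldType) (g : gradedLieAlgebra F) (M : lmodType F) (X : action g M).
Variables (L : M -> Prop).
Hypotheses (hL : subsp L) (Lact : forall x u, L u -> L (X x u)).

Let comb m (e : 'I_m -> M) (r : 'rV[F]_m) : M := \sum_(i < m) r 0 i *: e i.

Let comb_linear m (e : 'I_m -> M) a (x y : 'rV[F]_m) :
  comb e (a *: x + y) = a *: comb e x + comb e y.
Proof.
rewrite /comb scaler_sumr -big_split; apply: eq_bigr => i _.
by rewrite !mxE scalerDl scalerA.
Qed.

(** A spanning family of minimal size has no linear relation. *)
Lemma finite_coordinates s : (forall u, L u <-> lspan s u) ->
  exists m (f : 'rV[F]_m -> M), [/\ linear f, injective f & forall u, L u <-> exists r, f r = u].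
Proof.
move=> hs; pose spanning m := exists2 e : 'I_m -> M, (forall i, L (e i)) &
  forall u, L u -> exists r, comb e r = u.
have ex : exists m, `[< spanning m >].
  exists (size s); apply/asboolP; exists (fun i => s`_i) => [i|u /hs].
    by apply/hs; apply: lspan_mem; rewrite mem_nth.
  apply: (lspan_sub (Q := fun u => exists r, comb _ r = u)); first split.
  - by exists 0; rewrite /comb big1 // => i _; rewrite mxE scale0r.
  - by move=> a _ _ [x <-] [y <-]; exists (a *: x + y); rewrite comb_linear.
  move=> y ys; have ky : (index y s < size s)%N by rewrite index_mem.
  exists (delta_mx 0 (Ordinal ky)); rewrite /comb (bigD1 (Ordinal ky)) //= big1 => [|i ik].
    by rewrite mxE !eqxx scale1r addr0 nth_index.
  by rewrite mxE (negbTE ik) andbF scale0r.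
have [m /asboolP [e eL he] mmin] := ex_minnP ex.
exists m, (comb e); split; first exact: comb_linear.
  move=> x y exy; apply/eqP; rewrite -subr_eq0; apply: contraT => nz.
  have /rV0Pn [i ri] := nz; set r := x - y in ri.
  have cr : comb e r = 0.
    by rewrite /r -[x - y]addrC -scaleN1r comb_linear scaleN1r exy addNr.
  case: m e i eL he mmin x y exy r nz ri cr => [e []//|k] e i eL he mmin x y _ r _ ri cr.
  suff /mmin : `[< spanning k >] by rewrite ltnn.
  apply/asboolP; exists (fun j => e (lift i j)) => // u /he [r' <-].
  pose w := (- (r' 0 i / r 0 i)) *: r + r'.
  exists (col' i w); have <- : comb e w = comb e r' by rewrite comb_linear cr scaler0 add0r.
  rewrite /comb [RHS](bigD1_ord i) //= !mxE mulNr divfK // addNr scale0r add0r.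
  by apply: eq_bigr => j _; rewrite !mxE.
by move=> u; split=> [/he //|[r <-]]; apply: subsp_sum => // i _; apply: subspZ.
Qed.

Lemma finite_restriction s : (forall u, L u <-> lspan s u) ->
  exists (rho : representation g) (f : rep_space rho -> M),
  [/\ linear f, injective f, (forall u, L u <-> exists r, f r = u) &
      forall x r, f (rho x r) = X x (f r)].
Proof.
move=> /finite_coordinates [m [f [lf fi hf]]].
have [A hA] : exists A : g * 'rV[F]_m -> 'rV[F]_m, forall p, f (A p) = X p.1 (f p.2).
  have ex (p : g * 'rV[F]_m) : exists y, f y = X p.1 (f p.2).
   by apply/hf; apply: Lact; apply/hf; exists p.2.
  by have [A hA] := choice ex; exists A.
have lf' a x y : f (a *: x + y) = a *: f x + f y := lf a x y.
have fB x y : f (x - y) = f x - f y by have := lf' (-1) y x; rewrite !scaleN1r [- y + x]addrC [- f y + f x]addrC.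
have fZ a x : f (a *: x) = a *: f x.
  by have := lf' a x 0; rewrite -(subrr 0) fB !subrr !addr0.
have [A' hA'] : exists A' : g -> 'End('rV[F]_m), forall x r, f (A' x r) = X x (f r).
  have ex (x : g) : exists h : 'End('rV[F]_m), forall r, f (h r) = X x (f r).
    have [|h hh] := @hom_exists F _ _ (fun r => A (x, r)); last by exists h => r; rewrite hh hA.
    by move=> a u v; apply: fi; rewrite lf' !hA /= lf linearP.
  by have [A' hA'] := choice ex; exists A'.
have [|h hh] := @hom_exists F g _ A'.
  move=> a x y; apply/lfunP => r; apply: fi.
  by rewrite !lfun_simp lf' !hA' act_linear.
have br a b x y : x \in component g a -> y \in component g b ->
    h (ad g x y) = (h x \o h y)%VF - sign F a b *: (h y \o h x)%VF.
  move=> xa yb; apply/lfunP => r; apply: fi.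
  by rewrite !lfun_simp fB fZ !hh !hA' (act_bracket X _ xa yb).
by exists (Representation br), f; split=> // x r; rewrite /= hh hA'.
Qed.
End FiniteRestriction.


Section Existence.
Variables (F : numClosedFieldType) (g : gradedLieAlgebra F) (t : {vspace g}).
Local Notation dual := (dual_space t).
Variable B : root_basis t.
Variables (P : dual -> Prop) (hP : posys B P) (Dp : set dual).
Hypothesis hDp : forall alpha, Dp alpha <-> roots t alpha /\ P alpha.

Lemma irreducible_exists (chi : dual) : dominant_for B P chi ->
  exists2 rho : representation g, irreducible rho & is_highest_weight Dp rho chi.
Proof.
move=> dom; have [v [v0 sv irr]] := highest_weight_module hP chi.
have [s hs] := finite_span hP v0 sv irr dom.
have hL := @descendant_subsp _ _ _ B P _ (coloured_action B) v.
have [rho [f [lf fi hf fX]]] := finite_restriction hL (descendant_stable hP sv) hs.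
have lf' a x y : f (a *: x + y) = a *: f x + f y := lf a x y.
have f0 : f 0 = 0 by have := lf' (-1) 0 0; rewrite scaler0 addr0 scaleN1r addNr.
have [w fw] : exists w, f w = v by apply/hf; exact: (@descendant_word _ _ _ B P _ _ v [::]).
have w0 : w != 0 by apply: contra_neq v0 => w0; rewrite -fw w0.
have irho : irreducible rho.
  split=> [/vspaceP /(_ w)|U hU]; first by rewrite memvf memv0 (negbTE w0).
  have [U0|[u uU u0]] : U = 0%VS \/ exists2 u, u \in U & u != 0.
    have [->|] := eqVneq U 0%VS; [by left|right].
    by exists (vpick U); rewrite ?memv_pick // vpick0.
  by left.
  right; apply/vspaceP => z; rewrite memvf.
  pose Q y := exists2 r, r \in U & f r = y.
  have hQ : subsp Q.
    split=> [|a _ _ [x xU <-] [y yU <-]]; first by exists 0; rewrite ?mem0v.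
    by exists (a *: x + y); rewrite ?memvD ?memvZ.
  have Qfz : Q (f z).
    apply: (irreducible_span irr (u := f u) _ _ hQ _ _ (z := f z)).
    - by apply/hf; exists u.
    - by apply: contra_neq u0 => fu; apply: fi; rewrite fu.
    - by move=> x _ [r rU <-]; exists (rho x r); rewrite ?hU ?fX.
    - by exists u.
    - by apply/hf; exists z.
  by case: Qfz => r rU /fi <-.
exists rho => //; apply: (singular_highest hP hDp irho w0).
have [hv kv] := sv; split=> [h|i Pi]; apply: fi; rewrite fX fw.
  have -> : f (chi h *: w) = chi h *: v.
    by rewrite -[_ *: w]addr0 lf' f0 addr0 fw.
  exact: hv.
by rewrite f0; exact: kv.
Qed.

End Existence.

(** * The parametrization *)

Section RealForm.
Variables (R : realType) (g : gradedLieAlgebra R[i]) (t : {vspace g}).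
Local Notation dual := (dual_space t).
Variable B : root_basis t.
Local Notation wt := (rb_wt B).

Lemma real_span_closed (x y : dual) :
  real_span (roots t) x -> real_span (roots t) y -> real_span (roots t) (x + y).
Proof.
move=> [s [hs ->]] [s' [hs' ->]]; exists (s ++ s'); rewrite big_cat; split=> // p.
by rewrite mem_cat => /orP[/hs|/hs'].
Qed.

Lemma real_span_root (x : dual) : roots t x -> real_span (roots t) x.
Proof.
move=> rx; exists [:: (1, x)]; rewrite big_seq1 scale1r; split=> // p.
by rewrite inE => /eqP ->.
Qed.

(** The given positivity is constrained only on the nonzero elements of the real
    span of the roots; restricted to these it is additive on the whole dual. *)
Lemma positivity_posys (P : set dual) : positivity (real_span (roots t)) P ->
  posys B (fun x => [/\ x != 0, real_span (roots t) x & P x]).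
Proof.
move=> [P0 PD _]; split=> [|x y [x0 xs Px] [y0 ys Py]|i i0].
- by rewrite eqxx => -[].
- split; [|exact: real_span_closed|exact: PD].
  apply/eqP => /eqP; rewrite addr_eq0 => /eqP e.
  have [_] := P0 y ys y0; apply; split=> //; by rewrite -e.
- have ri : roots t (wt i) by apply/(rootsP B); split=> //; exists i.
  have [j [wj _ _]] := partner i; have nj : - wt i != 0 by rewrite oppr_eq0.
  have rj : roots t (- wt i) by apply/(rootsP B); split=> //; exists j.
  have si := real_span_root ri; have sj := real_span_root rj.
  by have [[Pi|Pi] _] := P0 _ si i0; [left|right].
Qed.

End RealForm.

Local Open Scope classical_set_scope.
Local Open Scope complex_scope.

Theorem theorem3p1 (R : realType) (g : gradedLieAlgebra R[i])
    (t : {vspace g}) (Dp : set (dual_space t)) :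
  basic g -> simple g -> cartan_subalgebra t -> self_centralizing t ->
  positive_system Dp ->
  (forall rho : representation g, irreducible rho ->
     exists! lambda : dual_space t, is_highest_weight Dp rho lambda) /\
  (exists hw : representation g -> dual_space t,
     (forall rho : representation g, irreducible rho ->
        is_highest_weight Dp rho (hw rho)) /\
     induces_bijection_on_classes (dominant_integral Dp) hw).
Proof.
move=> [hK _] _ ht hs [P0 hP0 DpE].
have [B _] := root_basis_exists ht hs hK.
pose P x := [/\ x != 0, real_span (roots t) x & P0 x].
have hP : posys B P by exact: positivity_posys.
have hDp alpha : Dp alpha <-> roots t alpha /\ P alpha.
  rewrite DpE; split=> [[ra Pa]|[ra [_ _ Pa]]]; split=> //; split=> //.
    by case: ra.
  exact: real_span_root.
have hwu := highest_weight_unique hP hDp.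
have ex (rho : representation g) : exists lambda : dual_space t,
    irreducible rho -> is_highest_weight Dp rho lambda.
  have [irr|nirr] := pselect (irreducible rho); last by exists 0.
  by have [mu [v [_ _ hmu]]] := highest_weight_exists hP hDp irr; exists mu.
have [hw hhw] := choice ex.
split=> [rho irr|].
  by exists (hw rho); split=> [|mu hmu]; [exact: hhw|exact: hwu (hhw _ irr) hmu].
exists hw; split=> //; split=> [rho irr|rho sigma irho isigma e|rho sigma irho isigma e|chi [dom hint]].
- by have [h1 h2] := highest_weight_dominant hP hDp irr (hhw _ irr); split.
- by apply: (hwu sigma) => //; [apply: equiv_highest_weight e _|]; exact: hhw.
- have hs' := hhw _ isigma; rewrite -e in hs'.
  have [v v0 sv] := highest_weight_singular hP hDp irho (hhw _ irho).
  have [w w0 sw] := highest_weight_singular hP hDp isigma hs'.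
  by have := equiv_of_singular hP irho isigma v0 w0 sv sw.
have domP : dominant_for B P chi.
  move=> i Pi; have Di : Dp (rb_wt B i).
    apply/hDp; split=> //; have [i0 _ _] := Pi.
    by apply/(rootsP B); split=> //; exists i.
  have [ri _] := proj1 (hDp _) Di.
  have [m hm] := hint _ ri; have := dom _ Di.
  rewrite (hrootE B) hm ler0z; case: m {hm} => // m _; exists m.
  by rewrite -pmulrn.
have [rho irr hrho] := irreducible_exists hP hDp domP.
by exists rho => //; exact: hwu (hhw _ irr) hrho.
Qed.
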